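(* For all integers $n\geq 55$, \[f(n)<u_n<g(n),\] where $u_n$, $f(n)$, $g(n)$ are as defined in the context.
   Context: $\overline{p}(n)$ denotes the number of overpartitions of $n$ (partitions of $n$ in which the first occurrence of each distinct part may be overlined), and $u_n=\dfrac{\overline{p}(n-1)\overline{p}(n+1)}{\overline{p}(n)^2}$. Let $\mu(m)=\pi\sqrt{m}$. For an integer $n\geq 2$ put $x=\mu(n-1)$, $y=\mu(n)$, $z=\mu(n+1)$, and define \[f(n)=e^{x-2y+z}\,\frac{y^{14}(x^5-x^4-1)(z^5-z^4-1)}{x^7z^7(y^5-y^4+1)^2},\qquad g(n)=e^{x-2y+z}\,\frac{y^{14}(x^5-x^4+1)(z^5-z^4+1)}{x^7z^7(y^5-y^4-1)^2}.\] *)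

(* Defs.v *)
From Stdlib Require Import Reals List Arith.
Import ListNotations.
Open Scope R_scope.

(* An overpartition of s is represented as a list of parts (p, b) with
   p >= 1 and b = true meaning "overlined", listed in nonincreasing order of
   parts, where among equal parts only the first occurrence may be overlined.
   [op_gen fuel s] lists every list of pairs (p,b), p >= 1, with sum of parts
   equal to s (each such list exactly once, given enough fuel). *)
Fixpoint op_gen (fuel s : nat) : list (list (nat * bool)) :=
  match fuel with
  | O => match s with O => [[]] | S _ => [] end
  | S f =>
      match s with
      | O => [[]]
      | S _ =>
          flat_map (fun p =>
            flat_map (fun b =>
              map (cons (p, b)) (op_gen f (s - p)))
            [false; true])
          (seq 1 s)
      end
  end.

Fixpoint op_valid (l : list (nat * bool)) : bool :=
  match l with
  | (p, _) :: ((p', b') :: _) as t =>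
      Nat.leb p' p && (negb (Nat.eqb p p') || negb b') && op_valid t
  | _ => true
  end.

Definition pbar (n : nat) : nat := length (filter op_valid (op_gen n n)).

Definition u_seq (n : nat) : R :=
  INR (pbar (n - 1)) * INR (pbar (n + 1)) / (INR (pbar n)) ^ 2.

Definition mu (m : nat) : R := PI * sqrt (INR m).

Definition f_low (n : nat) : R :=
  let x := mu (n - 1) in let y := mu n in let z := mu (n + 1) in
  exp (x - 2 * y + z) *
  (y ^ 14 * (x ^ 5 - x ^ 4 - 1) * (z ^ 5 - z ^ 4 - 1)
   / (x ^ 7 * z ^ 7 * (y ^ 5 - y ^ 4 + 1) ^ 2)).

Definition g_up (n : nat) : R :=
  let x := mu (n - 1) in let y := mu n in let z := mu (n + 1) in
  exp (x - 2 * y + z) *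
  (y ^ 14 * (x ^ 5 - x ^ 4 + 1) * (z ^ 5 - z ^ 4 + 1)
   / (x ^ 7 * z ^ 7 * (y ^ 5 - y ^ 4 - 1) ^ 2)).

(* Main.v *)
Require Import Defs.
From Stdlib Require Import Reals Lra Lia Arith List Bool.
From Coquelicot Require Import Coquelicot.
Import ListNotations.
Open Scope R_scope.
Set Bullet Behavior "Strict Subproofs".

(* Since [(x^5 - x^4 -+ 1) / x^7] is [(1 - 1/x -+ 1/x^5) / x^2], both bounds follow for large n
   from |8 n e^(-mu) pbar(n) - (1 - 1/mu)| < 1/mu^5 with mu = pi sqrt n.

   By Gauss's identity the overpartition series is F(q) = 1 / sum_k (-1)^k q^(k^2). Poisson
   summation inverts this theta function near q = 1, where F(e^(-s)) is, up to a bounded error,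
   half of the integral of exp (p (1 - v^2)) over [0, 1], with p = pi^2 / (4 s). Expanding the
   integral in powers of 1/s and replacing each power by a power sum gives an entire function
   of n, namely (cosh mu - sinh mu / mu) / (4 n), as main term. Away from q = 1 the product
   formula of F makes |F| exponentially smaller than at q = |q|. Cauchy's estimate on the circle
   |q| = exp (- pi / (2 sqrt n)) then gives the asymptotic with an exponentially small relative
   error, which suffices for n > 1000.

   For n <= 1000 the values of pbar come from the recurrence given by Gauss's identity, and the
   inequalities are checked in fixed-point arithmetic with directed rounding. *)

(** * Complex sums, limits, derivatives and the exponential *)

(** In the exact inversion F(e^(-s)) = g / H, the factor g is the Gaussian integral over the half
    line, a multiple of sqrt s, with a branch point at s = 0. After multiplication by e^p its part
    beyond u = 1/2 is at most 1/4 when Re p >= 1, so cutting there costs a bounded error and leaves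
    an entire function of p = pi^2 / (4 s), hence a series in integral powers of 1/s. The sum of m^i
    / i! e^(-m s) differs from 1/s^(i+1) by at most 10 2^i uniformly on the strip |Im s| <= pi, for
    Re s <= 1/20, and the factorials in the coefficients absorb this growth, so power sums replace
    powers at the cost of a constant. The one remaining error that grows as t = Re s decreases is
    that of F where Re p < 1, of size exp (pi^2 / (4 t) - 2 / t). At t = pi^2 / (2 mu) one has pi^2
    / (4 t) + n t = mu, and the gain 2 / t = 4 mu / pi^2 beats a polynomial loss of order mu^7 once
    mu >= 99, whence the split at n = 1000. Contour integrals are replaced throughout by derivatives
    along a real parameter and the mean value inequality. *)

Lemma im_le_Cmod (z : C) : Rabs (Im z) <= Cmod z.
Proof. apply Rle_trans with (2 := Rmax_Cmod z), Rmax_r. Qed.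

Lemma Cmod_minus_rev (x y : C) : Cmod x - Cmod y <= Cmod (x - y).
Proof.
  pose proof (Cmod_triangle (x - y) y).
  replace (x - y + y)%C with x in H by ring. lra.
Qed.

Lemma Cmod_minus_sym (x y : C) : Cmod (x - y) = Cmod (y - x).
Proof. rewrite <- Cmod_opp. f_equal. ring. Qed.

Lemma Cmod_minus_triangle (x y : C) : Cmod (x - y) <= Cmod x + Cmod y.
Proof.
  unfold Cminus. eapply Rle_trans; [apply Cmod_triangle|]. rewrite Cmod_opp. lra.
Qed.

Lemma C_eq (x y : C) : Re x = Re y -> Im x = Im y -> x = y.
Proof. destruct x, y; unfold Re, Im; simpl; intros; subst; reflexivity. Qed.

Lemma RtoC_neq_0 (x : R) : x <> 0 -> RtoC x <> RtoC 0.
Proof. intros H E. apply H. now apply RtoC_inj. Qed.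

Fixpoint rsum (f : nat -> R) (n : nat) : R :=
  match n with O => 0 | S k => rsum f k + f k end.

Fixpoint csum (f : nat -> C) (n : nat) : C :=
  match n with O => RtoC 0 | S k => (csum f k + f k)%C end.

Lemma rsum_ext f g n : (forall i, (i < n)%nat -> f i = g i) -> rsum f n = rsum g n.
Proof.
  induction n; simpl; intros H; [reflexivity|].
  rewrite IHn, H; [reflexivity|lia|]. intros; apply H; lia.
Qed.

Lemma csum_ext f g n : (forall i, (i < n)%nat -> f i = g i) -> csum f n = csum g n.
Proof.
  induction n; simpl; intros H; [reflexivity|].
  rewrite IHn, H; [reflexivity|lia|]. intros; apply H; lia.
Qed.

Lemma rsum_le f g n : (forall i, (i < n)%nat -> f i <= g i) -> rsum f n <= rsum g n.
Proof.
  induction n; simpl; intros H; [lra|].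
  apply Rplus_le_compat; [apply IHn; intros; apply H; lia|apply H; lia].
Qed.

Lemma rsum_ge0 f n : (forall i, (i < n)%nat -> 0 <= f i) -> 0 <= rsum f n.
Proof.
  induction n; simpl; intros H; [lra|].
  apply Rplus_le_le_0_compat; [apply IHn; intros; apply H; lia|apply H; lia].
Qed.

Lemma rsum_scal c f n : rsum (fun i => c * f i) n = c * rsum f n.
Proof. induction n; simpl; [ring|rewrite IHn; ring]. Qed.

Lemma rsum_plus f g n : rsum (fun i => f i + g i) n = rsum f n + rsum g n.
Proof. induction n; simpl; [ring|rewrite IHn; ring]. Qed.

Lemma csum_scal c f n : csum (fun i => c * f i)%C n = (c * csum f n)%C.
Proof. induction n; simpl; [ring|rewrite IHn; ring]. Qed.

Lemma csum_plus f g n : csum (fun i => f i + g i)%C n = (csum f n + csum g n)%C.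
Proof. induction n; simpl; [ring|rewrite IHn; ring]. Qed.

Lemma csum_minus f g n : csum (fun i => f i - g i)%C n = (csum f n - csum g n)%C.
Proof. induction n; simpl; [ring|rewrite IHn; ring]. Qed.

Lemma Re_csum f n : Re (csum f n) = rsum (fun i => Re (f i)) n.
Proof. induction n; simpl; [reflexivity|rewrite <- IHn; reflexivity]. Qed.

Lemma RtoC_rsum f n : RtoC (rsum f n) = csum (fun i => RtoC (f i)) n.
Proof. induction n; simpl; [reflexivity|rewrite RtoC_plus, IHn; reflexivity]. Qed.

Lemma Cmod_csum f n : Cmod (csum f n) <= rsum (fun i => Cmod (f i)) n.
Proof.
  induction n; simpl; [rewrite Cmod_0; lra|].
  eapply Rle_trans; [apply Cmod_triangle|lra].
Qed.

Lemma rsum_le_mono f n m :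
  (forall i, 0 <= f i) -> (n <= m)%nat -> rsum f n <= rsum f m.
Proof. intros H L. induction L; [lra|]. simpl. specialize (H m). lra. Qed.

Lemma csum_diff_le f g n m : (forall i, Cmod (f i) <= g i) -> (n <= m)%nat ->
  Cmod (csum f m - csum f n) <= rsum g m - rsum g n.
Proof.
  intros H L. induction L.
  - replace (csum f n - csum f n)%C with (RtoC 0) by ring. rewrite Cmod_0; lra.
  - simpl. replace (csum f m + f m - csum f n)%C with ((csum f m - csum f n) + f m)%C by ring.
    eapply Rle_trans; [apply Cmod_triangle|]. specialize (H m). lra.
Qed.

Lemma csum_shift f n : csum f (S n) = (f O + csum (fun i => f (S i)) n)%C.
Proof. induction n; [simpl; ring|]. simpl in *. rewrite IHn. ring. Qed.

Lemma rsum_shift f n : rsum f (S n) = f O + rsum (fun i => f (S i)) n.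
Proof. induction n; [simpl; ring|]. simpl in *. rewrite IHn. ring. Qed.

Lemma rsum_0 f n : (forall i, (i < n)%nat -> f i = 0) -> rsum f n = 0.
Proof.
  induction n; simpl; intros H; [reflexivity|].
  rewrite IHn, H; [ring|lia|]. intros; apply H; lia.
Qed.

Lemma rsum_sum_f_R0 f n : sum_f_R0 f n = rsum f (S n).
Proof. induction n; simpl in *; [ring|rewrite IHn; ring]. Qed.

Lemma rsum_rev f n : rsum (fun i => f (n - 1 - i)%nat) n = rsum f n.
Proof.
  induction n; [reflexivity|]. rewrite rsum_shift. cbn [rsum].
  replace (S n - 1 - 0)%nat with n by lia. rewrite <- IHn, Rplus_comm. f_equal.
  apply rsum_ext. intros i Hi. f_equal. lia.
Qed.

Lemma csum_exchange (f : nat -> nat -> C) n m :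
  csum (fun i => csum (fun j => f i j) m) n = csum (fun j => csum (fun i => f i j) n) m.
Proof.
  induction n; simpl.
  - induction m; simpl; [reflexivity|rewrite <- IHm; ring].
  - rewrite IHn, <- csum_plus. reflexivity.
Qed.

(** Convergence by components, with a finite limit built in, so that limit arguments reduce to the
    real theory. *)
Definition Clim (u : nat -> C) (l : C) : Prop :=
  is_lim_seq (fun n => Re (u n)) (Re l) /\ is_lim_seq (fun n => Im (u n)) (Im l).

Lemma Clim_ext u v l : (forall n, u n = v n) -> Clim u l -> Clim v l.
Proof.
  intros E [H1 H2]; split; (eapply is_lim_seq_ext; [|eassumption]); intros n; simpl; now rewrite E.
Qed.

Lemma Clim_const c : Clim (fun _ => c) c.
Proof. split; apply is_lim_seq_const. Qed.

Lemma Clim_plus u v a b : Clim u a -> Clim v b -> Clim (fun n => u n + v n)%C (a + b)%C.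
Proof. intros [H1 H2] [H3 H4]; split; simpl; apply is_lim_seq_plus'; assumption. Qed.

Lemma Clim_opp u a : Clim u a -> Clim (fun n => - u n)%C (- a)%C.
Proof.
  intros [H1 H2]; split; simpl;
    [apply (is_lim_seq_opp _ (Re a)); exact H1|apply (is_lim_seq_opp _ (Im a)); exact H2].
Qed.

Lemma Clim_minus u v a b : Clim u a -> Clim v b -> Clim (fun n => u n - v n)%C (a - b)%C.
Proof. intros; apply Clim_plus; [|apply Clim_opp]; assumption. Qed.

Lemma Clim_mult u v a b : Clim u a -> Clim v b -> Clim (fun n => u n * v n)%C (a * b)%C.
Proof.
  intros [H1 H2] [H3 H4]; split; simpl.
  - apply is_lim_seq_minus'; apply is_lim_seq_mult'; assumption.
  - apply is_lim_seq_plus'; apply is_lim_seq_mult'; assumption.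
Qed.

Lemma Clim_scal c u a : Clim u a -> Clim (fun n => c * u n)%C (c * a)%C.
Proof. intros; apply Clim_mult; [apply Clim_const|assumption]. Qed.

Lemma Clim_unique u a b : Clim u a -> Clim u b -> a = b.
Proof.
  intros [H1 H2] [H3 H4].
  apply is_lim_seq_unique in H1, H2, H3, H4.
  apply C_eq; congruence.
Qed.

Lemma Clim_RtoC (u : nat -> R) (l : R) : is_lim_seq u l -> Clim (fun n => RtoC (u n)) (RtoC l).
Proof. intros H; split; simpl; [exact H|apply is_lim_seq_const]. Qed.

Lemma Clim_Cmod u a : Clim u a -> is_lim_seq (fun n => Cmod (u n)) (Cmod a).
Proof.
  intros [H1 H2]. unfold Cmod.
  apply is_lim_seq_continuous with (f := sqrt).
  - apply continuity_pt_sqrt.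
    pose proof (pow2_ge_0 (fst a)); pose proof (pow2_ge_0 (snd a)); lra.
  - simpl. apply is_lim_seq_plus'; repeat apply is_lim_seq_mult'; try apply is_lim_seq_const; assumption.
Qed.

Lemma Clim_of_dist u a v :
  (forall n, Cmod (u n - a) <= v n) -> is_lim_seq v 0 -> Clim u a.
Proof.
  intros H Hv.
  assert (K : forall w : nat -> R, forall l, (forall n, Rabs (w n - l) <= v n) -> is_lim_seq w l).
  { intros w l Hw.
    apply is_lim_seq_ext with (fun n => (w n - l) + l); [intros; ring|].
    replace (Finite l) with (Finite (0 + l)) by (f_equal; ring).
    apply is_lim_seq_plus'; [|apply is_lim_seq_const].
    apply is_lim_seq_abs_0.
    apply is_lim_seq_le_le with (fun _ => 0) v; [|apply is_lim_seq_const|assumption].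
    intros n; split; [apply Rabs_pos|apply Hw]. }
  split; apply K; intros n; (eapply Rle_trans; [|apply (H n)]).
  - apply (re_le_Cmod (u n - a)).
  - apply (im_le_Cmod (u n - a)).
Qed.

Lemma Clim_Cmod_le u a (v : nat -> R) (b : R) :
  Clim u a -> is_lim_seq v b -> (exists N, forall n, (N <= n)%nat -> Cmod (u n) <= v n) ->
  Cmod a <= b.
Proof.
  intros Hu Hv [N HN].
  assert (H := is_lim_seq_le_loc (fun n => Cmod (u n)) v (Cmod a) b).
  apply H; [|apply Clim_Cmod; assumption|assumption].
  exists N; assumption.
Qed.

Lemma Clim_dist_le u a c B :
  Clim u a -> (exists N, forall n, (N <= n)%nat -> Cmod (u n - c) <= B) -> Cmod (a - c) <= B.
Proof.
  intros Hu HN. apply Clim_Cmod_le with (2 := is_lim_seq_const B) (3 := HN).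
  apply Clim_minus; [assumption|apply Clim_const].
Qed.

Lemma Clim_incr u a k : Clim u a -> Clim (fun n => u (n + k)%nat) a.
Proof. intros [H1 H2]; split; apply is_lim_seq_incr_n with (u := fun n => _ (u n)); assumption. Qed.

Lemma Clim_incr_inv u a k : Clim (fun n => u (n + k)%nat) a -> Clim u a.
Proof.
  intros [H1 H2]; split;
    [apply is_lim_seq_incr_n with (N := k) (u := fun n => Re (u n))
    |apply is_lim_seq_incr_n with (N := k) (u := fun n => Im (u n))]; assumption.
Qed.

Lemma Clim_cauchy u (v : nat -> R) (c : R) :
  is_lim_seq v c -> (forall n m, (n <= m)%nat -> Cmod (u m - u n) <= Rabs (v m - v n)) ->
  exists l, Clim u l.
Proof.
  intros Hv H.
  assert (K : forall w : nat -> R, (forall n m, (n <= m)%nat -> Rabs (w m - w n) <= Rabs (v m - v n)) ->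
            exists l : R, is_lim_seq w l).
  { intros w Hw.
    assert (Cv : ex_lim_seq_cauchy v) by (apply ex_lim_seq_cauchy_corr; exists c; exact Hv).
    assert (Cw : ex_lim_seq_cauchy w).
    { intros eps. destruct (Cv eps) as [N HN]. exists N. intros n m Hn Hm.
      destruct (Nat.le_ge_cases n m) as [L|L].
      - rewrite Rabs_minus_sym. eapply Rle_lt_trans; [apply Hw; exact L|].
        rewrite Rabs_minus_sym. apply HN; assumption.
      - eapply Rle_lt_trans; [apply Hw; exact L|]. apply HN; assumption. }
    apply ex_lim_seq_cauchy_corr in Cw. destruct Cw as [l Hl]; exists l; exact Hl. }
  destruct (K (fun n => Re (u n))) as [a Ha].
  { intros n m L; eapply Rle_trans; [apply (re_le_Cmod (u m - u n))|apply H; exact L]. }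
  destruct (K (fun n => Im (u n))) as [b Hb].
  { intros n m L; eapply Rle_trans; [apply (im_le_Cmod (u m - u n))|apply H; exact L]. }
  exists (a, b); split; assumption.
Qed.

(** Comparison test with a rate: the error at [n] is at most the tail of the majorant. [cauchy_coef]
    uses this rate to pass from truncated sums to the full series uniformly in the angle. *)
Lemma csum_conv f g (c : R) : (forall i, Cmod (f i) <= g i) -> is_lim_seq (rsum g) c ->
  exists l, Clim (csum f) l /\ forall n, Cmod (csum f n - l) <= c - rsum g n.
Proof.
  intros H Hg.
  destruct (Clim_cauchy (csum f) (rsum g) c) as [l Hl]; [assumption| |].
  { intros n m L. eapply Rle_trans; [|apply Rle_abs]. apply csum_diff_le; assumption. }
  exists l; split; [assumption|]. intros n.
  rewrite Cmod_minus_sym.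
  apply Clim_Cmod_le with (u := fun m => (csum f m - csum f n)%C) (v := fun m => rsum g m - rsum g n).
  - apply Clim_minus; [assumption|apply Clim_const].
  - apply is_lim_seq_minus'; [assumption|apply is_lim_seq_const].
  - exists n; intros; apply csum_diff_le; assumption.
Qed.

Lemma rsum_bounded_conv f B :
  (forall i, 0 <= f i) -> (forall n, rsum f n <= B) -> exists l : R, is_lim_seq (rsum f) l.
Proof.
  intros H HB.
  destruct (ex_finite_lim_seq_incr (rsum f) B) as [l Hl]; [|assumption|exists l; exact Hl].
  intros n; simpl; specialize (H n); lra.
Qed.

Lemma rsum_le_lim f (l : R) n : (forall i, 0 <= f i) -> is_lim_seq (rsum f) l -> rsum f n <= l.
Proof.
  intros H Hl. apply (is_lim_seq_incr_compare (rsum f) l); [assumption|].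
  intros k; simpl; specialize (H k); lra.
Qed.

(** Derivative of a complex-valued function of a real variable. Together with [Cmvt] it does the
    work of complex integration below. *)
Definition CD (F : R -> C) (x : R) (l : C) : Prop :=
  is_derive (fun y => Re (F y)) x (Re l) /\ is_derive (fun y => Im (F y)) x (Im l).

Lemma CD_const c x : CD (fun _ => c) x (RtoC 0).
Proof. split; [apply (is_derive_const (Re c) x)|apply (is_derive_const (Im c) x)]. Qed.

Lemma CD_plus F G x a b : CD F x a -> CD G x b -> CD (fun y => F y + G y)%C x (a + b)%C.
Proof.
  intros [H1 H2] [H3 H4]; split; simpl;
    [apply (is_derive_plus (fun y => Re (F y)) (fun y => Re (G y)))
    |apply (is_derive_plus (fun y => Im (F y)) (fun y => Im (G y)))]; assumption.
 Qed.

Lemma CD_minus F G x a b : CD F x a -> CD G x b -> CD (fun y => F y - G y)%C x (a - b)%C.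
Proof.
  intros [H1 H2] [H3 H4]; split; simpl;
    [apply (is_derive_minus (fun y => Re (F y)) (fun y => Re (G y)))
    |apply (is_derive_minus (fun y => Im (F y)) (fun y => Im (G y)))]; assumption.
Qed.

Lemma is_derive_Rmult f g x a b : is_derive f x a -> is_derive g x b ->
  is_derive (fun y => f y * g y) x (a * g x + f x * b).
Proof.
  intros H1 H2. apply (is_derive_mult f g x a b); try assumption.
  intros; apply Rmult_comm.
Qed.

Lemma is_derive_Req (f : R -> R) (x a b : R) : is_derive f x a -> a = b -> is_derive f x b.
Proof. intros; subst; assumption. Qed.

Lemma is_derive_Rplus f g x a b : is_derive f x a -> is_derive g x b ->
  is_derive (fun y => f y + g y) x (a + b).
Proof. apply (is_derive_plus f g). Qed.

Lemma is_derive_Rminus f g x a b : is_derive f x a -> is_derive g x b ->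
  is_derive (fun y => f y - g y) x (a - b).
Proof. apply (is_derive_minus f g). Qed.

Lemma CD_mult F G x a b : CD F x a -> CD G x b ->
  CD (fun y => F y * G y)%C x (a * G x + F x * b)%C.
Proof.
  intros [H1 H2] [H3 H4]; split.
  - eapply is_derive_Req.
    + apply (is_derive_Rminus (fun y => Re (F y) * Re (G y)) (fun y => Im (F y) * Im (G y)));
        apply is_derive_Rmult; eassumption.
    + unfold Re, Im; simpl; ring.
  - eapply is_derive_Req.
    + apply (is_derive_Rplus (fun y => Re (F y) * Im (G y)) (fun y => Im (F y) * Re (G y)));
        apply is_derive_Rmult; eassumption.
    + unfold Re, Im; simpl; ring.
Qed.

Lemma CD_eq F x a b : CD F x a -> a = b -> CD F x b.
Proof. intros; subst; assumption. Qed.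

Lemma CD_ext F G x a : (forall y, F y = G y) -> CD F x a -> CD G x a.
Proof.
  intros E [H1 H2]; split; (eapply is_derive_ext; [|eassumption]); intros; simpl; now rewrite E.
Qed.

Lemma CD_RtoC f x l : is_derive f x l -> CD (fun y => RtoC (f y)) x (RtoC l).
Proof. intros H; split; simpl; [exact H|apply (is_derive_const 0 x)]. Qed.

Lemma CD_id x : CD (fun y => RtoC y) x (RtoC 1).
Proof. apply CD_RtoC, (is_derive_id x). Qed.

Lemma CD_scal c F x a : CD F x a -> CD (fun y => c * F y)%C x (c * a)%C.
Proof.
  intros H. eapply CD_eq; [apply (CD_mult (fun _ => c) F x 0 a); [apply CD_const|exact H]|].
  cbv beta. ring.
Qed.

Lemma Rmvt_le f df a b : a <= b -> (forall x, a <= x <= b -> is_derive f x (df x)) ->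
  (forall x, a <= x <= b -> df x <= 0) -> f b <= f a.
Proof.
  intros L H Hd. destruct (MVT_gen f a b df) as [c [Hc E]].
  - intros x Hx; apply H; rewrite Rmin_left, Rmax_right in Hx; lra.
  - intros x Hx. rewrite Rmin_left, Rmax_right in Hx by lra.
    apply continuity_pt_filterlim, (ex_derive_continuous f).
    eexists; apply H; lra.
  - rewrite Rmin_left, Rmax_right in Hc by lra.
    specialize (Hd c Hc). nra.
Qed.

(* Projecting on the direction of [F b - F a] reduces this to the real mean value theorem. *)
Lemma Cmvt F dF G dG a b : a <= b ->
  (forall x, a <= x <= b -> CD F x (dF x)) -> (forall x, a <= x <= b -> is_derive G x (dG x)) ->
  (forall x, a <= x <= b -> Cmod (dF x) <= dG x) -> Cmod (F b - F a) <= G b - G a.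
Proof.
  intros L HF HG Hd.
  set (w := (F b - F a)%C).
  destruct (Req_dec (Cmod w) 0) as [Z|NZ].
  { rewrite Z. assert (- G b <= - G a); [|lra].
    apply (Rmvt_le (fun x => - G x) (fun x => - dG x)); [assumption| |].
    - intros x Hx. apply (is_derive_opp G). auto.
    - intros x Hx. specialize (Hd x Hx). pose proof (Cmod_ge_0 (dF x)). lra. }
  assert (P : 0 < Cmod w) by (pose proof (Cmod_ge_0 w); lra).
  set (h := fun x => (Re w * Re (F x) + Im w * Im (F x)) - Cmod w * G x).
  assert (K : h b <= h a).
  { apply (Rmvt_le h (fun x => (Re w * Re (dF x) + Im w * Im (dF x)) - Cmod w * dG x)); [assumption| |].
    - intros x Hx. destruct (HF x Hx) as [D1 D2]. unfold h.
      apply (is_derive_minus (fun x => Re w * Re (F x) + Im w * Im (F x)) (fun x => Cmod w * G x)).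
      + apply (is_derive_plus (fun x => Re w * Re (F x)) (fun x => Im w * Im (F x)));
          apply (is_derive_scal (fun x => _ (F x))); assumption.
      + apply (is_derive_scal G). auto.
    - intros x Hx. specialize (Hd x Hx).
      assert (Re w * Re (dF x) + Im w * Im (dF x) <= Cmod w * Cmod (dF x)).
      { pose proof (re_le_Cmod (Cconj w * dF x)) as Q. rewrite Cmod_mult, Cmod_conj in Q.
        apply Rle_trans with (2 := Q). eapply Rle_trans; [|apply Rle_abs].
        simpl. unfold Re, Im. lra. }
      nra. }
  unfold h in K.
  assert (E : Cmod w ^ 2 = Re w * Re (F b) + Im w * Im (F b) - (Re w * Re (F a) + Im w * Im (F a))).
  { rewrite Cmod2_alt. unfold w; simpl. unfold Re, Im. ring. }
  replace (Cmod w ^ 2) with (Cmod w * Cmod w) in E by ring.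
  apply Rmult_le_reg_l with (Cmod w); [lra|]. lra.
Qed.

Definition cexp (z : C) : C := (exp (Re z) * cos (Im z), exp (Re z) * sin (Im z)).

Lemma cexp_0 : cexp 0 = RtoC 1.
Proof. apply C_eq; simpl; rewrite exp_0, ?cos_0, ?sin_0; ring. Qed.

Lemma cexp_plus a b : cexp (a + b) = (cexp a * cexp b)%C.
Proof.
  apply C_eq; simpl; unfold Re, Im; simpl; rewrite exp_plus, ?cos_plus, ?sin_plus; ring.
Qed.

Lemma Cmod_cexp z : Cmod (cexp z) = exp (Re z).
Proof.
  unfold Cmod, cexp; simpl.
  replace (_ + _) with (Rsqr (exp (Re z)) * (Rsqr (sin (Im z)) + Rsqr (cos (Im z)))) by (unfold Rsqr; ring).
  rewrite sin2_cos2, Rmult_1_r, sqrt_Rsqr; [reflexivity|left; apply exp_pos].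
Qed.

Lemma cexp_neq_0 z : cexp z <> 0%C.
Proof. apply Cmod_gt_0. rewrite Cmod_cexp. apply exp_pos. Qed.

Lemma cexp_RtoC x : cexp (RtoC x) = RtoC (exp x).
Proof. apply C_eq; simpl; rewrite ?cos_0, ?sin_0; ring. Qed.

Lemma cexp_opp z : cexp (- z) = (/ cexp z)%C.
Proof.
  assert (E : (cexp (- z) * cexp z)%C = RtoC 1).
  { rewrite <- cexp_plus. replace (- z + z)%C with (RtoC 0) by ring. apply cexp_0. }
  pose proof (cexp_neq_0 z) as N.
  replace (cexp (- z)) with (cexp (- z) * cexp z * / cexp z)%C by (field; exact N).
  rewrite E. ring.
Qed.

Lemma cexp_pow z n : (cexp z ^ n)%C = cexp (INR n * z).
Proof.
  induction n.
  - simpl. replace (0 * z)%C with (RtoC 0) by ring. now rewrite cexp_0.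
  - rewrite Cpow_S, IHn, <- cexp_plus, S_INR, RtoC_plus. f_equal. ring.
Qed.

Lemma CD_cexp F x a : CD F x a -> CD (fun y => cexp (F y)) x (a * cexp (F x))%C.
Proof.
  intros [H1 H2]; split; simpl.
  - assert (D : is_derive (fun y => exp (Re (F y))) x (Re a * exp (Re (F x)))).
    { apply (is_derive_comp exp (fun y => Re (F y))); [apply is_derive_exp|assumption]. }
    assert (E : is_derive (fun y => cos (Im (F y))) x (Im a * - sin (Im (F x)))).
    { apply (is_derive_comp cos (fun y => Im (F y))); [apply is_derive_cos|assumption]. }
    eapply is_derive_Req; [apply (is_derive_Rmult _ _ _ _ _ D E)|].
    unfold Re, Im; simpl; ring.
  - assert (D : is_derive (fun y => exp (Re (F y))) x (Re a * exp (Re (F x)))).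
    { apply (is_derive_comp exp (fun y => Re (F y))); [apply is_derive_exp|assumption]. }
    assert (E : is_derive (fun y => sin (Im (F y))) x (Im a * cos (Im (F x)))).
    { apply (is_derive_comp sin (fun y => Im (F y))); [apply is_derive_sin|assumption]. }
    eapply is_derive_Req; [apply (is_derive_Rmult _ _ _ _ _ D E)|].
    unfold Re, Im; simpl; ring.
Qed.

Definition ctaylor (z : C) (n : nat) : C := csum (fun m => z ^ m / INR (fact m))%C n.

Lemma CD_ctaylor z n x :
  CD (fun u => ctaylor (RtoC u * z) (S n)) x (z * ctaylor (RtoC x * z) n)%C.
Proof.
  assert (P : forall m x, CD (fun u => ((RtoC u * z) ^ S m)%C) x (INR (S m) * z * (RtoC x * z) ^ m)%C).
  { intros m. induction m; intros y.
    - apply CD_ext with (fun u => RtoC u * z)%C; [intros; simpl; ring|].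
      eapply CD_eq; [apply CD_mult; [apply CD_id|apply CD_const]|]. simpl; ring.
    - apply CD_ext with (fun u => (RtoC u * z) ^ S m * (RtoC u * z))%C; [intros; rewrite !Cpow_S; ring|].
      eapply CD_eq; [apply CD_mult; [apply IHm|apply CD_mult; [apply CD_id|apply CD_const]]|].
      rewrite (S_INR (S m)), RtoC_plus, Cpow_S. ring. }
  induction n.
  - apply CD_ext with (fun _ => RtoC 1); [intros; unfold ctaylor; simpl; field|].
    eapply CD_eq; [apply CD_const|]. unfold ctaylor; simpl; ring.
  - apply CD_ext with (fun u => ctaylor (RtoC u * z) (S n) + / INR (fact (S n)) * (RtoC u * z) ^ S n)%C.
    { intros. unfold ctaylor. cbn [csum]. unfold Cdiv. ring. }
    eapply CD_eq; [apply CD_plus; [apply IHn|apply CD_scal, P]|].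
    unfold ctaylor; cbn [csum]. rewrite fact_simpl, mult_INR, RtoC_mult.
    field. split; apply RtoC_neq_0; [apply INR_fact_neq_0|apply not_0_INR; lia].
Qed.

(** Along the segment from 0 to [z] the remainder of order n + 1 has derivative [z] times the
    remainder of order n, so the mean value inequality gives the induction step. The exponential of
    [Rmax 0 (Re z)] bounds [cexp] on the whole segment; for [Re z <= 0] it is 1. *)
Lemma cexp_ctaylor_le z n :
  Cmod (cexp z - ctaylor z n) <= exp (Rmax 0 (Re z)) * Cmod z ^ n / INR (fact n).
Proof.
  assert (H : forall u, 0 <= u <= 1 ->
     Cmod (cexp (RtoC u * z) - ctaylor (RtoC u * z) n) <= exp (Rmax 0 (Re z)) * (u * Cmod z) ^ n / INR (fact n)).
  { induction n; intros u Hu.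
    - unfold ctaylor; simpl. replace (cexp (RtoC u * z) - 0)%C with (cexp (RtoC u * z)) by ring.
      rewrite Cmod_cexp. unfold Rdiv; rewrite Rinv_1, !Rmult_1_r.
      assert (Re (RtoC u * z) <= Rmax 0 (Re z)).
      { rewrite re_scal_l. pose proof (Rmax_l 0 (Re z)); pose proof (Rmax_r 0 (Re z)). nra. }
      destruct H; [left; apply exp_increasing; assumption|rewrite H; lra].
    - set (E := exp (Rmax 0 (Re z))).
      pose proof (Cmvt (fun u => cexp (RtoC u * z) - ctaylor (RtoC u * z) (S n))%C
        (fun u => z * (cexp (RtoC u * z) - ctaylor (RtoC u * z) n))%C
        (fun u => E * (u * Cmod z) ^ S n / INR (fact (S n)))
        (fun u => Cmod z * (E * (u * Cmod z) ^ n / INR (fact n))) 0 u) as M.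
      cbv beta in M.
      replace (cexp (RtoC 0 * z)) with (RtoC 1) in M
        by (replace (RtoC 0 * z)%C with (RtoC 0) by ring; now rewrite cexp_0).
      replace (ctaylor (RtoC 0 * z) (S n)) with (RtoC 1) in M.
      2:{ replace (RtoC 0 * z)%C with (RtoC 0) by ring. clear.
          unfold ctaylor. rewrite csum_shift.
          rewrite (csum_ext _ (fun _ => RtoC 0 * RtoC 0)%C).
          - rewrite csum_scal. simpl. field.
          - intros. rewrite Cpow_S. unfold Cdiv. ring. }
      replace (cexp (RtoC u * z) - ctaylor (RtoC u * z) (S n) - (1 - 1))%C
        with (cexp (RtoC u * z) - ctaylor (RtoC u * z) (S n))%C in M by ring.
      replace (E * (0 * Cmod z) ^ S n / INR (fact (S n))) with 0 in M
        by (rewrite Rmult_0_l, pow_i by lia; unfold Rdiv; ring).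
      rewrite Rminus_0_r in M. apply M; [lra| | |].
      + intros x Hx. eapply CD_eq; [apply CD_minus; [apply CD_cexp|apply CD_ctaylor]|].
        { apply CD_mult; [apply CD_id|apply CD_const]. } simpl; ring.
      + intros x Hx. rewrite fact_simpl, mult_INR. auto_derive; [trivial|].
        change (pred (S n)) with n.
        pose proof (INR_fact_neq_0 n). pose proof (not_0_INR (S n) ltac:(lia)) as N0.
        change (match n with O => 1 | S _ => INR n + 1 end) with (INR (S n)).
        field. auto.
      + intros x Hx. rewrite Cmod_mult. apply Rmult_le_compat_l; [apply Cmod_ge_0|].
        apply IHn; lra. }
  specialize (H 1 ltac:(lra)). rewrite Rmult_1_l in H.
  replace (RtoC 1 * z)%C with z in H by ring. exact H.
Qed.

(** * The generating function of overpartitions *)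

(* [rep K f s] has generating function f(q)/(1 - q^K) (for enough fuel), and
   [ov K s] counts the overpartitions of [s] into parts at most [K]. *)
Fixpoint rep (K : nat) (f : nat -> nat) (fuel s : nat) : nat :=
  match fuel with
  | O => f s
  | S g => (f s + if Nat.leb K s then rep K f g (s - K) else 0)%nat
  end.

Fixpoint ov (K s : nat) : nat :=
  match K with
  | O => if Nat.eqb s 0 then 1%nat else 0%nat
  | S k => (ov k s + 2 * if Nat.leb K s then rep K (ov k) s (s - K) else 0)%nat
  end.

Lemma rep_fuel K f a b s : (0 < K)%nat -> (s <= a)%nat -> (s <= b)%nat -> rep K f a s = rep K f b s.
Proof.
  intros HK. revert b s. induction a; intros b s Ha Hb.
  - assert (s = 0)%nat by lia; subst. destruct b; simpl; [reflexivity|].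
    destruct K; [lia|]. simpl. lia.
  - destruct b; simpl.
    + assert (s = 0)%nat by lia; subst. destruct K; [lia|]. simpl. lia.
    + destruct (Nat.leb_spec K s); [|reflexivity]. f_equal. apply IHa; lia.
Qed.

Lemma rep_eq K f s : (0 < K)%nat ->
  rep K f s s = (f s + if Nat.leb K s then rep K f (s - K) (s - K) else 0)%nat.
Proof.
  intros HK. destruct s.
  - destruct K; [lia|]. simpl. lia.
  - simpl rep at 1. destruct (Nat.leb_spec K (S s)); [|reflexivity].
    f_equal. apply rep_fuel; lia.
Qed.

Lemma ov_S k s :
  ov (S k) s = (ov k s + 2 * if Nat.leb (S k) s then rep (S k) (ov k) (s - S k) (s - S k) else 0)%nat.
Proof.
  simpl ov at 1. destruct s; [reflexivity|].
  destruct (Nat.leb_spec k s) as [H|H].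
  - replace (Nat.leb (S k) (S s)) with true by (symmetry; apply Nat.leb_le; lia).
    rewrite (rep_fuel (S k) (ov k) (S s) (S s - S k) (S s - S k)) by lia. simpl. reflexivity.
  - replace (Nat.leb (S k) (S s)) with false by (symmetry; apply Nat.leb_gt; lia). reflexivity.
Qed.

Lemma ov_stable K s : (s <= K)%nat -> ov K s = ov s s.
Proof.
  intros H; induction H; [reflexivity|].
  rewrite ov_S, IHle. replace (Nat.leb (S m) s) with false by (symmetry; apply Nat.leb_gt; lia). lia.
Qed.

(** Validity only compares neighbours, so a list may follow a part [p] exactly when it is valid and
    its head passes a test depending on [p]. The counts below are refined by such a test: [below p]
    is the one that applies after [p], and [upto p] bounds the head without restricting its
    overline. *)
Definition head_ok (h : nat * bool -> bool) (l : list (nat * bool)) : bool :=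
  match l with [] => true | x :: _ => h x end.

Definition cnt (h : nat * bool -> bool) (f s : nat) : nat :=
  length (filter (fun l => op_valid l && head_ok h l) (op_gen f s)).

Definition below (p : nat) (x : nat * bool) : bool :=
  Nat.leb (fst x) p && (negb (Nat.eqb p (fst x)) || negb (snd x)).

Definition upto (p : nat) (x : nat * bool) : bool := Nat.leb (fst x) p.

Lemma length_filter_flat_map {A B} (P : B -> bool) (g : A -> list B) l :
  length (filter P (flat_map g l)) = list_sum (map (fun x => length (filter P (g x))) l).
Proof.
  induction l; simpl; [reflexivity|]. rewrite filter_app, length_app, IHl. reflexivity.
Qed.

Lemma cnt_cons h f s p b :
  length (filter (fun l => op_valid l && head_ok h l) (map (cons (p, b)) (op_gen f s)))
  = if h (p, b) then cnt (below p) f s else 0%nat.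
Proof.
  unfold cnt. induction (op_gen f s) as [|l L IH]; [simpl; now destruct (h (p, b))|].
  assert (E : op_valid ((p, b) :: l) = op_valid l && head_ok (below p) l).
  { destruct l as [|[p' b'] t]; [reflexivity|]. unfold below. simpl. apply andb_comm. }
  cbn [map filter]. rewrite E. cbn [head_ok].
  destruct (op_valid l && head_ok (below p) l); simpl; destruct (h (p, b)); simpl; auto.
Qed.

Lemma cnt_S h f s :
  cnt h (S f) (S s) = list_sum (map (fun p =>
    ((if h (p, false) then cnt (below p) f (S s - p) else 0)
     + (if h (p, true) then cnt (below p) f (S s - p) else 0))%nat) (seq 1 (S s))).
Proof.
  unfold cnt at 1. cbn [op_gen]. rewrite length_filter_flat_map. f_equal. apply map_ext.
  intros p. rewrite length_filter_flat_map. simpl map. rewrite !cnt_cons. simpl. lia.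
Qed.

Lemma cnt_0 h f : cnt h f 0 = 1%nat.
Proof. destruct f; reflexivity. Qed.

Lemma list_sum_cons x l : list_sum (x :: l) = (x + list_sum l)%nat.
Proof. reflexivity. Qed.

Lemma list_sum_map_0 {A} (l : list A) : list_sum (map (fun _ => 0%nat) l) = 0%nat.
Proof. induction l; [reflexivity|exact IHl]. Qed.

Lemma list_sum_cutoff (g : nat -> nat) K n :
  list_sum (map (fun p => if Nat.leb p (S K) then g p else 0%nat) (seq 1 n))
  = (list_sum (map (fun p => if Nat.leb p K then g p else 0%nat) (seq 1 n))
     + if Nat.leb (S K) n then g (S K) else 0)%nat.
Proof.
  induction n; [reflexivity|].
  rewrite seq_S, !map_app, !list_sum_app, IHn. cbn [map list_sum fold_right Nat.add].
  destruct (Nat.leb_spec (S n) (S K)); destruct (Nat.leb_spec (S n) K);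
    destruct (Nat.leb_spec (S K) n); destruct (Nat.leb_spec (S K) (S n)); try lia.
  replace K with n by lia. lia.
Qed.

Lemma cnt_spec f : forall s K, (s <= f)%nat ->
  cnt (upto K) f s = ov K s /\ cnt (below (S K)) f s = rep (S K) (ov K) s s.
Proof.
  induction f; intros s K Hs.
  - assert (s = 0)%nat by lia; subst. rewrite !cnt_0. split; [|cbn [rep]; now rewrite ov_stable by lia].
    rewrite ov_stable by lia. reflexivity.
  - destruct s.
    { rewrite !cnt_0, ov_stable by lia. split; [reflexivity|]. simpl. rewrite ov_stable by lia. reflexivity. }
    set (g := fun p => cnt (below p) f (S s - p)).
    assert (U : forall K, cnt (upto K) (S f) (S s)
      = (2 * list_sum (map (fun p => if Nat.leb p K then g p else 0%nat) (seq 1 (S s))))%nat).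
    { intros K'. rewrite cnt_S. generalize (seq 1 (S s)) as L.
      induction L as [|p L IH]; [reflexivity|]. cbn [map]. rewrite !list_sum_cons, IH.
      unfold upto at 1 2; simpl fst. unfold g at 2. destruct (Nat.leb p K'); lia. }
    assert (E : forall K, cnt (upto K) (S f) (S s) = ov K (S s)).
    { intros K'. induction K'.
      - rewrite U. replace (map _ _) with (map (fun _ : nat => 0%nat) (seq 1 (S s))).
        + rewrite list_sum_map_0. reflexivity.
        + apply map_ext_in. intros p Hp. apply in_seq in Hp.
          destruct (Nat.leb_spec p 0); [lia|reflexivity].
      - rewrite U, list_sum_cutoff, Nat.mul_add_distr_l, <- U, IHK', ov_S.
        destruct (Nat.leb_spec (S K') (S s)); [|reflexivity].
        unfold g. destruct (IHf (S s - S K') K')%nat as [_ ->]; [lia|reflexivity]. }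
    split; [apply E|].
    rewrite rep_eq, <- E by lia.
    assert (B : cnt (below (S K)) (S f) (S s) = (cnt (upto K) (S f) (S s)
       + if Nat.leb (S K) (S s) then g (S K) else 0)%nat).
    { rewrite U, cnt_S.
      transitivity (list_sum (map (fun p => if Nat.leb p K then g p else 0%nat) (seq 1 (S s)))
        + list_sum (map (fun p => if Nat.leb p (S K) then g p else 0%nat) (seq 1 (S s))))%nat.
      - generalize (seq 1 (S s)) as L. induction L as [|p L IH]; [reflexivity|].
        cbn [map]. rewrite !list_sum_cons, IH. unfold below at 1 3; simpl fst; simpl snd. fold (g p).
        change (cnt (below p) f (S s - p)) with (g p).
        destruct (Nat.leb_spec p (S K)); destruct (Nat.leb_spec p K);
          destruct (Nat.eqb_spec (S K) p); simpl; try lia.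
      - rewrite list_sum_cutoff. lia. }
    rewrite B. f_equal. destruct (Nat.leb_spec (S K) (S s)); [|reflexivity].
    unfold g. destruct (IHf (S s - S K) K)%nat as [_ ->]; [lia|reflexivity].
Qed.

Lemma pbar_ov n K : (n <= K)%nat -> pbar n = ov K n.
Proof.
  intros H. rewrite ov_stable by assumption. destruct (cnt_spec n n n) as [<- _]; [lia|].
  destruct n; [reflexivity|].
  assert (T : pbar (S n) = cnt (fun _ => true) (S n) (S n)).
  { unfold pbar, cnt. f_equal. apply filter_ext. intros l.
    destruct l; simpl head_ok; now rewrite andb_true_r. }
  rewrite T, !cnt_S. f_equal. apply map_ext_in. intros p Hp. apply in_seq in Hp.
  unfold upto; simpl fst. replace (Nat.leb p (S n)) with true by (symmetry; apply Nat.leb_le; lia).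
  reflexivity.
Qed.

(** Multiplication by q^K as a shift of coefficients, exact for truncated sums; it turns coefficient
    recurrences into identities between partial sums of lengths M and M + K. *)
Lemma csum_delay K (f : nat -> C) M :
  csum (fun s => if Nat.leb K s then f (s - K)%nat else RtoC 0) (M + K) = csum f M.
Proof.
  induction M.
  - assert (H : forall n, (n <= K)%nat ->
      csum (fun s => if Nat.leb K s then f (s - K)%nat else RtoC 0) n = RtoC 0).
    { induction n; intros Hn; [reflexivity|]. cbn [csum]. rewrite IHn by lia.
      replace (Nat.leb K n) with false by (symmetry; apply Nat.leb_gt; lia). ring. }
    simpl. apply H; lia.
  - cbn [csum Nat.add]. rewrite IHM. replace (Nat.leb K (M + K)) with true by (symmetry; apply Nat.leb_le; lia).
    do 2 f_equal. lia.
Qed.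

Definition gterm (a : nat -> nat) (q : C) (s : nat) : C := (INR (a s) * q ^ s)%C.

Definition ssum (a : nat -> nat) (r : R) (s : nat) : R := INR (a s) * r ^ s.

Lemma Cmod_gterm a q s : Cmod (gterm a q s) = ssum a (Cmod q) s.
Proof.
  unfold gterm, ssum. rewrite Cmod_mult, Cmod_R, Cmod_pow, Rabs_pos_eq; [reflexivity|apply pos_INR].
Qed.

Lemma ssum_ge0 a r s : 0 <= r -> 0 <= ssum a r s.
Proof. intros; apply Rmult_le_pos; [apply pos_INR|apply pow_le; assumption]. Qed.

Lemma gterm_RtoC a r s : gterm a (RtoC r) s = RtoC (ssum a r s).
Proof. unfold gterm, ssum. now rewrite RtoC_mult, RtoC_pow. Qed.

Fixpoint FK (K : nat) (q : C) : C :=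
  match K with
  | O => RtoC 1
  | S k => (FK k q * ((1 + q ^ S k) / (1 - q ^ S k)))%C
  end.

Lemma one_minus_pow_neq_0 q k : Cmod q < 1 -> (1 - q ^ S k)%C <> RtoC 0.
Proof.
  intros H E.
  assert (D : Cmod (q ^ S k) = 1).
  { rewrite <- Cmod_1. f_equal. generalize dependent (q ^ S k)%C. intros w E.
    apply C_eq; [apply (f_equal Re) in E|apply (f_equal Im) in E]; unfold Re, Im in *; simpl in *; lra. }
  rewrite Cmod_pow in D. pose proof (Cmod_ge_0 q).
  assert (Cmod q ^ S k < 1) by (apply pow_lt_1_compat; [lra|lia]). lra.
Qed.

(** With K = k + 1 and N the series of [rep], the recurrences give N = FK k + q^K N and, for the
    series of [ov K], FK k + 2 q^K N. Its quotient by FK k is the new factor (1 + q^K) / (1 -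
    q^K). *)
Lemma ov_gf_step k q : Cmod q < 1 ->
  (exists A, forall M, rsum (ssum (ov k) (Cmod q)) M <= A) ->
  Clim (csum (gterm (ov k) q)) (FK k q) ->
  (exists A, forall M, rsum (ssum (ov (S k)) (Cmod q)) M <= A) /\
  Clim (csum (gterm (ov (S k)) q)) (FK (S k) q).
Proof.
  intros Hq [A HA] HF. set (r := Cmod q) in *. set (K := S k).
  assert (Hr : 0 <= r) by apply Cmod_ge_0.
  assert (HrK : r ^ K < 1) by (apply pow_lt_1_compat; [lra|unfold K; lia]).
  assert (HrK0 : 0 <= r ^ K) by (apply pow_le; assumption).
  assert (A0 : 0 <= A) by (specialize (HA O); simpl in HA; lra).
  set (n := fun s => rep K (ov k) s s).
  assert (En : forall z s, gterm n z s = (gterm (ov k) z s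
     + z ^ K * if Nat.leb K s then gterm n z (s - K) else RtoC 0)%C).
  { intros z s. unfold gterm, n. rewrite rep_eq by (unfold K; lia).
    rewrite plus_INR, RtoC_plus. destruct (Nat.leb_spec K s) as [L|L].
    - replace (z ^ s)%C with (z ^ K * z ^ (s - K))%C by (rewrite <- Cpow_add_r; f_equal; lia). ring.
    - simpl INR. ring. }
  assert (Sn : forall z M, csum (gterm n z) (M + K)
      = (csum (gterm (ov k) z) (M + K) + z ^ K * csum (gterm n z) M)%C).
  { intros z M. rewrite (csum_ext _ _ _ (fun i _ => En z i)), csum_plus, csum_scal.
    now rewrite (csum_delay K (gterm n z)). }
  assert (Eo : forall z s, gterm (ov K) z s = (gterm (ov k) z s
     + 2 * z ^ K * if Nat.leb K s then gterm n z (s - K) else RtoC 0)%C).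
  { intros z s. unfold gterm, n, K. rewrite ov_S, plus_INR, mult_INR, RtoC_plus, RtoC_mult.
    replace (RtoC (INR 2)) with (RtoC 2) by (f_equal; simpl; ring).
    destruct (Nat.leb_spec (S k) s) as [L|L].
    - replace (z ^ s)%C with (z ^ S k * z ^ (s - S k))%C by (rewrite <- Cpow_add_r; f_equal; lia). ring.
    - change (INR 0) with 0. ring. }
  assert (So : forall z M, csum (gterm (ov K) z) (M + K)
      = (csum (gterm (ov k) z) (M + K) + 2 * z ^ K * csum (gterm n z) M)%C).
  { intros z M. rewrite (csum_ext _ _ _ (fun i _ => Eo z i)), csum_plus, csum_scal.
    now rewrite (csum_delay K (gterm n z)). }
  (* The same identities at the real point [r] bound the sums of absolute values, which gives
     convergence before any limit is identified. *)
  assert (RS : forall a M, csum (gterm a (RtoC r)) M = RtoC (rsum (ssum a r) M)).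
  { intros a M. rewrite RtoC_rsum. apply csum_ext. intros; apply gterm_RtoC. }
  assert (Bn : forall M, rsum (ssum n r) M <= A / (1 - r ^ K)).
  { intros M. apply Rle_div_r; [lra|].
    assert (E := Sn (RtoC r) M). rewrite !RS, <- RtoC_pow, <- RtoC_mult, <- RtoC_plus in E.
    apply RtoC_inj in E.
    assert (rsum (ssum n r) M <= rsum (ssum n r) (M + K)).
    { apply rsum_le_mono; [intros; apply ssum_ge0; assumption|lia]. }
    specialize (HA (M + K)%nat). lra. }
  assert (Bo : forall M, rsum (ssum (ov K) r) M <= A + 2 * r ^ K * (A / (1 - r ^ K))).
  { intros M. apply Rle_trans with (rsum (ssum (ov K) r) (M + K)).
    { apply rsum_le_mono; [intros; apply ssum_ge0; assumption|lia]. }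
    assert (E := So (RtoC r) M).
    rewrite !RS, <- RtoC_pow, <- !RtoC_mult, <- RtoC_plus in E. apply RtoC_inj in E.
    rewrite E. apply Rplus_le_compat; [apply HA|]. apply Rmult_le_compat_l; [lra|apply Bn]. }
  split; [eexists; exact Bo|].
  destruct (rsum_bounded_conv (ssum n r) _ (fun i => ssum_ge0 n r i Hr) Bn) as [c Hc].
  destruct (csum_conv (gterm n q) (ssum n r) c) as [l [Hl _]]; [|assumption|].
  { intros i. rewrite Cmod_gterm. unfold r; lra. }
  pose proof (one_minus_pow_neq_0 q k Hq) as NZ. fold K in NZ.
  assert (L : l = (FK k q / (1 - q ^ K))%C).
  { assert (E : l = (FK k q + q ^ K * l)%C).
    { apply Clim_unique with (fun M => csum (gterm n q) (M + K)%nat).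
      - apply Clim_incr with (u := csum (gterm n q)); assumption.
      - eapply Clim_ext; [intros M; symmetry; apply Sn|].
        apply Clim_plus; [apply Clim_incr with (u := csum (gterm (ov k) q)); assumption|].
        apply Clim_scal; assumption. }
    replace (FK k q) with (l - q ^ K * l)%C; [field; exact NZ|].
    rewrite E at 1. ring. }
  apply Clim_incr_inv with K.
  eapply Clim_ext; [intros M; symmetry; apply So|].
  replace (FK K q) with (FK k q + 2 * q ^ K * l)%C.
  - apply Clim_plus; [apply Clim_incr with (u := csum (gterm (ov k) q)); assumption|].
    apply Clim_scal; assumption.
  - rewrite L. unfold K at 3; cbn [FK]; fold K. field. exact NZ.
Qed.

Lemma ov_gf K q : Cmod q < 1 ->
  (exists A, forall M, rsum (ssum (ov K) (Cmod q)) M <= A) /\ Clim (csum (gterm (ov K) q)) (FK K q).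
Proof.
  intros Hq. induction K.
  - assert (E : forall z M, csum (gterm (ov 0) z) (S M) = RtoC 1).
    { intros z M. induction M.
      - unfold gterm. simpl. ring.
      - change (csum (gterm (ov 0) z) (S (S M))) with (csum (gterm (ov 0) z) (S M) + gterm (ov 0) z (S M))%C.
        rewrite IHM. unfold gterm. simpl ov. change (INR 0) with 0. ring. }
    split.
    + exists 1. intros M. apply Rle_trans with (rsum (ssum (ov 0) (Cmod q)) (S M)).
      { apply rsum_le_mono; [intros; apply ssum_ge0, Cmod_ge_0|lia]. }
      right. apply RtoC_inj. rewrite RtoC_rsum, <- (E (RtoC (Cmod q)) M).
      apply csum_ext. intros; now rewrite gterm_RtoC.
    + apply Clim_incr_inv with 1%nat. apply Clim_ext with (fun _ => RtoC 1); [|apply Clim_const].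
      intros n. rewrite Nat.add_1_r. now rewrite E.
  - destruct IHK. apply ov_gf_step; assumption.
Qed.

Lemma ov_le_pbar K s : (ov K s <= pbar s)%nat.
Proof.
  destruct (Nat.le_ge_cases s K) as [H|H].
  - rewrite (pbar_ov s K) by assumption. lia.
  - rewrite (pbar_ov s s) by lia. induction H; [lia|].
    apply Nat.le_trans with (ov K (S m)).
    + lia.
    + assert (M : forall j, (K <= j)%nat -> (ov K (S m) <= ov j (S m))%nat).
      { intros j Hj. induction Hj; [lia|]. rewrite ov_S. lia. }
      apply M. lia.
Qed.

(** * Gauss's identity for the inverse generating function *)

Definition theta (q : C) (n : nat) : C :=
  (1 + csum (fun i => 2 * (- (1)) ^ S i * q ^ (S i * S i)) n)%C.

(** Summand of Shanks's finite form of Gauss's identity. The factor 2 / (1 + q^s) is 1 at s = 0 and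
    for s >= 1 replaces the last numerator of the product by 2, so that one formula covers all
    [s]. *)
Definition shanks (q : C) (n s : nat) : C :=
  ((- (1)) ^ s * FK s q * q ^ (s * n) * (2 / (1 + q ^ s)))%C.

Lemma one_plus_pow_neq_0 q k : Cmod q < 1 -> (1 + q ^ k)%C <> RtoC 0.
Proof.
  intros H E. destruct k.
  - apply (f_equal Re) in E. unfold Re in E; simpl in E. lra.
  - assert (D : Cmod (q ^ S k) = 1).
    { rewrite <- Cmod_1, <- Cmod_opp. f_equal. generalize dependent (q ^ S k)%C. intros w E.
      apply C_eq; [apply (f_equal Re) in E|apply (f_equal Im) in E]; unfold Re, Im in *; simpl in *; lra. }
    rewrite Cmod_pow in D. pose proof (Cmod_ge_0 q).
    assert (Cmod q ^ S k < 1) by (apply pow_lt_1_compat; [lra|lia]). lra.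
Qed.

(** The right side is an antidifference in [m] that relates the Shanks sums at [S n] and [n]. Its
    exponent becomes the square (m + 1)^2 for n = m + 1, which is how each new term of [theta]
    arises. *)
Lemma shanks_telescope q n m : Cmod q < 1 ->
  (csum (fun s => shanks q (S n) s * (1 - q ^ n) - shanks q n s * (1 + q ^ n)) (S m)
   = - ((- (1)) ^ m * 2 * FK m q * q ^ (S m * n)))%C.
Proof.
  intros Hq. induction m.
  - unfold shanks. simpl csum. simpl. rewrite Nat.add_0_r. field.
  - change (csum ?f (S (S m))) with (csum f (S m) + f (S m))%C. rewrite IHm. unfold shanks.
    pose proof (one_minus_pow_neq_0 q m Hq) as N1. pose proof (one_plus_pow_neq_0 q (S m) Hq) as N2.
    cbn [FK].
    replace (q ^ (S m * S n))%C with (q ^ (S m * n) * q ^ S m)%C by (rewrite <- Cpow_add_r; f_equal; lia).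
    replace (q ^ (S (S m) * n))%C with (q ^ (S m * n) * q ^ n)%C by (rewrite <- Cpow_add_r; f_equal; lia).
    rewrite (Cpow_S (- (1)) m).
    generalize dependent (q ^ S m)%C. intros Q N1 N2. field. auto.
Qed.

Lemma shanks_identity q n : Cmod q < 1 ->
  (theta q n * FK n q = csum (shanks q (S n)) (S n))%C.
Proof.
  intros Hq. induction n.
  - unfold theta, shanks. simpl. field.
  - pose proof (one_minus_pow_neq_0 q n Hq) as N1. pose proof (one_plus_pow_neq_0 q (S n) Hq) as N2.
    assert (T := shanks_telescope q (S n) n Hq).
    rewrite csum_minus in T.
    rewrite (csum_ext (fun i => shanks q (S (S n)) i * (1 - q ^ S n))%C (fun i => (1 - q ^ S n) * shanks q (S (S n)) i)%C) in T
      by (intros; ring).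
    rewrite (csum_ext (fun i => shanks q (S n) i * (1 + q ^ S n))%C (fun i => (1 + q ^ S n) * shanks q (S n) i)%C) in T
      by (intros; ring).
    rewrite !csum_scal, <- IHn in T.
    change (csum (shanks q (S (S n))) (S (S n)))
      with (csum (shanks q (S (S n))) (S n) + shanks q (S (S n)) (S n))%C.
    (* The telescoped relation solved for the new Shanks sum: the old one times (1 + q^(n+1)) / (1 -
       q^(n+1)), the factor gained by [FK], and a part of the new theta term. The summand split off
       just before completes that term. *)
    assert (E : csum (shanks q (S (S n))) (S n) = (((1 + q ^ S n) * (theta q n * FK n q)
       - (- (1)) ^ n * 2 * FK n q * q ^ (S n * S n)) / (1 - q ^ S n))%C).
    { set (X := csum (shanks q (S (S n))) (S n)) in *.
      replace X with ((1 - q ^ S n) * X / (1 - q ^ S n))%C by (field; exact N1).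
      f_equal. transitivity ((1 - q ^ S n) * X - (1 + q ^ S n) * (theta q n * FK n q) + (1 + q ^ S n) * (theta q n * FK n q))%C;
        [ring|rewrite T; ring]. }
    rewrite E.
    replace (theta q (S n)) with (theta q n + 2 * (- (1)) ^ S n * q ^ (S n * S n))%C
      by (unfold theta; cbn [csum]; ring).
    unfold shanks. cbn [FK].
    replace (q ^ (S n * S (S n)))%C with (q ^ (S n * S n) * q ^ S n)%C by (rewrite <- Cpow_add_r; f_equal; lia).
    rewrite (Cpow_S (- (1)) n).
    generalize dependent (q ^ S n)%C. intros Q N1 N2 T E. field. auto.
Qed.

(** * Size of the product on and off the positive axis *)

Lemma exp_le a b : a <= b -> exp a <= exp b.
Proof. intros [H|H]; [left; apply exp_increasing; exact H|rewrite H; lra]. Qed.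

Fixpoint gsum (r : R) (n : nat) : R := match n with O => 0 | S k => gsum r k + r ^ S k end.

Lemma gsum_eq r n : r <> 1 -> gsum r n = (r - r ^ S n) / (1 - r).
Proof.
  intros H. induction n; simpl in *; [field; lra|]. rewrite IHn. field. lra.
Qed.

(** Each factor is 1 + 2 r^k / (1 - r^k), at most exp (2 r^k / (1 - r)), so a geometric series
    bounds the logarithm of the product. *)
Lemma FK_ge1 K r : 0 <= r < 1 ->
  exists x, FK K (RtoC r) = RtoC x /\ 1 <= x <= exp (2 * gsum r K / (1 - r)).
Proof.
  intros Hr. induction K as [|K [x [E Hx]]].
  - exists 1. split; [reflexivity|]. simpl. rewrite Rmult_0_r. unfold Rdiv.
    rewrite Rmult_0_l, exp_0. lra.
  - assert (P : 0 <= r ^ S K) by (apply pow_le; lra).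
    assert (P1 : r ^ S K <= r).
    { simpl. assert (r ^ K <= 1); [|nra]. rewrite <- (pow1 K). apply pow_incr; lra. }
    exists (x * ((1 + r ^ S K) / (1 - r ^ S K))). split.
    + cbn [FK]. rewrite E, <- RtoC_pow, <- RtoC_plus, <- RtoC_minus, <- RtoC_div, <- RtoC_mult; [reflexivity|lra].
    + assert (G : 1 <= (1 + r ^ S K) / (1 - r ^ S K)) by (apply Rle_div_r; lra).
      split; [nra|].
      cbn [gsum]. replace (2 * (gsum r K + r ^ S K) / (1 - r)) with (2 * gsum r K / (1 - r) + 2 * r ^ S K / (1 - r)) by (field; lra).
      rewrite exp_plus. apply Rmult_le_compat; try lra.
      apply Rle_trans with (2 := exp_ineq1_le _).
      apply Rle_div_l; [lra|].
      replace ((1 + 2 * r ^ S K / (1 - r)) * (1 - r ^ S K)) with (1 - r ^ S K + 2 * r ^ S K * ((1 - r ^ S K) / (1 - r))) by (field; lra).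
      assert (1 <= (1 - r ^ S K) / (1 - r)) by (apply Rle_div_r; lra). nra.
Qed.

Lemma FK_bounded r : 0 <= r < 1 -> exists B, forall K, Cmod (FK K (RtoC r)) <= B.
Proof.
  intros Hr. exists (exp (2 * (r / (1 - r)) / (1 - r))). intros K.
  destruct (FK_ge1 K r Hr) as [x [-> Hx]]. rewrite Cmod_R, Rabs_pos_eq by lra.
  apply Rle_trans with (1 := proj2 Hx).
  assert (2 * gsum r K / (1 - r) <= 2 * (r / (1 - r)) / (1 - r)).
  { rewrite gsum_eq by lra. unfold Rdiv. apply Rmult_le_compat_r; [left; apply Rinv_0_lt_compat; lra|].
    apply Rmult_le_compat_l; [lra|]. apply Rmult_le_compat_r; [left; apply Rinv_0_lt_compat; lra|].
    assert (0 <= r ^ S K) by (apply pow_le; lra). lra. }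
  apply exp_le, H.
Qed.

(** The expression that decides the sign in [log_ratio_le], with v = 1 - r^2. It is divisible by 1 -
    c, and the cofactor is a quadratic in w = 1 + c: all its terms are nonnegative for v <= 1/2, and
    for v > 1/2 completing the square leaves (1 - v) (3 v - 1 - v^2) >= 0. *)
Lemma ratio_ineq v c : 0 < v <= 1 -> -1 <= c <= 1 ->
  0 <= v ^ 2 + 4 * (1 - v) * (1 - c ^ 2) + c * v * (4 * (1 - c ^ 2) - v).
Proof.
  intros Hv Hc. set (w := 1 + c).
  replace (_ + _) with ((1 - c) * (v ^ 2 + 4 * w * (1 - 2 * v) + 4 * w ^ 2 * v)) by (unfold w; ring).
  apply Rmult_le_pos; [lra|].
  destruct (Rle_lt_dec v (1 / 2)) as [H|H].
  - assert (0 <= w) by (unfold w; lra). nra.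
  - apply Rmult_le_reg_l with v; [lra|]. rewrite Rmult_0_r.
    replace (v * _) with ((2 * v * w - (2 * v - 1)) ^ 2 + (1 - v) * (3 * v - 1 - v ^ 2)) by ring.
    pose proof (pow2_ge_0 (2 * v * w - (2 * v - 1))). assert (0 <= 3 * v - 1 - v ^ 2) by nra. nra.
Qed.

(* For z = r e^(i phi) and c = cos phi the left side is log|(1+z)/(1-z)|, so moving off the
   positive axis loses at least twice the drop r (1 - c) of Re z. Both sides agree at [r = 0]
   and the derivatives in [r] compare by [ratio_ineq]. *)
Lemma log_ratio_le r c : 0 <= r < 1 -> -1 <= c <= 1 ->
  / 2 * (ln (1 + r ^ 2 + 2 * r * c) - ln (1 + r ^ 2 - 2 * r * c))
  <= ln (1 + r) - ln (1 - r) - 2 * r * (1 - c).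
Proof.
  intros Hr Hc.
  pose proof (Rmvt_le
    (fun r => / 2 * (ln (1 + r ^ 2 + 2 * r * c) - ln (1 + r ^ 2 - 2 * r * c))
              - (ln (1 + r) - ln (1 - r) - 2 * r * (1 - c)))
    (fun r => 2 * c * (1 - r ^ 2) / ((1 + r ^ 2 + 2 * r * c) * (1 + r ^ 2 - 2 * r * c))
              - (2 / ((1 + r) * (1 - r)) - 2 * (1 - c))) 0 r ltac:(lra)) as M.
  assert (Pos : forall x, 0 <= x < 1 -> 0 < 1 + x ^ 2 + 2 * x * c /\ 0 < 1 + x ^ 2 - 2 * x * c).
  { intros x Hx. split; assert (0 < (1 - x) ^ 2) by (apply pow_lt; lra); nra. }
  cbv beta in M.
  assert (K : / 2 * (ln (1 + r ^ 2 + 2 * r * c) - ln (1 + r ^ 2 - 2 * r * c)) -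
      (ln (1 + r) - ln (1 - r) - 2 * r * (1 - c)) <=
      / 2 * (ln (1 + 0 ^ 2 + 2 * 0 * c) - ln (1 + 0 ^ 2 - 2 * 0 * c)) -
      (ln (1 + 0) - ln (1 - 0) - 2 * 0 * (1 - c))).
  { apply M.
    - intros x Hx. destruct (Pos x) as [P1 P2]; [lra|].
      auto_derive; [repeat split; simpl in *; lra|]. simpl in *. field. repeat split; lra.
    - intros x Hx. destruct (Pos x) as [P1 P2]; [lra|].
      assert (V : 0 < 1 - x ^ 2) by nra.
      pose proof (ratio_ineq (1 - x ^ 2) c ltac:(nra) Hc) as Q.
      set (D := (1 + x ^ 2 + 2 * x * c) * (1 + x ^ 2 - 2 * x * c)) in *.
      assert (HD : 0 < D) by (apply Rmult_lt_0_compat; assumption).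
      replace ((1 + x) * (1 - x)) with (1 - x ^ 2) by ring.
      assert (ED : D = (1 - x ^ 2) ^ 2 + 4 * x ^ 2 * (1 - c ^ 2)) by (unfold D; ring).
      replace (_ - _) with (- (2 * x ^ 2 * ((1 - x ^ 2) ^ 2 + 4 * (1 - (1 - x ^ 2)) * (1 - c ^ 2)
          + c * (1 - x ^ 2) * (4 * (1 - c ^ 2) - (1 - x ^ 2)))) / (D * (1 - x ^ 2))).
      + unfold Rdiv. rewrite Ropp_mult_distr_l_reverse.
        assert (0 <= / (D * (1 - x ^ 2))) by (left; apply Rinv_0_lt_compat, Rmult_lt_0_compat; assumption).
        assert (0 <= 2 * x ^ 2) by nra.
        apply Ropp_le_cancel. rewrite Ropp_0, Ropp_involutive.
        apply Rmult_le_pos; [apply Rmult_le_pos|]; assumption.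
      + rewrite ED. field. rewrite <- ED. split; lra. }
  replace (1 + 0 ^ 2 + 2 * 0 * c) with 1 in K by ring.
  replace (1 + 0 ^ 2 - 2 * 0 * c) with 1 in K by ring.
  replace (1 + 0) with 1 in K by ring. replace (1 - 0) with 1 in K by ring.
  rewrite ln_1 in K. lra.
Qed.

Lemma Cmod_ratio_le (z : C) : Cmod z < 1 ->
  Cmod ((1 + z) / (1 - z)) <= (1 + Cmod z) / (1 - Cmod z) * exp (- 2 * (Cmod z - Re z)).
Proof.
  intros Hz. pose proof (Cmod_ge_0 z) as Z0. set (r := Cmod z) in *.
  assert (Z2 : r ^ 2 = Re z ^ 2 + Im z ^ 2) by (apply Cmod2_alt).
  assert (Hc : exists c, -1 <= c <= 1 /\ Re z = r * c).
  { destruct (Req_dec r 0) as [E|E].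
    (* At z = 0 there is no angle, and any cosine fits. *)
    - exists 0. split; [lra|]. assert (Re z ^ 2 = 0) by nra.
      destruct (Req_dec (Re z) 0); [lra|]. pose proof (pow_nonzero (Re z) 2 H0). lra.
    - exists (Re z / r). split; [|field; assumption].
      pose proof (re_le_Cmod z) as Q. fold r in Q. apply Rabs_le_between in Q.
      split; [apply Rle_div_r|apply Rle_div_l]; lra. }
  destruct Hc as [c [Hc E]].
  pose proof (log_ratio_le r c ltac:(lra) Hc) as L.
  assert (P1 : 0 < 1 + r ^ 2 + 2 * r * c) by (assert (0 < (1 - r) ^ 2) by (apply pow_lt; lra); nra).
  assert (P2 : 0 < 1 + r ^ 2 - 2 * r * c) by (assert (0 < (1 - r) ^ 2) by (apply pow_lt; lra); nra).
  assert (E1 : Cmod (1 + z) = exp (/ 2 * ln (1 + r ^ 2 + 2 * r * c))).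
  { assert (Q : Cmod (1 + z) ^ 2 = 1 + r ^ 2 + 2 * r * c).
    { rewrite Cmod2_alt, Z2. replace (2 * r * c) with (2 * Re z) by (rewrite E; ring).
      unfold Re, Im; simpl; ring. }
    rewrite <- Q, ln_pow; [|apply Cmod_gt_0; intros X; rewrite X, Cmod_0 in Q; lra].
    replace (/ 2 * (INR 2 * ln (Cmod (1 + z)))) with (ln (Cmod (1 + z))) by (simpl; field).
    rewrite exp_ln; [reflexivity|]. apply Cmod_gt_0; intros X; rewrite X, Cmod_0 in Q; lra. }
  assert (E2 : Cmod (1 - z) = exp (/ 2 * ln (1 + r ^ 2 - 2 * r * c))).
  { assert (Q : Cmod (1 - z) ^ 2 = 1 + r ^ 2 - 2 * r * c).
    { rewrite Cmod2_alt, Z2. replace (2 * r * c) with (2 * Re z) by (rewrite E; ring).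
      unfold Re, Im; simpl; ring. }
    rewrite <- Q, ln_pow; [|apply Cmod_gt_0; intros X; rewrite X, Cmod_0 in Q; lra].
    replace (/ 2 * (INR 2 * ln (Cmod (1 - z)))) with (ln (Cmod (1 - z))) by (simpl; field).
    rewrite exp_ln; [reflexivity|]. apply Cmod_gt_0; intros X; rewrite X, Cmod_0 in Q; lra. }
  rewrite Cmod_div.
  2:{ intros X. rewrite X, Cmod_0 in E2. pose proof (exp_pos (/ 2 * ln (1 + r ^ 2 - 2 * r * c))). lra. }
  rewrite E1, E2, E.
  rewrite <- (exp_ln (1 + r)), <- (exp_ln (1 - r)) at 1 by lra.
  unfold Rdiv. rewrite <- !exp_Ropp, <- !exp_plus.
  match goal with |- exp ?a <= exp ?b => assert (H : a <= b) by lra end.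
  apply exp_le, H.
Qed.

Fixpoint gsumC (q : C) (n : nat) : C := match n with O => RtoC 0 | S k => (gsumC q k + q ^ S k)%C end.

Lemma gsumC_eq q n : Cmod q < 1 -> (gsumC q n = (q - q ^ S n) / (1 - q))%C.
Proof.
  intros H. pose proof (one_minus_pow_neq_0 q 0 H) as N. rewrite Cpow_1_r in N.
  induction n; cbn [gsumC]; [rewrite Cpow_1_r; field; exact N|].
  rewrite IHn, (Cpow_S q (S n)). field. exact N.
Qed.

(** [Cmod_ratio_le] applied to each q^k; the losses 2 (|q|^k - Re q^k) add up to twice a difference
    of two geometric series. *)
Lemma Cmod_FK_le K q : Cmod q < 1 ->
  Cmod (FK K q) <= Cmod (FK K (RtoC (Cmod q))) * exp (- 2 * (gsum (Cmod q) K - Re (gsumC q K))).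
Proof.
  intros Hq. pose proof (Cmod_ge_0 q) as Q0. set (r := Cmod q) in *.
  induction K.
  - cbn [FK gsum gsumC]. rewrite Cmod_1. change (Re (RtoC 0)) with 0.
    replace (-2 * (0 - 0)) with 0 by ring. rewrite exp_0. lra.
  - cbn [FK gsum gsumC].
    assert (Hp : Cmod (q ^ S K) = r ^ S K) by apply Cmod_pow.
    assert (Hp0 : 0 <= r ^ S K) by (apply pow_le; lra).
    assert (Hp1 : r ^ S K < 1) by (apply pow_lt_1_compat; [lra|lia]).
    pose proof (Cmod_ratio_le (q ^ S K) ltac:(lra)) as L. rewrite Hp in L.
    rewrite !Cmod_mult.
    assert (E : Cmod ((1 + RtoC r ^ S K) / (1 - RtoC r ^ S K)) = (1 + r ^ S K) / (1 - r ^ S K)).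
    { rewrite <- RtoC_pow, <- RtoC_plus, <- RtoC_minus, <- RtoC_div, Cmod_R, Rabs_pos_eq; [reflexivity| |lra].
      apply Rdiv_le_0_compat; lra. }
    rewrite E.
    replace (-2 * (gsum r K + r ^ S K - Re (gsumC q K + q ^ S K)))
      with (-2 * (gsum r K - Re (gsumC q K)) + -2 * (r ^ S K - Re (q ^ S K)))
      by (rewrite re_plus; ring).
    rewrite exp_plus.
    replace (_ * _ * (_ * _)) with ((Cmod (FK K (RtoC r)) * exp (-2 * (gsum r K - Re (gsumC q K))))
      * ((1 + r ^ S K) / (1 - r ^ S K) * exp (-2 * (r ^ S K - Re (q ^ S K))))) by ring.
    apply Rmult_le_compat; try apply Cmod_ge_0; assumption.
Qed.

Lemma Re_gsumC_le q n : Re (gsumC q n) <= gsum (Cmod q) n.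
Proof.
  induction n; [simpl; lra|]. cbn [gsum gsumC]. rewrite re_plus.
  pose proof (re_le_Cmod (q ^ S n)) as H. rewrite Cmod_pow in H.
  pose proof (Rle_abs (Re (q ^ S n))). lra.
Qed.

Lemma FK_bounded_C q : Cmod q < 1 -> exists B, forall K, Cmod (FK K q) <= B.
Proof.
  intros Hq. pose proof (Cmod_ge_0 q) as Q0.
  destruct (FK_bounded (Cmod q) ltac:(lra)) as [B HB].
  exists (B * 1). intros s. apply Rle_trans with (1 := Cmod_FK_le s q Hq).
  apply Rmult_le_compat; [apply Cmod_ge_0|left; apply exp_pos|apply HB|].
  rewrite <- exp_0. apply exp_le. pose proof (Re_gsumC_le q s). lra.
Qed.

(* The terms [s >= 1] of Shanks's sum carry the factor [q^(s (n+1))]. *)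
Lemma theta_FK_lim q : Cmod q < 1 -> Clim (fun n => theta q n * FK n q)%C 1.
Proof.
  intros Hq. pose proof (Cmod_ge_0 q) as Q0. set (r := Cmod q) in *.
  destruct (FK_bounded_C q Hq) as [B HF].
  assert (B0 : 0 <= B) by (specialize (HF O); pose proof (Cmod_ge_0 (FK 0 q)); lra).
  apply Clim_of_dist with (fun n => B * (2 / (1 - r)) * (r / (1 - r)) * r ^ n).
  - intros n. rewrite (shanks_identity q n Hq), csum_shift.
    replace (shanks q (S n) 0) with (RtoC 1) by (unfold shanks; simpl; field).
    replace (1 + csum (fun i => shanks q (S n) (S i)) n - 1)%C with (csum (fun i => shanks q (S n) (S i)) n) by ring.
    apply Rle_trans with (1 := Cmod_csum _ _).
    apply Rle_trans with (rsum (fun i => (B * (2 / (1 - r)) * r ^ n) * r ^ S i) n).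
    + apply rsum_le. intros i _. unfold shanks.
      rewrite !Cmod_mult, Cmod_pow, Cmod_m1, pow1, Rmult_1_l, Cmod_pow. fold r.
      rewrite Cmod_div, Cmod_R, Rabs_pos_eq; [|lra|apply one_plus_pow_neq_0; assumption].
      assert (Hp0 : 0 <= r ^ S i) by (apply pow_le; lra).
      assert (Hri : r ^ S i <= r).
      { simpl. assert (r ^ i <= 1); [|nra]. rewrite <- (pow1 i). apply pow_incr; lra. }
      assert (D : 1 - r <= Cmod (1 + q ^ S i)).
      { pose proof (Cmod_minus_rev 1 (- q ^ S i)) as M. rewrite Cmod_opp, Cmod_1, Cmod_pow in M. fold r in M.
        replace (1 - - q ^ S i)%C with (1 + q ^ S i)%C in M by ring. lra. }
      assert (I : 2 / Cmod (1 + q ^ S i) <= 2 / (1 - r)).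
      { unfold Rdiv. apply Rmult_le_compat_l; [lra|]. apply Rinv_le_contravar; lra. }
      assert (J : r ^ (S i * S n) <= r ^ n * r ^ S i).
      { rewrite <- pow_add. replace (S i * S n)%nat with ((n + S i) + i * n)%nat by lia.
        rewrite pow_add. assert (r ^ (i * n) <= 1) by (rewrite <- (pow1 (i * n)); apply pow_incr; lra).
        assert (0 <= r ^ (n + S i)) by (apply pow_le; lra). nra. }
      assert (0 <= r ^ (S i * S n)) by (apply pow_le; lra).
      assert (0 <= 2 / Cmod (1 + q ^ S i)) by (apply Rdiv_le_0_compat; lra).
      replace (B * (2 / (1 - r)) * r ^ n * r ^ S i) with (B * (r ^ n * r ^ S i) * (2 / (1 - r))) by ring.
      apply Rmult_le_compat; try assumption.
      * apply Rmult_le_pos; [apply Cmod_ge_0|assumption].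
      * apply Rmult_le_compat; try assumption; [apply Cmod_ge_0|apply HF].
    + rewrite rsum_scal.
      assert (G : rsum (fun i => r ^ S i) n = gsum r n).
      { clear. induction n; [reflexivity|]. cbn [rsum gsum]. now rewrite IHn. }
      rewrite G, gsum_eq by lra.
      replace (B * (2 / (1 - r)) * (r / (1 - r)) * r ^ n) with ((B * (2 / (1 - r)) * r ^ n) * (r / (1 - r))) by ring.
      apply Rmult_le_compat_l.
      * apply Rmult_le_pos; [apply Rmult_le_pos; [assumption|apply Rdiv_le_0_compat; lra]|apply pow_le; lra].
      * unfold Rdiv. apply Rmult_le_compat_r; [left; apply Rinv_0_lt_compat; lra|].
        assert (0 <= r ^ S n) by (apply pow_le; lra). lra.
  - replace (Finite 0) with (Rbar_mult (B * (2 / (1 - r)) * (r / (1 - r))) (Finite 0)) by (simpl; f_equal; ring).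
    apply is_lim_seq_scal_l. apply is_lim_seq_geom. rewrite Rabs_pos_eq; lra.
Qed.

(** The identity FK - 1/T = ((theta FK - 1) - FK (theta - T)) / T shows that boundedness of the
    products suffices to divide in the limit. *)
Lemma FK_lim q (T : C) : Cmod q < 1 -> Clim (theta q) T -> T <> RtoC 0 -> Clim (fun n => FK n q) (/ T)%C.
Proof.
  intros Hq HT NZ. pose proof (theta_FK_lim q Hq) as H.
  destruct (FK_bounded_C q Hq) as [B HF].
  assert (M : 0 < Cmod T) by (apply Cmod_gt_0; exact NZ).
  apply Clim_of_dist with
    (fun n => / Cmod T * (Cmod (theta q n * FK n q - 1) + B * Cmod (theta q n - T))).
  - intros n.
    replace (FK n q - / T)%C with (/ T * ((theta q n * FK n q - 1) - FK n q * (theta q n - T)))%C by (field; exact NZ).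
    rewrite Cmod_mult, Cmod_inv by exact NZ.
    apply Rmult_le_compat_l; [left; apply Rinv_0_lt_compat; assumption|].
    apply Rle_trans with (1 := Cmod_minus_triangle _ _). apply Rplus_le_compat_l.
    rewrite Cmod_mult. apply Rmult_le_compat_r; [apply Cmod_ge_0|apply HF].
  - replace (Finite 0) with (Finite (/ Cmod T * (Cmod (1 - 1) + B * Cmod (T - T)))).
    + apply is_lim_seq_mult'; [apply is_lim_seq_const|]. apply is_lim_seq_plus'.
      * apply Clim_Cmod, Clim_minus; [assumption|apply Clim_const].
      * apply is_lim_seq_mult'; [apply is_lim_seq_const|].
        apply Clim_Cmod, Clim_minus; [assumption|apply Clim_const].
    + f_equal. replace (1 - 1)%C with (RtoC 0) by ring. replace (T - T)%C with (RtoC 0) by ring.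
      rewrite Cmod_0. ring.
Qed.

(* [FK K] and the overpartition series share their first [K+1] coefficients. *)
Lemma pbar_gf q : Cmod q < 1 ->
  (exists c : R, is_lim_seq (rsum (ssum pbar (Cmod q))) c) /\
  exists F, Clim (csum (gterm pbar q)) F /\ Clim (fun K => FK K q) F.
Proof.
  intros Hq. set (r := Cmod q) in *.
  assert (Hr : 0 <= r) by apply Cmod_ge_0.
  destruct (FK_bounded r (conj Hr Hq)) as [B HB].
  assert (Hrr : Cmod (RtoC r) = r) by (rewrite Cmod_R; apply Rabs_pos_eq; assumption).
  assert (PS : forall K M, rsum (ssum (ov K) r) M <= Cmod (FK K (RtoC r))).
  { intros K M. destruct (ov_gf K (RtoC r)) as [_ H]; [rewrite Hrr; assumption|].
    apply Clim_Cmod in H.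
    assert (H2 : is_lim_seq (rsum (ssum (ov K) r)) (Cmod (FK K (RtoC r)))).
    { eapply is_lim_seq_ext; [|exact H]. intros n.
      cbv beta; rewrite (csum_ext _ _ _ (fun i _ => gterm_RtoC (ov K) r i)), <- RtoC_rsum, Cmod_R, Rabs_pos_eq; [reflexivity|].
      apply rsum_ge0. intros; apply ssum_ge0; assumption. }
    apply rsum_le_lim; [intros; apply ssum_ge0; assumption|exact H2]. }
  assert (PB : forall M, rsum (ssum pbar r) M <= B).
  { intros M. rewrite (rsum_ext _ (ssum (ov M) r)); [apply Rle_trans with (1 := PS M M), HB|].
    intros i Hi. unfold ssum. rewrite (pbar_ov i M); [reflexivity|lia]. }
  destruct (rsum_bounded_conv (ssum pbar r) _ (fun i => ssum_ge0 pbar r i Hr) PB) as [c Hc].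
  split; [exists c; assumption|].
  assert (D : forall K, Cmod (csum (gterm pbar q) K - FK K q) <= c - rsum (ssum pbar r) K).
  { intros K. rewrite Cmod_minus_sym.
    destruct (ov_gf K q Hq) as [_ H].
    apply Clim_Cmod_le with (u := fun M => (csum (gterm (ov K) q) M - csum (gterm pbar q) K)%C)
       (v := fun M => rsum (ssum pbar r) M - rsum (ssum pbar r) K).
    - apply Clim_minus; [assumption|apply Clim_const].
    - apply is_lim_seq_minus'; [assumption|apply is_lim_seq_const].
    - exists K. intros M HM.
      rewrite (csum_ext (gterm pbar q) (gterm (ov K) q)).
      2:{ intros i Hi. unfold gterm. rewrite (pbar_ov i K); [reflexivity|lia]. }
      apply csum_diff_le; [|assumption]. intros i. rewrite Cmod_gterm. unfold ssum.
      apply Rmult_le_compat_r; [apply pow_le; assumption|]. apply le_INR, ov_le_pbar. }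
  destruct (csum_conv (gterm pbar q) (ssum pbar r) c) as [F [HF _]]; [|assumption|].
  { intros i. rewrite Cmod_gterm. apply Rle_refl. }
  exists F. split; [assumption|].
  apply Clim_ext with (fun K => csum (gterm pbar q) K - (csum (gterm pbar q) K - FK K q))%C; [intros; ring|].
  replace F with (F - 0)%C by ring. apply Clim_minus; [assumption|].
  apply Clim_of_dist with (fun K => c - rsum (ssum pbar r) K).
  - intros K. replace (csum (gterm pbar q) K - FK K q - 0)%C with (csum (gterm pbar q) K - FK K q)%C by ring. apply D.
  - replace (Finite 0) with (Finite (c - c)) by (f_equal; ring).
    apply is_lim_seq_minus'; [apply is_lim_seq_const|assumption].
Qed.

(** * Poisson summation for the complex Gaussian *)

Lemma is_derive_Rlin c x : is_derive (fun y => c * y) x c.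
Proof. auto_derive; [trivial|ring]. Qed.

Lemma is_derive_rsum (f df : nat -> R -> R) n x :
  (forall i, is_derive (f i) x (df i x)) ->
  is_derive (fun y => rsum (fun i => f i y) n) x (rsum (fun i => df i x) n).
Proof.
  intros H. induction n; simpl; [apply (is_derive_const 0 x)|].
  apply is_derive_Rplus; [assumption|apply H].
Qed.

Definition freq (i : nat) : R := 2 * PI * INR (S i).

(** Partial sum of the Fourier series of x - x^2 on [0, 1], with the constant term distributed over
    the terms so that it vanishes at 0. [parab1] is its derivative, a partial sum for the sawtooth 1
    - 2 x, and [dirichlet] the Dirichlet kernel. *)
Definition parab (K : nat) (x : R) : R :=
  rsum (fun i => (1 - cos (freq i * x)) / (PI * INR (S i)) ^ 2) K.

Definition parab1 (K : nat) (x : R) : R :=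
  rsum (fun i => 2 * sin (freq i * x) / (PI * INR (S i))) K.

Definition dirichlet (K : nat) (x : R) : R :=
  1 + 2 * rsum (fun i => cos (freq i * x)) K.

Lemma INR_S_pos i : 0 < INR (S i).
Proof. apply lt_0_INR; lia. Qed.

Lemma is_derive_parab K x : is_derive (parab K) x (parab1 K x).
Proof.
  unfold parab, parab1.
  apply (is_derive_rsum (fun i y => (1 - cos (freq i * y)) / (PI * INR (S i)) ^ 2)
           (fun i y => 2 * sin (freq i * y) / (PI * INR (S i)))).
  intros i. unfold freq. pose proof (INR_S_pos i). pose proof PI_RGT_0.
  generalize dependent (INR (S i)). intros k Hk.
  auto_derive; [trivial|]. field. split; lra.
Qed.

Lemma is_derive_parab1 K x : is_derive (parab1 K) x (2 * (dirichlet K x - 1)).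
Proof.
  unfold dirichlet, parab1.
  replace (2 * _) with (rsum (fun i => 4 * cos (freq i * x)) K) by (rewrite rsum_scal; ring).
  apply (is_derive_rsum (fun i y => 2 * sin (freq i * y) / (PI * INR (S i)))
           (fun i y => 4 * cos (freq i * y))).
  intros i. unfold freq. pose proof (INR_S_pos i). pose proof PI_RGT_0.
  generalize dependent (INR (S i)). intros k Hk.
  auto_derive; [trivial|]. field. split; lra.
Qed.

Lemma dirichlet_eq K x : dirichlet K x * sin (PI * x) = sin (INR (2 * K + 1) * (PI * x)).
Proof.
  unfold dirichlet. induction K.
  - simpl. rewrite Rmult_0_r, Rplus_0_r, !Rmult_1_l. reflexivity.
  - cbn [rsum]. rewrite Rmult_plus_distr_l, <- Rplus_assoc, Rmult_plus_distr_r, IHK.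
    unfold freq.
    replace (INR (2 * S K + 1) * (PI * x)) with (2 * PI * INR (S K) * x + PI * x)
      by (rewrite plus_INR, mult_INR; simpl; ring).
    replace (INR (2 * K + 1) * (PI * x)) with (2 * PI * INR (S K) * x - PI * x)
      by (rewrite S_INR, plus_INR, mult_INR; simpl; ring).
    rewrite sin_plus, sin_minus. ring.
Qed.

Lemma sin_INR_PI k : sin (INR k * PI) = 0.
Proof.
  induction k; [simpl; rewrite Rmult_0_l; apply sin_0|].
  rewrite S_INR, Rmult_plus_distr_r, Rmult_1_l, neg_sin, IHk. ring.
Qed.

Lemma cos_odd_half K : cos (INR (2 * K + 1) * (PI / 2)) = 0.
Proof.
  replace (INR (2 * K + 1) * (PI / 2)) with (INR K * PI + PI / 2)
    by (rewrite plus_INR, mult_INR; simpl; field).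
  rewrite cos_plus, cos_PI2, sin_PI2, sin_INR_PI. ring.
Qed.

(* Integration by parts of the Dirichlet kernel: [parab1 K x - (1 - 2 x)] differs from
   [- 2 cos(N pi x) / (N pi sin(pi x))], N = 2K+1, by a function whose derivative is
   dominated by that of [2 / (N pi sin(pi x))]. *)
Lemma parab1_approx K x : 0 < x <= 1 / 2 ->
  Rabs (parab1 K x - (1 - 2 * x)) <= 4 / (INR (2 * K + 1) * PI * sin (PI * x)).
Proof.
  intros Hx. pose proof PI_RGT_0 as P.
  assert (N : 0 < INR (2 * K + 1)) by (apply lt_0_INR; lia).
  set (E := fun x => parab1 K x - (1 - 2 * x)
     + 2 * cos (INR (2 * K + 1) * (PI * x)) / (INR (2 * K + 1) * PI * sin (PI * x))).
  set (G := fun x => 2 / (INR (2 * K + 1) * PI * sin (PI * x))).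
  assert (Sp : forall y, x <= y <= 1 / 2 -> 0 < sin (PI * y)) by (intros y Hy; apply sin_gt_0; nra).
  assert (Cp : forall y, x <= y <= 1 / 2 -> 0 <= cos (PI * y)) by (intros y Hy; apply cos_ge_0; nra).
  assert (AD : forall n y, 0 < n -> 0 < sin (PI * y) ->
    is_derive (fun y => 2 * cos (n * (PI * y)) / (n * PI * sin (PI * y))) y
          (2 * (- sin (n * (PI * y)) * sin (PI * y) * n - cos (n * (PI * y)) * cos (PI * y))
            / (n * sin (PI * y) ^ 2))).
  { intros n y Hn Hy. auto_derive; [apply Rgt_not_eq; apply Rmult_lt_0_compat; [apply Rmult_lt_0_compat|]; lra|].
    field. repeat split; lra. }
  assert (AG : forall n y, 0 < n -> 0 < sin (PI * y) ->
    is_derive (fun y => 2 / (n * PI * sin (PI * y))) y (- 2 * cos (PI * y) / (n * sin (PI * y) ^ 2))).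
  { intros n y Hn Hy. auto_derive; [apply Rgt_not_eq; apply Rmult_lt_0_compat; [apply Rmult_lt_0_compat|]; lra|].
    field. repeat split; lra. }
  assert (D : forall y, x <= y <= 1 / 2 ->
     is_derive E y (- 2 * cos (INR (2 * K + 1) * (PI * y)) * cos (PI * y) / (INR (2 * K + 1) * sin (PI * y) ^ 2))).
  { intros y Hy. pose proof (Sp y Hy) as S. unfold E.
    eapply is_derive_Req.
    - apply is_derive_Rplus.
      + apply is_derive_Rminus; [apply is_derive_parab1|].
        assert (Q : is_derive (fun y => 1 - 2 * y) y (- 2)) by (auto_derive; [trivial|ring]). exact Q.
      + assert (Q : is_derive (fun y => 2 * cos (INR (2 * K + 1) * (PI * y)) / (INR (2 * K + 1) * PI * sin (PI * y))) y
          (2 * (- sin (INR (2 * K + 1) * (PI * y)) * sin (PI * y) * INR (2 * K + 1) - cos (INR (2 * K + 1) * (PI * y)) * cos (PI * y))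
            / (INR (2 * K + 1) * sin (PI * y) ^ 2))).
        { apply AD; assumption. }
        exact Q.
    - rewrite <- dirichlet_eq. field. split; lra. }
  assert (DG : forall y, x <= y <= 1 / 2 ->
     is_derive G y (- 2 * cos (PI * y) / (INR (2 * K + 1) * sin (PI * y) ^ 2))).
  { intros y Hy. pose proof (Sp y Hy) as S. unfold G.
    apply AG; assumption. }
  assert (E2 : E (1 / 2) = 0).
  { unfold E. replace (PI * (1 / 2)) with (PI / 2) by field. rewrite cos_odd_half.
    assert (Z : parab1 K (1 / 2) = 0).
    { unfold parab1. apply rsum_0.
      intros i _. unfold freq. replace (2 * PI * INR (S i) * (1 / 2)) with (INR (S i) * PI) by field.
      rewrite sin_INR_PI. unfold Rdiv. ring. }
    rewrite Z. unfold Rdiv. rewrite Rmult_0_r, Rmult_0_l. lra. }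
  assert (G2 : 0 <= G (1 / 2)).
  { unfold G. apply Rdiv_le_0_compat; [lra|]. pose proof (Sp (1/2)). apply Rmult_lt_0_compat; [apply Rmult_lt_0_compat|]; lra. }
  assert (Q : forall y, x <= y <= 1 / 2 -> 0 <= 2 * cos (PI * y) / (INR (2 * K + 1) * sin (PI * y) ^ 2)).
  { intros y Hy. pose proof (Sp y Hy). pose proof (Cp y Hy).
    apply Rdiv_le_0_compat; [lra|]. apply Rmult_lt_0_compat; [assumption|]. apply pow_lt; assumption. }
  assert (B1 : E x <= G x).
  { pose proof (Rmvt_le (fun y => G y - E y)
      (fun y => - 2 * cos (PI * y) / (INR (2 * K + 1) * sin (PI * y) ^ 2)
       - (- 2 * cos (INR (2 * K + 1) * (PI * y)) * cos (PI * y) / (INR (2 * K + 1) * sin (PI * y) ^ 2))) x (1 / 2)) as M.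
    cbv beta in M. assert (G (1 / 2) - E (1 / 2) <= G x - E x); [|lra]. apply M; [lra| |].
    - intros y Hy. apply is_derive_Rminus; auto.
    - intros y Hy. specialize (Q y Hy).
      replace (_ - _) with (- ((1 - cos (INR (2 * K + 1) * (PI * y))) * (2 * cos (PI * y) / (INR (2 * K + 1) * sin (PI * y) ^ 2))))
        by (field; pose proof (Sp y Hy); split; lra).
      pose proof (COS_bound (INR (2 * K + 1) * (PI * y))).
      assert (0 <= (1 - cos (INR (2 * K + 1) * (PI * y))) * (2 * cos (PI * y) / (INR (2 * K + 1) * sin (PI * y) ^ 2)))
        by (apply Rmult_le_pos; lra). lra. }
  assert (B2 : - E x <= G x).
  { pose proof (Rmvt_le (fun y => G y + E y)
      (fun y => - 2 * cos (PI * y) / (INR (2 * K + 1) * sin (PI * y) ^ 2)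
       + (- 2 * cos (INR (2 * K + 1) * (PI * y)) * cos (PI * y) / (INR (2 * K + 1) * sin (PI * y) ^ 2))) x (1 / 2)) as M.
    cbv beta in M. assert (G (1 / 2) + E (1 / 2) <= G x + E x); [|lra]. apply M; [lra| |].
    - intros y Hy. apply is_derive_Rplus; auto.
    - intros y Hy. specialize (Q y Hy).
      replace (_ + _) with (- ((1 + cos (INR (2 * K + 1) * (PI * y))) * (2 * cos (PI * y) / (INR (2 * K + 1) * sin (PI * y) ^ 2))))
        by (field; pose proof (Sp y Hy); split; lra).
      pose proof (COS_bound (INR (2 * K + 1) * (PI * y))).
      assert (0 <= (1 + cos (INR (2 * K + 1) * (PI * y))) * (2 * cos (PI * y) / (INR (2 * K + 1) * sin (PI * y) ^ 2)))
        by (apply Rmult_le_pos; lra). lra. }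
  pose proof (Sp x ltac:(lra)) as S.
  assert (EG : 4 / (INR (2 * K + 1) * PI * sin (PI * x)) = 2 * G x) by (unfold G; field; repeat split; lra).
  rewrite EG.
  replace (parab1 K x - (1 - 2 * x)) with (E x - cos (INR (2 * K + 1) * (PI * x)) * G x)
    by (unfold E, G; field; repeat split; lra).
  pose proof (COS_bound (INR (2 * K + 1) * (PI * x))).
  assert (0 <= G x) by lra.
  apply Rabs_le. nra.
Qed.

(** The terms are at most 2 / (pi (m + 1))^2, hence at most the telescoping difference 1/m - 1/(m +
    1). *)
Lemma parab_tail K x : (0 < K)%nat -> forall M, (K <= M)%nat ->
  0 <= parab M x - parab K x <= / INR K - / INR M.
Proof.
  intros HK M H. induction H; [lra|].
  unfold parab in *. cbn [rsum].
  set (t := (1 - cos (freq m * x)) / (PI * INR (S m)) ^ 2).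
  assert (Ht : 0 <= t <= / INR m - / INR (S m)); [|lra].
  assert (M0 : 0 < INR m) by (apply lt_0_INR; lia).
  unfold t. rewrite S_INR. pose proof (COS_bound (freq m * x)). pose proof PI2_3_2 as P.
  assert (D : 0 < (PI * (INR m + 1)) ^ 2) by (apply pow_lt; nra).
  split; [apply Rdiv_le_0_compat; lra|].
  apply Rle_div_l; [assumption|].
  replace (/ INR m - / (INR m + 1)) with (/ (INR m * (INR m + 1))) by (field; lra).
  apply Rle_trans with 2; [lra|].
  apply Rmult_le_reg_l with (INR m * (INR m + 1)); [nra|].
  rewrite <- Rmult_assoc, Rinv_r, Rmult_1_l by nra.
  assert (P2 : 0 <= PI * PI - 2) by nra.
  pose proof (Rmult_le_pos _ _ P2 (pow2_ge_0 (INR m + 1))). nra.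
Qed.

Lemma one_minus_cos_le u : 1 - cos u <= u ^ 2 / 2.
Proof.
  replace u with (2 * (u / 2)) at 1 by field. rewrite cos_2a_sin.
  assert (H : Rabs (sin (u / 2)) <= Rabs (u / 2)).
  { destruct (Rle_lt_dec 0 (u / 2)) as [H|H].
    - pose proof (Cmvt (fun x => RtoC (sin x)) (fun x => RtoC (cos x)) (fun x => x) (fun _ => 1) 0 (u / 2) H) as M.
      cbv beta in M; rewrite <- RtoC_minus, Cmod_R, sin_0, !Rminus_0_r in M. rewrite (Rabs_pos_eq (u / 2)) by lra. apply M.
      + intros; apply CD_RtoC, is_derive_sin.
      + intros; apply (is_derive_id x).
      + intros; rewrite Cmod_R; apply Rabs_le, COS_bound.
    - pose proof (Cmvt (fun x => RtoC (sin x)) (fun x => RtoC (cos x)) (fun x => x) (fun _ => 1) (u / 2) 0 ltac:(lra)) as M.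
      cbv beta in M; rewrite <- RtoC_minus, Cmod_R, sin_0, Rminus_0_l, Rabs_Ropp in M. rewrite (Rabs_left (u / 2)) by lra.
      rewrite <- (Rminus_0_l (u / 2)). apply M.
      + intros; apply CD_RtoC, is_derive_sin.
      + intros; apply (is_derive_id x).
      + intros; rewrite Cmod_R; apply Rabs_le, COS_bound. }
  pose proof (pow_incr _ _ 2 (conj (Rabs_pos _) H)) as Q.
  rewrite !pow2_abs in Q. nra.
Qed.

Lemma parab_small K x : parab K x <= 2 * x ^ 2 * INR K.
Proof.
  unfold parab. induction K; [simpl; lra|]. cbn [rsum].
  replace (2 * x ^ 2 * INR (S K)) with (2 * x ^ 2 * INR K + 2 * x ^ 2) by (rewrite S_INR; ring).
  apply Rplus_le_compat; [assumption|].
  pose proof PI_RGT_0. pose proof (INR_S_pos K).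
  apply Rle_div_l; [apply pow_lt, Rmult_lt_0_compat; assumption|].
  apply Rle_trans with (1 := one_minus_cos_le _). unfold freq. right. field.
Qed.

Lemma parab_0 K : parab K 0 = 0.
Proof.
  unfold parab. apply rsum_0.
  intros i _. rewrite Rmult_0_r, cos_0. unfold Rdiv; ring.
Qed.

Lemma parab_sym K x : parab K (1 - x) = parab K x.
Proof.
  unfold parab. apply rsum_ext. intros i _. do 2 f_equal. unfold freq.
  replace (2 * PI * INR (S i) * (1 - x)) with (- (2 * PI * INR (S i) * x) + 2 * INR (S i) * PI) by ring.
  rewrite cos_period. apply cos_neg.
Qed.

(** The bound of [parab1_approx] on the derivative of the error blows up at 0, so it is integrated
    only from d = x / J on, with the order M chosen large after d. Near 0 both x - x^2 and the
    series are small, the latter by [parab_small] up to order J and by [parab_tail] beyond. This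
    identifies the sum of the series within eps, and the tail from K to M gives 1/K. *)
Lemma parab_approx_half K x : (0 < K)%nat -> 0 < x <= 1 / 2 ->
  Rabs (x - x ^ 2 - parab K x) <= / INR K.
Proof.
  intros HK Hx. pose proof PI_RGT_0 as P.
  apply le_epsilon. intros eps Heps.
  destruct (archimed_cor1 (eps / 3)) as [J [HJ1 HJ0]]; [lra|].
  assert (J0 : 0 < INR J) by (apply lt_0_INR; lia).
  assert (J1 : 1 <= INR J) by (apply (le_INR 1); lia).
  set (d := x / INR J).
  assert (Hd : 0 < d <= x).
  { unfold d. split; [apply Rdiv_lt_0_compat; lra|]. apply Rle_div_l; nra. }
  assert (Sd : 0 < sin (PI * d)) by (apply sin_gt_0; nra).
  destruct (archimed_cor1 (sin (PI * d) * (eps / 3))) as [M0 [HM HM0]]; [apply Rmult_lt_0_compat; lra|].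
  set (M := (M0 + K + J)%nat).
  assert (MM0 : 0 < INR M0) by (apply lt_0_INR; lia).
  assert (A1 : Rabs ((x - x ^ 2 - parab M x) - (d - d ^ 2 - parab M d)) <= eps / 3).
  { pose proof (Cmvt (fun y => RtoC (y - y ^ 2 - parab M y)) (fun y => RtoC (1 - 2 * y - parab1 M y))
      (fun y => 4 / (INR (2 * M + 1) * PI * sin (PI * d)) * y)
      (fun y => 4 / (INR (2 * M + 1) * PI * sin (PI * d))) d x ltac:(lra)) as Q.
    cbv beta in Q; rewrite <- RtoC_minus, Cmod_R in Q.
    assert (NM : INR M0 < INR (2 * M + 1)) by (apply lt_INR; unfold M; lia).
    (* The interval of integration has length at most 1/2, whence the factor 2. *)
    assert (B : 4 / (INR (2 * M + 1) * PI * sin (PI * d)) <= 2 * (eps / 3)).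
    { apply Rle_div_l; [apply Rmult_lt_0_compat; [apply Rmult_lt_0_compat|]; lra|].
      assert (1 < sin (PI * d) * (eps / 3) * INR M0).
      { apply Rmult_lt_reg_l with (/ INR M0); [apply Rinv_0_lt_compat; assumption|].
        rewrite Rmult_1_r. replace (/ INR M0 * _) with (sin (PI * d) * (eps / 3)) by (field; lra). assumption. }
      assert (Z : 0 < sin (PI * d) * (eps / 3)) by (apply Rmult_lt_0_compat; lra).
      assert (sin (PI * d) * (eps / 3) * INR M0 <= sin (PI * d) * (eps / 3) * INR (2 * M + 1))
        by (apply Rmult_le_compat_l; lra).
      set (W := sin (PI * d) * (eps / 3) * INR (2 * M + 1)) in *.
      replace (2 * (eps / 3) * (INR (2 * M + 1) * PI * sin (PI * d))) with (2 * PI * W) by (unfold W; ring).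
      pose proof PI2_3_2. nra. }
    eapply Rle_trans; [apply Q|].
    - intros y Hy. apply CD_RtoC. apply is_derive_Rminus; [|apply is_derive_parab].
      auto_derive; [trivial|ring].
    - intros y Hy. apply is_derive_Rlin.
    - intros y Hy. rewrite Cmod_R. replace (1 - 2 * y - parab1 M y) with (- (parab1 M y - (1 - 2 * y))) by ring.
      rewrite Rabs_Ropp. apply Rle_trans with (1 := parab1_approx M y ltac:(lra)).
      unfold Rdiv. apply Rmult_le_compat_l; [lra|]. apply Rinv_le_contravar; [apply Rmult_lt_0_compat; [apply Rmult_lt_0_compat|]; lra|].
      apply Rmult_le_compat_l; [apply Rmult_le_pos; lra|].
      apply sin_incr_1; nra.
    - rewrite <- Rmult_minus_distr_l.
      assert (0 <= 4 / (INR (2 * M + 1) * PI * sin (PI * d)))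
        by (apply Rdiv_le_0_compat; [lra|apply Rmult_lt_0_compat; [apply Rmult_lt_0_compat|]; lra]). nra. }
  pose proof (parab_tail J d HJ0 M ltac:(unfold M; lia)) as T1.
  pose proof (parab_tail K x HK M ltac:(unfold M; lia)) as T2.
  pose proof (parab_small J d) as S1.
  assert (iM : 0 <= / INR M) by (left; apply Rinv_0_lt_compat, lt_0_INR; unfold M; lia).
  assert (S2 : 2 * d ^ 2 * INR J <= 1 / 2 * / INR J).
  { unfold d. replace (2 * (x / INR J) ^ 2 * INR J) with (2 * x ^ 2 * / INR J) by (field; lra).
    apply Rmult_le_compat_r; [left; apply Rinv_0_lt_compat; assumption|nra]. }
  assert (S3 : d <= 1 / 2 * / INR J).
  { unfold d, Rdiv at 1. apply Rmult_le_compat_r; [left; apply Rinv_0_lt_compat; assumption|lra]. }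
  assert (S4 : 0 <= parab J d).
  { apply rsum_ge0. intros i _. pose proof (COS_bound (freq i * d)). pose proof (INR_S_pos i).
    apply Rdiv_le_0_compat; [lra|]. apply pow_lt, Rmult_lt_0_compat; lra. }
  apply Rabs_le_between in A1. apply Rabs_le. assert (0 <= d ^ 2 <= d) by nra. lra.
Qed.

Lemma parab_approx K x : (0 < K)%nat -> 0 <= x <= 1 -> Rabs (x - x ^ 2 - parab K x) <= / INR K.
Proof.
  intros HK Hx.
  assert (I : 0 < / INR K) by (apply Rinv_0_lt_compat, lt_0_INR; lia).
  assert (Z : forall y, y = 0 -> Rabs (y - y ^ 2 - parab K y) <= / INR K).
  { intros y ->. rewrite parab_0. replace (0 - 0 ^ 2 - 0) with 0 by ring. rewrite Rabs_R0. lra. }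
  destruct (Rle_lt_dec x (1 / 2)) as [H|H].
  - destruct (Req_dec x 0); [apply Z; assumption|apply parab_approx_half; [assumption|lra]].
  - rewrite <- parab_sym. replace (x - x ^ 2) with ((1 - x) - (1 - x) ^ 2) by ring.
    destruct (Req_dec x 1); [apply Z; lra|apply parab_approx_half; [assumption|lra]].
Qed.

(** * Gaussian integrals and their cosine transforms *)

Definition Ccont (f : R -> C) : Prop :=
  forall x, continuous (fun y => Re (f y)) x /\ continuous (fun y => Im (f y)) x.

Definition CInt (f : R -> C) (x : R) : C :=
  (RInt (fun u => Re (f u)) 0 x, RInt (fun u => Im (f u)) 0 x).

Lemma is_derive_RInt_cont (f : R -> R) x : (forall y, continuous f y) ->
  is_derive (fun y => RInt f 0 y) x (f x).
Proof.
  intros H. apply (is_derive_RInt f _ 0); [|apply H].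
  apply filter_forall. intros y. apply (RInt_correct f).
  apply (ex_RInt_continuous f). intros; apply H.
Qed.

Lemma CD_CInt f x : Ccont f -> CD (CInt f) x (f x).
Proof.
  intros H; split; simpl.
  - apply (is_derive_RInt_cont (fun u => Re (f u))). intros; apply H.
  - apply (is_derive_RInt_cont (fun u => Im (f u))). intros; apply H.
Qed.

Lemma CInt_0 f : CInt f 0 = RtoC 0.
Proof. unfold CInt. rewrite !RInt_point. reflexivity. Qed.

Lemma CD_Ccont f df : (forall x, CD f x (df x)) -> Ccont f.
Proof.
  intros H x. destruct (H x) as [H1 H2].
  split; [apply (ex_derive_continuous (fun y => Re (f y)))|apply (ex_derive_continuous (fun y => Im (f y)))];
    eexists; eassumption.
Qed.

Definition gauss (s : C) (u : R) : C := cexp (- s * (RtoC u * RtoC u)).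

Lemma CD_gauss s u : CD (gauss s) u (- 2 * s * RtoC u * gauss s u)%C.
Proof.
  unfold gauss. eapply CD_eq.
  - apply CD_cexp. apply CD_scal. apply CD_mult; apply CD_id.
  - cbv beta. ring.
Qed.

Lemma CD_gauss1 s u :
  CD (fun u => - 2 * s * RtoC u * gauss s u)%C u
     ((4 * s * s * (RtoC u * RtoC u) - 2 * s) * gauss s u)%C.
Proof.
  eapply CD_eq.
  - apply (CD_mult (fun u => - 2 * s * RtoC u)%C (gauss s)); [|apply CD_gauss].
    apply CD_scal, CD_id.
  - cbv beta. ring.
Qed.

Lemma Cmod_gauss s u : Cmod (gauss s u) = exp (- (Re s * u ^ 2)).
Proof.
  unfold gauss. rewrite Cmod_cexp. f_equal. unfold Re; simpl. ring.
Qed.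

Definition cgauss (s : C) (xi u : R) : C := (RtoC (cos (xi * u)) * gauss s u)%C.

Lemma CD_cos_lin (xi u : R) : CD (fun u => RtoC (cos (xi * u))) u (- RtoC xi * RtoC (sin (xi * u)))%C.
Proof.
  eapply CD_eq; [apply CD_RtoC with (l := - (xi * sin (xi * u)))|].
  - auto_derive; [trivial|ring].
  - rewrite RtoC_opp, RtoC_mult. ring.
Qed.

Lemma CD_sin_lin (xi u : R) : CD (fun u => RtoC (sin (xi * u))) u (RtoC xi * RtoC (cos (xi * u)))%C.
Proof.
  eapply CD_eq; [apply CD_RtoC with (l := xi * cos (xi * u))|].
  - auto_derive; [trivial|ring].
  - rewrite RtoC_mult. ring.
Qed.

Lemma Ccont_cgauss s xi : Ccont (cgauss s xi).
Proof.
  eapply CD_Ccont. intros u. apply (CD_mult (fun u => RtoC (cos (xi * u))) (gauss s));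
    [apply CD_cos_lin|apply CD_gauss].
Qed.

Definition sgauss (s : C) (xi u : R) : C := (RtoC (u * sin (xi * u)) * gauss s u)%C.

Lemma Ccont_sgauss s xi : Ccont (sgauss s xi).
Proof.
  apply (CD_Ccont _ (fun u => RtoC (sin (xi * u) + u * (xi * cos (xi * u))) * gauss s u
     + RtoC (u * sin (xi * u)) * (- 2 * s * RtoC u * gauss s u))%C).
  intros u. apply (CD_mult (fun u => RtoC (u * sin (xi * u))) (gauss s));
    [apply CD_RtoC|apply CD_gauss].
  auto_derive; [trivial|ring].
Qed.

Lemma is_derive_cos_transform (h : R -> R) (r xi : R) : (forall y, continuous h y) ->
  is_derive (fun x => RInt (fun u => cos (x * u) * h u) 0 r) xi
            (- RInt (fun u => u * sin (xi * u) * h u) 0 r).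
Proof.
  intros Hh.
  assert (D : forall x u, is_derive (fun z => cos (z * u) * h u) x (- (u * sin (x * u) * h u))).
  { intros x u. auto_derive; [trivial|ring]. }
  assert (Cs : forall x u, continuous (fun u => cos (x * u) * h u) u).
  { intros x u. apply (continuous_mult (fun u => cos (x * u)) h); [|apply Hh].
    apply (ex_derive_continuous (fun u => cos (x * u))). auto_derive; trivial. }
  assert (Cs' : forall x u, continuous (fun u => u * sin (x * u) * h u) u).
  { intros x u. apply (continuous_mult (fun u => u * sin (x * u)) h); [|apply Hh].
    apply (ex_derive_continuous (fun u => u * sin (x * u))). auto_derive; trivial. }
  replace (- RInt (fun u => u * sin (xi * u) * h u) 0 r)
    with (RInt (fun u => Derive (fun z => cos (z * u) * h u) xi) 0 r).
  - apply (is_derive_RInt_param (fun x u => cos (x * u) * h u)).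
    + apply filter_forall. intros x u _. eexists; apply D.
    + intros u _. apply continuity_2d_pt_ext with (fun x v => - (v * sin (x * v)) * h v).
      { intros x v. symmetry. etransitivity; [apply is_derive_unique, (D x v)|ring]. }
      apply continuity_2d_pt_mult.
      * apply continuity_2d_pt_opp. apply continuity_2d_pt_mult; [apply continuity_2d_pt_id2|].
        apply (continuity_1d_2d_pt_comp sin); [apply continuity_sin|].
        apply continuity_2d_pt_mult; [apply continuity_2d_pt_id1|apply continuity_2d_pt_id2].
      * apply (continuity_1d_2d_pt_comp h (fun _ v => v)); [|apply continuity_2d_pt_id2].
        apply continuity_pt_filterlim, Hh.
    + apply filter_forall. intros x. apply (ex_RInt_continuous (fun t => cos (x * t) * h t)).
      intros; apply Cs.
  - rewrite <- (RInt_opp (fun u => u * sin (xi * u) * h u)).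
    + apply RInt_ext. intros u _. apply is_derive_unique, (D xi u).
    + apply (ex_RInt_continuous (fun u => u * sin (xi * u) * h u)). intros; apply Cs'.
Qed.

Lemma CD_cos_transform s r xi :
  CD (fun x => CInt (cgauss s x) r) xi (- CInt (sgauss s xi) r)%C.
Proof.
  pose proof (CD_Ccont _ _ (CD_gauss s)) as G.
  assert (E : forall x, CInt (cgauss s x) r = (RInt (fun u => cos (x * u) * Re (gauss s u)) 0 r,
      RInt (fun u => cos (x * u) * Im (gauss s u)) 0 r)).
  { intros x. unfold CInt. f_equal; apply RInt_ext; intros u _; unfold cgauss;
      match goal with |- ?a = ?b => change (@eq R a b) end; unfold Re, Im; simpl; ring. }
  assert (E' : CInt (sgauss s xi) r = (RInt (fun u => u * sin (xi * u) * Re (gauss s u)) 0 r,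
      RInt (fun u => u * sin (xi * u) * Im (gauss s u)) 0 r)).
  { unfold CInt. f_equal; apply RInt_ext; intros u _; unfold sgauss;
      match goal with |- ?a = ?b => change (@eq R a b) end; unfold Re, Im; simpl; ring. }
  rewrite E'. split.
  - apply (is_derive_ext (fun x => RInt (fun u => cos (x * u) * Re (gauss s u)) 0 r)).
    { intros x. now rewrite E. }
    exact (is_derive_cos_transform (fun u => Re (gauss s u)) r xi (fun y => proj1 (G y))).
  - apply (is_derive_ext (fun x => RInt (fun u => cos (x * u) * Im (gauss s u)) 0 r)).
    { intros x. now rewrite E. }
    exact (is_derive_cos_transform (fun u => Im (gauss s u)) r xi (fun y => proj2 (G y))).
Qed.

(** The derivative of sin (xi u) e^(-s u^2), integrated over [0, r]; the boundary term survives
    because the integral is truncated. *)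
Lemma gauss_by_parts s xi r :
  (2 * s * CInt (sgauss s xi) r = RtoC xi * CInt (cgauss s xi) r - RtoC (sin (xi * r)) * gauss s r)%C.
Proof.
  set (F := fun u => (2 * s * CInt (sgauss s xi) u - RtoC xi * CInt (cgauss s xi) u
               + RtoC (sin (xi * u)) * gauss s u)%C).
  assert (D : forall u, CD F u (RtoC 0)).
  { intros u. unfold F. eapply CD_eq.
    - apply CD_plus.
      + apply (CD_minus (fun u => 2 * s * CInt (sgauss s xi) u)%C (fun u => RtoC xi * CInt (cgauss s xi) u)%C);
          apply CD_scal, CD_CInt; [apply Ccont_sgauss|apply Ccont_cgauss].
      + apply (CD_mult (fun u => RtoC (sin (xi * u))) (gauss s)); [apply CD_sin_lin|apply CD_gauss].
    - unfold sgauss, cgauss. rewrite RtoC_mult. ring. }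
  assert (Z : forall a b, a <= b -> F b = F a).
  { intros a b L. pose proof (Cmvt F (fun _ => RtoC 0) (fun _ => 0) (fun _ => 0) a b L) as M.
    assert (M0 : Cmod (F b - F a) <= 0 - 0).
    { apply M; intros; [apply D|apply (is_derive_const 0 x)|rewrite Cmod_0; lra]. }
    assert (E : (F b - F a)%C = RtoC 0) by (apply Cmod_eq_0; pose proof (Cmod_ge_0 (F b - F a)); lra).
    replace (F b) with (F b - F a + F a)%C by ring. rewrite E. ring. }
  assert (F0 : F 0 = RtoC 0).
  { unfold F. rewrite !CInt_0, Rmult_0_r, sin_0. ring. }
  assert (Fr : F r = RtoC 0).
  { destruct (Rle_lt_dec 0 r) as [H|H].
    - now rewrite (Z 0 r H).
    - rewrite <- (Z r 0); [assumption|lra]. }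
  unfold F in Fr.
  replace (RtoC xi * CInt (cgauss s xi) r - RtoC (sin (xi * r)) * gauss s r)%C
    with (2 * s * CInt (sgauss s xi) r - (2 * s * CInt (sgauss s xi) r - RtoC xi * CInt (cgauss s xi) r
               + RtoC (sin (xi * r)) * gauss s r))%C by ring.
  rewrite Fr. ring.
Qed.

Lemma Re_pos_neq_0 (s : C) : 0 < Re s -> s <> RtoC 0.
Proof. intros H E. rewrite E in H. simpl in H. lra. Qed.

(** The factor e^(xi^2 / (4 s)) integrates the differential equation in [xi] that [gauss_by_parts]
    gives for the transform; only the boundary term at [r] remains, and it dies out with the
    Gaussian. So the transform at [xi] is obtained relative to its value at 0. *)
Lemma gauss_transform_approx s xi r : 0 < Re s -> 0 <= xi ->
  Cmod (cexp (RtoC (xi ^ 2) / (4 * s)) * CInt (cgauss s xi) r - CInt (cgauss s 0) r)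
  <= xi * exp (xi ^ 2 * Rabs (Re (/ (4 * s)))) * / Cmod (2 * s) * Cmod (gauss s r).
Proof.
  intros Hs Hxi. pose proof (Re_pos_neq_0 s Hs) as NZ.
  set (F := fun x => (cexp (RtoC (x ^ 2) / (4 * s)) * CInt (cgauss s x) r)%C).
  set (B := exp (xi ^ 2 * Rabs (Re (/ (4 * s)))) * / Cmod (2 * s) * Cmod (gauss s r)).
  pose proof (Cmvt F
    (fun x => cexp (RtoC (x ^ 2) / (4 * s)) * (RtoC (sin (x * r)) * gauss s r / (2 * s)))%C
    (fun x => B * x) (fun _ => B) 0 xi Hxi) as M.
  replace (xi * exp (xi ^ 2 * Rabs (Re (/ (4 * s)))) * / Cmod (2 * s) * Cmod (gauss s r)) with (B * xi - B * 0)
    by (unfold B; ring).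
  replace (CInt (cgauss s 0) r) with (F 0).
  2:{ unfold F. replace (RtoC (0 ^ 2) / (4 * s))%C with (RtoC 0).
      - rewrite cexp_0. ring.
      - replace (0 ^ 2) with 0 by ring. unfold Cdiv. ring. }
  apply M.
  - intros x Hx. unfold F. eapply CD_eq.
    + apply (CD_mult (fun x => cexp (RtoC (x ^ 2) / (4 * s))) (fun x => CInt (cgauss s x) r)).
      * apply CD_cexp. apply CD_ext with (fun x => / (4 * s) * RtoC (x ^ 2))%C; [intros; unfold Cdiv; ring|].
        apply CD_scal, CD_RtoC. instantiate (1 := 2 * x). auto_derive; [trivial|ring].
      * apply CD_cos_transform.
    + assert (E := gauss_by_parts s x r).
      assert (E2 : CInt (sgauss s x) r = ((RtoC x * CInt (cgauss s x) r - RtoC (sin (x * r)) * gauss s r) / (2 * s))%C).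
      { rewrite <- E. field. exact NZ. }
      rewrite E2, RtoC_mult. field. exact NZ.
  - intros x Hx. apply is_derive_Rlin.
  - intros x Hx. rewrite !Cmod_mult, Cmod_div, !Cmod_mult.
    2:{ intros Z. apply NZ. apply (f_equal (fun z => z / 2)%C) in Z.
        replace (2 * s / 2)%C with s in Z by field. rewrite Z. field. }
    rewrite (Cmod_R (sin _)), Cmod_cexp. unfold B. unfold Rdiv at 1.
    rewrite !Cmod_mult.
    assert (E1 : exp (Re (RtoC (x ^ 2) / (4 * s))) <= exp (xi ^ 2 * Rabs (Re (/ (4 * s))))).
    { apply exp_le. unfold Cdiv. rewrite re_scal_l.
      apply Rle_trans with (x ^ 2 * Rabs (Re (/ (4 * s)))).
      - apply Rmult_le_compat_l; [apply pow2_ge_0|apply Rle_abs].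
      - apply Rmult_le_compat_r; [apply Rabs_pos|]. apply pow_incr; lra. }
    assert (E2 : Rabs (sin (x * r)) <= 1) by apply Rabs_le, SIN_bound.
    pose proof (exp_pos (Re (RtoC (x ^ 2) / (4 * s)))).
    pose proof (Cmod_ge_0 (gauss s r)). pose proof (Rabs_pos (sin (x * r))).
    assert (0 <= / (Cmod 2 * Cmod s)).
    { left; apply Rinv_0_lt_compat, Rmult_lt_0_compat; apply Cmod_gt_0; [apply RtoC_neq_0; lra|exact NZ]. }
    replace (exp (xi ^ 2 * Rabs (Re (/ (4 * s)))) * / (Cmod 2 * Cmod s) * Cmod (gauss s r))
      with (exp (xi ^ 2 * Rabs (Re (/ (4 * s)))) * (1 * Cmod (gauss s r) * / (Cmod 2 * Cmod s))) by ring.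
    apply Rmult_le_compat; [lra| |exact E1|].
    + repeat apply Rmult_le_pos; assumption.
    + apply Rmult_le_compat_r; [assumption|]. apply Rmult_le_compat_r; assumption.
Qed.

Lemma pow2_le_exp y : 0 <= y -> y ^ 2 <= 4 * exp y.
Proof.
  intros H. replace (exp y) with (exp (y / 2) * exp (y / 2)) by (rewrite <- exp_plus; f_equal; field).
  pose proof (exp_ineq1_le (y / 2)). nra.
Qed.

(** From (Re s y - 1)^2 >= 0; the rate 2 leaves one factor e^(-y) to spare against the polynomial in
    [gauss2_decay]. *)
Lemma gauss_decay s y : 0 < Re s -> 0 <= y -> Cmod (gauss s y) <= exp (/ Re s) * exp (- (2 * y)).
Proof.
  intros Hs Hy. rewrite Cmod_gauss, <- exp_plus. apply exp_le.
  assert (0 <= (Re s * y - 1) ^ 2 * / Re s).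
  { apply Rmult_le_pos; [apply pow2_ge_0|left; apply Rinv_0_lt_compat; assumption]. }
  replace ((Re s * y - 1) ^ 2 * / Re s) with (Re s * y ^ 2 - 2 * y + / Re s) in H by (field; lra). lra.
Qed.

Lemma gauss2_decay s : 0 < Re s -> exists B, 0 <= B /\ forall y, 0 <= y ->
  Cmod ((4 * s * s * (RtoC y * RtoC y) - 2 * s) * gauss s y) <= B * exp (- y).
Proof.
  intros Hs. exists ((16 * Cmod s * Cmod s + 2 * Cmod s) * exp (/ Re s)).
  pose proof (Cmod_ge_0 s) as S0. pose proof (exp_pos (/ Re s)) as E0.
  split; [apply Rmult_le_pos; [nra|lra]|]. intros y Hy.
  rewrite Cmod_mult.
  apply Rle_trans with ((4 * Cmod s * Cmod s * y ^ 2 + 2 * Cmod s) * (exp (/ Re s) * exp (- (2 * y)))).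
  - apply Rmult_le_compat; try apply Cmod_ge_0; [|apply gauss_decay; assumption].
    eapply Rle_trans; [apply Cmod_minus_triangle|].
    rewrite !Cmod_mult, !Cmod_R, !Rabs_pos_eq by lra. lra.
  - replace (- (2 * y)) with (- y + - y) by ring. rewrite exp_plus.
    pose proof (exp_pos (- y)) as Ey.
    assert (Q : y ^ 2 * exp (- y) <= 4).
    { pose proof (pow2_le_exp y Hy). rewrite exp_Ropp. pose proof (exp_pos y).
      apply Rle_div_l; lra. }
    assert (Q1 : exp (- y) <= 1) by (rewrite <- exp_0; apply exp_le; lra).
    replace ((4 * Cmod s * Cmod s * y ^ 2 + 2 * Cmod s) * (exp (/ Re s) * (exp (- y) * exp (- y))))
      with ((4 * Cmod s * Cmod s * (y ^ 2 * exp (- y)) + 2 * Cmod s * exp (- y)) * (exp (/ Re s) * exp (- y))) by ring.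
    rewrite (Rmult_assoc (16 * Cmod s * Cmod s + 2 * Cmod s)).
    apply Rmult_le_compat_r; [apply Rmult_le_pos; lra|].
    assert (0 <= Cmod s * Cmod s) by nra. nra.
Qed.

(** * Poisson summation over the half-integers *)

Definition trans_sum (s : C) (K : nat) (y : R) : C :=
  (CInt (cgauss s 0) y + csum (fun i => 2 * (- (1)) ^ S i * CInt (cgauss s (freq i)) y) K)%C.

Lemma CD_csum (f df : nat -> R -> C) n x :
  (forall i, CD (f i) x (df i x)) -> CD (fun y => csum (fun i => f i y) n) x (csum (fun i => df i x) n).
Proof.
  intros H. induction n; simpl; [apply CD_const|]. apply CD_plus; [assumption|apply H].
Qed.

Lemma pow_m1_RtoC k : ((- (1)) ^ k)%C = RtoC ((-1) ^ k).
Proof. rewrite RtoC_pow. f_equal. apply C_eq; unfold Re, Im; simpl; ring. Qed.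

Lemma cos_shift_freq i m y :
  cos (freq i * (y - (INR m - / 2))) = (-1) ^ S i * cos (freq i * y).
Proof.
  unfold freq.
  assert (P : forall k z, cos (z + INR k * PI) = (-1) ^ k * cos z).
  { induction k; intros z.
    - simpl. rewrite Rmult_0_l, Rplus_0_r. ring.
    - rewrite S_INR. replace (z + (INR k + 1) * PI) with ((z + INR k * PI) + PI) by ring.
      rewrite neg_cos, IHk. simpl. ring. }
  replace (2 * PI * INR (S i) * (y - (INR m - / 2)))
    with (2 * PI * INR (S i) * y - 2 * INR (m * S i) * PI + INR (S i) * PI)
    by (rewrite mult_INR; field).
  rewrite P. f_equal. rewrite <- (cos_period _ (m * S i)). f_equal. ring.
Qed.

(** The signs (-1)^k move the peaks of the Dirichlet kernel to the half-integers, so [trans_sum]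
    approximates the sum of the Gaussian over them. By periodicity the shift may be taken with any
    [m]. *)
Lemma CD_trans_sum s K m y :
  CD (trans_sum s K) y (RtoC (dirichlet K (y - (INR m - / 2))) * gauss s y)%C.
Proof.
  unfold trans_sum. eapply CD_eq.
  - apply CD_plus; [apply CD_CInt, Ccont_cgauss|].
    apply (CD_csum (fun i y => 2 * (- (1)) ^ S i * CInt (cgauss s (freq i)) y)%C
      (fun i y => 2 * (- (1)) ^ S i * cgauss s (freq i) y)%C).
    intros i. apply CD_scal, CD_CInt, Ccont_cgauss.
  - unfold dirichlet, cgauss. rewrite Rmult_0_l, cos_0, RtoC_plus, RtoC_mult, RtoC_rsum, Cmult_plus_distr_r.
    f_equal. rewrite <- csum_scal, Cmult_comm, <- csum_scal. apply csum_ext. intros i _.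
    rewrite cos_shift_freq, RtoC_mult, pow_m1_RtoC. ring.
Qed.

(** Two integrations by parts on the cell from m - 1/2 to m + 1/2 produce this antiderivative of
    half the kernel times the second derivative of the Gaussian. The variable x = y - (m - 1/2) runs
    through [0, 1], and the kernel vanishes at both ends. *)
Definition trap_remainder (s : C) (K m : nat) (y : R) : C :=
  (/ 2 * (RtoC ((y - (INR m - / 2)) - (y - (INR m - / 2)) ^ 2 - parab K (y - (INR m - / 2))) * (- 2 * s * RtoC y * gauss s y)
          - RtoC (1 - 2 * (y - (INR m - / 2)) - parab1 K (y - (INR m - / 2))) * gauss s y)
   - trans_sum s K y)%C.

(* The trapezoidal rule with the kernel [x - x^2 - parab K x], whose second derivative is
   [- 2 dirichlet K x]. *)
Lemma CD_trap_remainder s K m y :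
  CD (trap_remainder s K m) y
   (/ 2 * (RtoC ((y - (INR m - / 2)) - (y - (INR m - / 2)) ^ 2 - parab K (y - (INR m - / 2)))
     * ((4 * s * s * (RtoC y * RtoC y) - 2 * s) * gauss s y)))%C.
Proof.
  unfold trap_remainder. set (c := INR m - / 2).
  assert (D0 : is_derive (fun y => y - c) y 1) by (auto_derive; [trivial|ring]).
  assert (D1 : is_derive (fun y => (y - c) - (y - c) ^ 2 - parab K (y - c)) y (1 - 2 * (y - c) - parab1 K (y - c))).
  { eapply is_derive_Req.
    - apply is_derive_Rminus; [|apply (is_derive_comp (parab K) (fun y => y - c)); [apply is_derive_parab|exact D0]].
      instantiate (1 := 1 - 2 * (y - c)). auto_derive; [trivial|ring].
    - simpl. unfold scal; simpl. unfold mult; simpl. ring. }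
  assert (D2 : is_derive (fun y => 1 - 2 * (y - c) - parab1 K (y - c)) y (- 2 * dirichlet K (y - c))).
  { eapply is_derive_Req.
    - apply is_derive_Rminus; [|apply (is_derive_comp (parab1 K) (fun y => y - c)); [apply is_derive_parab1|exact D0]].
      instantiate (1 := - 2). auto_derive; [trivial|ring].
    - unfold scal; simpl. unfold mult; simpl. ring. }
  eapply CD_eq.
  - apply CD_minus; [|apply (CD_trans_sum s K m)].
    apply CD_scal. apply CD_minus.
    + apply (CD_mult (fun y => RtoC ((y - c) - (y - c) ^ 2 - parab K (y - c))) (fun y => - 2 * s * RtoC y * gauss s y)%C);
        [apply CD_RtoC, D1|apply CD_gauss1].
    + apply (CD_mult (fun y => RtoC (1 - 2 * (y - c) - parab1 K (y - c))) (gauss s)); [apply CD_RtoC, D2|apply CD_gauss].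
  - fold c. rewrite (RtoC_mult (-2)).
    replace (RtoC (-2)) with (- (2))%C by (apply C_eq; unfold Re, Im; simpl; ring). field.
Qed.

Lemma parab1_0 K : parab1 K 0 = 0.
Proof. apply rsum_0. intros i _. rewrite Rmult_0_r, sin_0. unfold Rdiv; ring. Qed.

Lemma parab1_half K : parab1 K (1 / 2) = 0.
Proof.
  apply rsum_0. intros i _. unfold freq.
  replace (2 * PI * INR (S i) * (1 / 2)) with (INR (S i) * PI) by field.
  rewrite sin_INR_PI. unfold Rdiv; ring.
Qed.

Lemma parab1_1 K : parab1 K 1 = 0.
Proof.
  apply rsum_0. intros i _. unfold freq.
  replace (2 * PI * INR (S i) * 1) with (0 + 2 * INR (S i) * PI) by ring.
  rewrite sin_period, sin_0. unfold Rdiv; ring.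
Qed.

Lemma parab_1 K : parab K 1 = 0.
Proof. replace 1 with (1 - 0) by ring. rewrite parab_sym. apply parab_0. Qed.

Lemma trap_remainder_left s K m :
  trap_remainder s K m (INR m - / 2)
  = (- / 2 * gauss s (INR m - / 2) - trans_sum s K (INR m - / 2))%C.
Proof.
  unfold trap_remainder.
  replace (INR m - / 2 - (INR m - / 2)) with 0 by ring.
  rewrite parab_0, parab1_0.
  replace (0 - 0 ^ 2 - 0) with 0 by ring. replace (1 - 2 * 0 - 0) with 1 by ring. ring.
Qed.

Lemma trap_remainder_right s K m :
  trap_remainder s K m (INR m + / 2)
  = (/ 2 * gauss s (INR m + / 2) - trans_sum s K (INR m + / 2))%C.
Proof.
  unfold trap_remainder.
  replace (INR m + / 2 - (INR m - / 2)) with 1 by field.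
  rewrite parab_1, parab1_1.
  replace (1 - 1 ^ 2 - 0) with 0 by ring. replace (RtoC (1 - 2 * 1 - 0)) with (- (1))%C; [ring|].
  rewrite <- RtoC_opp. f_equal. ring.
Qed.

Lemma trans_sum_0 s K : trans_sum s K 0 = RtoC 0.
Proof.
  unfold trans_sum. rewrite CInt_0.
  rewrite (csum_ext _ (fun i => RtoC 0 * RtoC 0)%C).
  - rewrite csum_scal. ring.
  - intros i _. rewrite CInt_0. ring.
Qed.

(** The cell of m = 0 is entered at its midpoint y = 0, where the sawtooth vanishes by symmetry and
    the derivative of the Gaussian is 0: the half line contributes no boundary term at 0. *)
Lemma trap_remainder_mid s K : trap_remainder s K 0 0 = RtoC 0.
Proof.
  unfold trap_remainder. rewrite trans_sum_0.
  replace (0 - (INR 0 - / 2)) with (1 / 2) by (simpl; field).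
  rewrite parab1_half. replace (1 - 2 * (1 / 2) - 0) with 0 by field. ring.
Qed.

Lemma trap_remainder_bound s (Hs : 0 < Re s) : exists B, 0 <= B /\ forall K m a b, (0 < K)%nat ->
  0 <= a -> INR m - / 2 <= a -> a <= b -> b <= INR m + / 2 ->
  Cmod (trap_remainder s K m b - trap_remainder s K m a) <= B * / INR K * (exp (- a) - exp (- b)).
Proof.
  destruct (gauss2_decay s Hs) as [B [B0 HB]].
  exists (B / 2). split; [lra|]. intros K m a b HK Ha Hma Hab Hb.
  assert (iK : 0 < / INR K) by (apply Rinv_0_lt_compat, lt_0_INR; lia).
  replace (B / 2 * / INR K * (exp (- a) - exp (- b)))
    with (- (B / 2 * / INR K) * exp (- b) - - (B / 2 * / INR K) * exp (- a)) by ring.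
  apply (Cmvt (trap_remainder s K m) (fun y => / 2 * (RtoC ((y - (INR m - / 2)) - (y - (INR m - / 2)) ^ 2 - parab K (y - (INR m - / 2)))
     * ((4 * s * s * (RtoC y * RtoC y) - 2 * s) * gauss s y)))%C
    (fun y => - (B / 2 * / INR K) * exp (- y)) (fun y => B / 2 * / INR K * exp (- y))); [assumption| | |].
  - intros y Hy. apply CD_trap_remainder.
  - intros y Hy. auto_derive; [trivial|ring].
  - intros y Hy. rewrite !Cmod_mult.
    rewrite <- (Cmod_mult (_ - _)), Cmod_R.
    assert (E : Cmod (/ 2) = / 2) by (rewrite <- RtoC_inv by lra; rewrite Cmod_R; apply Rabs_pos_eq; lra).
    rewrite E.
    replace (B / 2 * / INR K * exp (- y)) with (/ 2 * (/ INR K * (B * exp (- y)))) by (unfold Rdiv; ring).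
    apply Rmult_le_compat_l; [lra|].
    apply Rmult_le_compat; [apply Rabs_pos|apply Cmod_ge_0| |apply HB; lra].
    apply parab_approx; [assumption|lra].
Qed.

(** Half-integers are the endpoints of the cells and collect 1/2 from either side; the last one
    keeps half its weight. The bound is uniform in [N], so [N] may tend to infinity before [K]. *)
Lemma poisson_finite s (Hs : 0 < Re s) : exists B, 0 <= B /\ forall K N, (0 < K)%nat ->
  Cmod (csum (fun m => gauss s (INR m + / 2)) N + / 2 * gauss s (INR N + / 2) - trans_sum s K (INR N + / 2))
  <= B * / INR K.
Proof.
  destruct (trap_remainder_bound s Hs) as [B [B0 HB]]. exists B. split; [assumption|].
  intros K N HK.
  assert (iK : 0 < / INR K) by (apply Rinv_0_lt_compat, lt_0_INR; lia).
  (* A stronger bound for the induction on [N]: the bounds on the cells are differences of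
     exponentials and telescope. *)
  apply Rle_trans with (B * / INR K * (1 - exp (- (INR N + / 2)))).
  2:{ pose proof (exp_pos (- (INR N + / 2))). assert (0 <= B * / INR K) by (apply Rmult_le_pos; lra). nra. }
  induction N.
  - cbn [csum]. pose proof (HB K O 0 (INR 0 + / 2) HK) as H.
    rewrite trap_remainder_right, trap_remainder_mid, Ropp_0, exp_0 in H.
    eapply Rle_trans; [|apply H; simpl; lra]. right. f_equal. ring.
  - pose proof (HB K (S N) (INR (S N) - / 2) (INR (S N) + / 2) HK) as H.
    rewrite trap_remainder_right, trap_remainder_left in H.
    assert (E : INR (S N) - / 2 = INR N + / 2) by (rewrite S_INR; field).
    rewrite E in H. cbn [csum]. pose proof (pos_INR N).
    specialize (H ltac:(lra) ltac:(lra) ltac:(rewrite S_INR; lra) ltac:(lra)).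
    replace (_ - _)%C with
      ((csum (fun m => gauss s (INR m + / 2)) N + / 2 * gauss s (INR N + / 2) - trans_sum s K (INR N + / 2))
       + (/ 2 * gauss s (INR (S N) + / 2) - trans_sum s K (INR (S N) + / 2)
          - (- / 2 * gauss s (INR N + / 2) - trans_sum s K (INR N + / 2))))%C by field.
    eapply Rle_trans; [apply Cmod_triangle|]. lra.
Qed.

Lemma exp_opp_lim (c : R) : is_lim_seq (fun n => c * exp (- (INR n + / 2))) 0.
Proof.
  replace (Finite 0) with (Finite (c * exp (- / 2) * 0)) by (f_equal; ring).
  apply is_lim_seq_ext with (fun n => c * exp (- / 2) * (exp (- 1)) ^ n).
  - intros n. rewrite Rmult_assoc. f_equal.
    induction n; [simpl; rewrite Rmult_1_r; f_equal; ring|].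
    simpl pow. rewrite S_INR. replace (- (INR n + 1 + / 2)) with (- 1 + - (INR n + / 2)) by ring.
    rewrite exp_plus, <- IHn. ring.
  - apply is_lim_seq_mult'; [apply is_lim_seq_const|]. apply is_lim_seq_geom.
    pose proof (exp_pos (- 1)). rewrite Rabs_pos_eq by lra.
    rewrite <- exp_0. apply exp_increasing. lra.
Qed.

Lemma gauss_le_exp s y (Hs : 0 < Re s) : 0 <= y -> Cmod (gauss s y) <= exp (/ Re s) * exp (- y).
Proof.
  intros Hy. apply Rle_trans with (1 := gauss_decay s y Hs Hy).
  apply Rmult_le_compat_l; [left; apply exp_pos|apply exp_le; lra].
Qed.

Lemma gauss_lim s (Hs : 0 < Re s) : is_lim_seq (fun N => Cmod (gauss s (INR N + / 2))) 0.
Proof.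
  apply is_lim_seq_le_le with (fun _ => 0) (fun n => exp (/ Re s) * exp (- (INR n + / 2))).
  - intros n. pose proof (pos_INR n). split; [apply Cmod_ge_0|apply gauss_le_exp; [assumption|lra]].
  - apply is_lim_seq_const.
  - apply exp_opp_lim.
Qed.

Lemma cgauss_int_lim s (Hs : 0 < Re s) : exists g, Clim (fun N => CInt (cgauss s 0) (INR N + / 2)) g.
Proof.
  apply Clim_cauchy with (fun n => - exp (/ Re s) * exp (- (INR n + / 2))) 0; [apply exp_opp_lim|].
  intros n m L. apply le_INR in L. pose proof (pos_INR n).
  eapply Rle_trans; [|apply Rle_abs].
  apply (Cmvt (CInt (cgauss s 0)) (cgauss s 0)
     (fun y => - exp (/ Re s) * exp (- y)) (fun y => exp (/ Re s) * exp (- y))); [lra| | |].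
  - intros; apply CD_CInt, Ccont_cgauss.
  - intros y Hy. auto_derive; [trivial|ring].
  - intros y Hy. unfold cgauss. rewrite Rmult_0_l, cos_0, Cmod_mult, Cmod_1, Rmult_1_l.
    apply gauss_le_exp; [assumption|lra].
Qed.

Lemma cgauss_transform_lim s g xi (Hs : 0 < Re s) : 0 <= xi -> Clim (fun N => CInt (cgauss s 0) (INR N + / 2)) g ->
  Clim (fun N => CInt (cgauss s xi) (INR N + / 2)) (cexp (- (RtoC (xi ^ 2) / (4 * s))) * g)%C.
Proof.
  intros Hxi Hg.
  set (E := cexp (RtoC (xi ^ 2) / (4 * s))).
  assert (H : Clim (fun N => E * CInt (cgauss s xi) (INR N + / 2))%C g).
  { apply Clim_ext with (fun N => (E * CInt (cgauss s xi) (INR N + / 2) - CInt (cgauss s 0) (INR N + / 2))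
        + CInt (cgauss s 0) (INR N + / 2))%C; [intros; ring|].
    replace g with (0 + g)%C by ring. apply Clim_plus; [|assumption].
    apply Clim_of_dist with (fun N => xi * exp (xi ^ 2 * Rabs (Re (/ (4 * s)))) * / Cmod (2 * s) * Cmod (gauss s (INR N + / 2))).
    - intros N. replace (_ - 0)%C with (E * CInt (cgauss s xi) (INR N + / 2) - CInt (cgauss s 0) (INR N + / 2))%C by ring.
      apply gauss_transform_approx; assumption.
    - replace (Finite 0) with (Finite (xi * exp (xi ^ 2 * Rabs (Re (/ (4 * s)))) * / Cmod (2 * s) * 0)) by (f_equal; ring).
      apply is_lim_seq_mult'; [apply is_lim_seq_const|apply gauss_lim, Hs]. }
  apply Clim_ext with (fun N => cexp (- (RtoC (xi ^ 2) / (4 * s))) * (E * CInt (cgauss s xi) (INR N + / 2)))%C.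
  - intros N. rewrite cexp_opp. fold E. field. apply cexp_neq_0.
  - apply Clim_scal; assumption.
Qed.

(** The k-th frequency contributes freq^2 / (4 s) = pi^2 k^2 / s, so the transforms assemble to
    [theta] at e^(-pi^2 / s). *)
Lemma trans_sum_lim s g K (Hs : 0 < Re s) : Clim (fun N => CInt (cgauss s 0) (INR N + / 2)) g ->
  Clim (fun N => trans_sum s K (INR N + / 2)) (g * theta (cexp (- (RtoC (PI ^ 2) / s))) K)%C.
Proof.
  intros Hg. pose proof (Re_pos_neq_0 s Hs) as NZ. unfold trans_sum, theta.
  rewrite Cmult_plus_distr_l, Cmult_1_r. apply Clim_plus; [assumption|].
  rewrite <- csum_scal. induction K; cbn [csum]; [apply Clim_const|].
  apply Clim_plus; [assumption|].
  replace (g * (2 * (- (1)) ^ S K * cexp (- (RtoC (PI ^ 2) / s)) ^ (S K * S K)))%C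
    with (2 * (- (1)) ^ S K * (cexp (- (RtoC (freq K ^ 2) / (4 * s))) * g))%C.
  - apply Clim_scal, cgauss_transform_lim; try assumption.
    unfold freq. pose proof PI_RGT_0. pose proof (INR_S_pos K).
    apply Rmult_le_pos; [lra|lra].
  - rewrite cexp_pow.
    replace (RtoC (INR (S K * S K)) * - (RtoC (PI ^ 2) / s))%C with (- (RtoC (freq K ^ 2) / (4 * s)))%C; [ring|].
    unfold freq. rewrite mult_INR, !RtoC_pow, !RtoC_mult. field. exact NZ.
Qed.

(** With g the Gaussian integral over the half line and H the sum over half-integers, g theta
    (e^(-pi^2 / s)) = H, by N and then K to infinity in [poisson_finite]. It is applied with 4 p =
    pi^2 / s in place of s, which turns the nome into e^(-s). *)
Lemma poisson_gauss s (Hs : 0 < Re s) : exists g H,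
  Clim (fun N => CInt (cgauss s 0) (INR N + / 2)) g /\
  Clim (csum (fun m => gauss s (INR m + / 2))) H /\
  Clim (fun K => g * theta (cexp (- (RtoC (PI ^ 2) / s))) K)%C H.
Proof.
  destruct (cgauss_int_lim s Hs) as [g Hg].
  assert (HH : exists H, Clim (csum (fun m => gauss s (INR m + / 2))) H).
  { destruct (rsum_bounded_conv (fun m => exp (/ Re s) * exp (- (INR m + / 2)))
      (exp (/ Re s) * (1 / (1 - exp (- 1))))) as [c Hc].
    - intros m. apply Rmult_le_pos; left; apply exp_pos.
    - intros n. rewrite rsum_scal. apply Rmult_le_compat_l; [left; apply exp_pos|].
      assert (E1 : exp (- 1) < 1) by (rewrite <- exp_0; apply exp_increasing; lra).
      apply Rle_trans with (rsum (fun m => exp (- 1) ^ m) n).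
      + apply rsum_le. intros i _.
        assert (E : exp (- 1) ^ i = exp (- INR i)).
        { induction i; [simpl; rewrite Ropp_0, exp_0; reflexivity|].
          simpl pow. rewrite IHi, <- exp_plus, S_INR. f_equal; ring. }
        rewrite E. apply exp_le. lra.
      + apply Rle_div_r; [lra|].
        assert (E : rsum (fun m => exp (- 1) ^ m) n * (1 - exp (- 1)) = 1 - exp (- 1) ^ n).
        { induction n; [simpl; ring|]. cbn [rsum pow]. rewrite Rmult_plus_distr_r, IHn. ring. }
        rewrite E. assert (0 <= exp (- 1) ^ n) by (apply pow_le; left; apply exp_pos). lra.
    - destruct (csum_conv (fun m => gauss s (INR m + / 2)) (fun m => exp (/ Re s) * exp (- (INR m + / 2))) c) with (2 := Hc) as [H [HH _]].
      + intros i. pose proof (pos_INR i). apply gauss_le_exp; [assumption|lra].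
      + exists H; assumption. }
  destruct HH as [H HH].
  exists g, H. split; [assumption|]. split; [assumption|].
  destruct (poisson_finite s Hs) as [B [B0 HB]].
  apply Clim_incr_inv with 1%nat.
  apply Clim_of_dist with (fun K => B * / (INR K + 1)).
  - intros K. rewrite Nat.add_1_r, Cmod_minus_sym, <- S_INR.
    apply Clim_Cmod_le with
      (u := fun N => (csum (fun m => gauss s (INR m + / 2)) N + / 2 * gauss s (INR N + / 2) - trans_sum s (S K) (INR N + / 2))%C)
      (v := fun _ => B * / INR (S K)); [|apply is_lim_seq_const|].
    + apply Clim_minus; [|apply trans_sum_lim; assumption].
      replace H with (H + / 2 * 0)%C at 1 by ring. apply Clim_plus; [assumption|]. apply Clim_scal.
      apply Clim_of_dist with (2 := gauss_lim s Hs). intros n.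
      replace (gauss s (INR n + / 2) - 0)%C with (gauss s (INR n + / 2)) by ring. lra.
    + exists O. intros N _. apply HB. lia.
  - replace (Finite 0) with (Finite (B * 0)) by (f_equal; ring).
    apply is_lim_seq_mult'; [apply is_lim_seq_const|].
    replace (Finite 0) with (Rbar_inv p_infty) by reflexivity.
    apply is_lim_seq_inv; [|discriminate].
    apply is_lim_seq_ext with (fun n => INR (S n)); [intros; apply S_INR|].
    apply (is_lim_seq_incr_1 INR), is_lim_seq_INR.
Qed.

(** * Rational bounds for pi *)

Lemma atan_series_bounds x N : 0 < x < 1 ->
  sum_f_R0 (tg_alt (Ratan_seq x)) (S (2 * N)) <= atan x <= sum_f_R0 (tg_alt (Ratan_seq x)) (2 * N).
Proof.
  intros Hx. rewrite atan_eq_ps_atan by assumption.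
  apply alternated_series_ineq; [apply Ratan_seq_decreasing; lra|apply Ratan_seq_converging; lra|].
  intros eps Heps. destruct (Ratan_is_ps_atan eps Heps) as [M HM].
  exists M. intros n Hn. unfold Rdist. apply HM; [assumption|lra|lra].
Qed.

(** Machin's formula, with the alternating arctangent series at 1/5 cut at the indices 14 and 15,
    and at 1/239 cut at 4 and 5. The fixed-point data use 16 decimals of pi. *)
Lemma PI_bounds : 314159265358979323846 / 10 ^ 20 <= PI <= 314159265358979323847 / 10 ^ 20.
Proof.
  pose proof Machin_4_5_239 as M.
  pose proof (atan_series_bounds (/ 5) 7 ltac:(lra)) as A.
  pose proof (atan_series_bounds (/ 239) 2 ltac:(lra)) as B.
  unfold tg_alt, Ratan_seq in A, B. simpl in A, B.
  simpl. lra.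
Qed.

Lemma PI_coarse : 3.14159 < PI < 3.1416.
Proof. pose proof PI_bounds. simpl in H. lra. Qed.

(** * Power sums [sum_n n^j e^(-n s)] and their leading terms *)

Lemma sin_ge_cubic x : 0 <= x -> x - x ^ 3 / 6 <= sin x.
Proof.
  intros Hx.
  pose proof (Rmvt_le (fun y => y - y ^ 3 / 6 - sin y) (fun y => 1 - y ^ 2 / 2 - cos y) 0 x Hx) as M.
  cbv beta in M. rewrite sin_0 in M.
  assert (x - x ^ 3 / 6 - sin x <= 0 - 0 ^ 3 / 6 - 0); [|lra].
  apply M.
  - intros y Hy. auto_derive; [trivial|field].
  - intros y Hy. pose proof (one_minus_cos_le y). lra.
Qed.

(** For 0 <= y <= pi the cubic bound gives sin (y / 2) >= 0.2932 y, and twice the square of 0.2932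
    exceeds 0.168. *)
Lemma one_minus_cos_ge x : Rabs x <= PI -> 0.168 * x ^ 2 <= 1 - cos x.
Proof.
  intros Hx. pose proof PI_coarse.
  assert (H0 : forall y, 0 <= y <= PI -> 0.168 * y ^ 2 <= 1 - cos y).
  { intros y Hy. replace (cos y) with (cos (2 * (y / 2))) by (f_equal; field).
    rewrite cos_2a_sin.
    pose proof (sin_ge_cubic (y / 2) ltac:(lra)) as S.
    assert (Q : y * 0.2932 <= y / 2 - (y / 2) ^ 3 / 6) by nra.
    nra. }
  destruct (Rle_lt_dec 0 x) as [L|L].
  - apply H0. rewrite Rabs_pos_eq in Hx; lra.
  - rewrite <- cos_neg. replace (x ^ 2) with ((- x) ^ 2) by ring.
    apply H0. rewrite Rabs_left in Hx; lra.
Qed.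

Lemma Cmod_cexp_minus_1 s : Cmod (cexp s - 1) ^ 2
  = (exp (Re s) - 1) ^ 2 + 2 * exp (Re s) * (1 - cos (Im s)).
Proof.
  rewrite Cmod2_alt.
  replace (Re (cexp s - 1)) with (exp (Re s) * cos (Im s) - 1) by (unfold Re, Im; simpl; unfold Re, Im; ring).
  replace (Im (cexp s - 1)) with (exp (Re s) * sin (Im s)) by (unfold Re, Im; simpl; unfold Re, Im; ring).
  pose proof (sin2_cos2 (Im s)) as E. unfold Rsqr in E.
  replace ((exp (Re s) * cos (Im s) - 1) ^ 2 + (exp (Re s) * sin (Im s)) ^ 2)
    with (exp (Re s) ^ 2 * (sin (Im s) * sin (Im s) + cos (Im s) * cos (Im s)) - 2 * exp (Re s) * cos (Im s) + 1) by ring.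
  rewrite E. ring.
Qed.

(** On the strip |Im s| <= pi the only zero of e^s - 1 is s = 0, so it is bounded below by a
    multiple of s; 0.336 is twice the constant of [one_minus_cos_ge]. *)
Lemma Cmod_cexp_minus_1_ge s : 0 < Re s -> Rabs (Im s) <= PI ->
  0.336 * Cmod s ^ 2 <= Cmod (cexp s - 1) ^ 2.
Proof.
  intros Hs Hi. rewrite Cmod_cexp_minus_1, Cmod2_alt.
  pose proof (one_minus_cos_ge (Im s) Hi) as H. pose proof (exp_ineq1_le (Re s)) as E.
  assert (0 <= 1 - cos (Im s)) by (pose proof (COS_bound (Im s)); lra).
  assert (Re s ^ 2 <= (exp (Re s) - 1) ^ 2) by nra. nra.
Qed.

(** The division by j! gives the power sum the leading term 1 / s^(j+1) with coefficient 1, and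
    makes e^(n w) the generating function in [j]. *)
Definition pw (j n : nat) : R := INR n ^ j / INR (fact j).

Lemma pw_ge0 j n : 0 <= pw j n.
Proof. apply Rdiv_le_0_compat; [apply pow_le, pos_INR|apply INR_fact_lt_0]. Qed.

Lemma pow_fact_le_exp x j : 0 <= x -> x ^ j / INR (fact j) <= exp x.
Proof.
  intros Hx. apply Rle_trans with (2 := exp_ge_taylor x j Hx).
  rewrite rsum_sum_f_R0. cbn [rsum].
  assert (0 <= rsum (fun k => x ^ k / INR (fact k)) j); [|lra].
  apply rsum_ge0. intros i _. apply Rdiv_le_0_compat; [apply pow_le; assumption|apply INR_fact_lt_0].
Qed.

Lemma rsum_geom_le r n : 0 <= r < 1 -> rsum (fun i => r ^ i) n <= / (1 - r).
Proof.
  intros Hr. replace (/ (1 - r)) with (1 / (1 - r)) by (unfold Rdiv; ring). apply Rle_div_r; [lra|].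
  assert (E : rsum (fun m => r ^ m) n * (1 - r) = 1 - r ^ n).
  { induction n; [simpl; ring|]. cbn [rsum pow]. rewrite Rmult_plus_distr_r, IHn. ring. }
  rewrite E. assert (0 <= r ^ n) by (apply pow_le; lra). lra.
Qed.

Lemma exp_opp_pow t n : exp (- t) ^ n = exp (- (INR n * t)).
Proof.
  induction n; [simpl; rewrite Rmult_0_l, Ropp_0, exp_0; reflexivity|].
  rewrite S_INR. simpl pow. rewrite IHn, <- exp_plus. f_equal. ring.
Qed.

(** Since n^j / j! <= (2 / t)^j e^(n t / 2), a geometric series of ratio e^(-t/2) dominates. *)
Lemma pw_conv j t : 0 < t -> exists c : R, is_lim_seq (rsum (fun n => pw j n * exp (- t) ^ n)) c.
Proof.
  intros Ht.
  assert (Hr : 0 <= exp (- (t / 2)) < 1).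
  { split; [left; apply exp_pos|]. rewrite <- exp_0. apply exp_increasing. lra. }
  apply rsum_bounded_conv with ((2 / t) ^ j * / (1 - exp (- (t / 2)))).
  - intros n. apply Rmult_le_pos; [apply pw_ge0|apply pow_le; left; apply exp_pos].
  - intros N. apply Rle_trans with (rsum (fun n => (2 / t) ^ j * exp (- (t / 2)) ^ n) N).
    + apply rsum_le. intros n _. unfold pw. rewrite !exp_opp_pow.
      assert (P : 0 <= INR n * (t / 2)) by (apply Rmult_le_pos; [apply pos_INR|lra]).
      pose proof (pow_fact_le_exp (INR n * (t / 2)) j P) as Q.
      replace (INR n ^ j / INR (fact j)) with ((2 / t) ^ j * ((INR n * (t / 2)) ^ j / INR (fact j))).
      * replace (- (INR n * t)) with (- (INR n * (t / 2)) + - (INR n * (t / 2))) by field.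
        rewrite exp_plus, !Rmult_assoc. apply Rmult_le_compat_l.
        { apply pow_le. apply Rdiv_le_0_compat; lra. }
        rewrite <- Rmult_assoc. rewrite <- (Rmult_1_l (exp (- (INR n * (t / 2))))) at 3.
        apply Rmult_le_compat_r; [left; apply exp_pos|].
        rewrite exp_Ropp. apply Rle_div_l; [apply exp_pos|]. lra.
      * unfold Rdiv at 2. rewrite <- Rmult_assoc, <- Rpow_mult_distr.
        replace (2 / t * (INR n * (t / 2))) with (INR n) by (field; lra). reflexivity.
    + rewrite rsum_scal. apply Rmult_le_compat_l; [apply pow_le, Rdiv_le_0_compat; lra|].
      apply rsum_geom_le; assumption.
Qed.

Definition pwsum_lim (q : C) (T : nat -> C) : Prop :=
  forall j, Clim (csum (fun n => RtoC (pw j n) * q ^ n)%C) (T j).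

(** Coefficient of w^i in (e^s - e^w) / (s - w), which is entire in w; [kcoef] has the coefficients
    of e^s - e^w itself, and [kap_0] and [kap_S] express the multiplication by s - w. *)
Definition kap (s : C) (i : nat) : C := ((cexp s - ctaylor s (S i)) / s ^ S i)%C.

Definition kcoef (s : C) (i : nat) : C :=
  match i with O => (cexp s - 1)%C | S _ => (- / INR (fact i))%C end.

Lemma Cfact_neq_0 n : RtoC (INR (fact n)) <> RtoC 0.
Proof. apply RtoC_neq_0, INR_fact_neq_0. Qed.

Lemma kap_0 s : s <> RtoC 0 -> (s * kap s 0 = cexp s - 1)%C.
Proof. intros H. unfold kap, ctaylor. simpl. field. exact H. Qed.

Lemma kap_S s i : s <> RtoC 0 -> (s * kap s (S i) = kap s i + kcoef s (S i))%C.
Proof.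
  intros H. unfold kap. change (ctaylor s (S (S i))) with (ctaylor s (S i) + s ^ S i / INR (fact (S i)))%C.
  unfold kcoef. rewrite (Cpow_S s (S i)).
  pose proof (Cpow_nz s (S i) H). pose proof (Cfact_neq_0 (S i)).
  generalize dependent (s ^ S i)%C. generalize dependent (RtoC (INR (fact (S i)))).
  intros f Hf w Hw. field. auto.
Qed.

Lemma Cmod_kap_le s i : 0 < Re s -> Cmod (kap s i) <= exp (Re s) / INR (fact (S i)).
Proof.
  intros Hs. assert (NZ : s <> RtoC 0) by (intros E; rewrite E in Hs; simpl in Hs; lra).
  pose proof (Cpow_nz s (S i) NZ) as NP.
  unfold kap. rewrite Cmod_div by exact NP.
  pose proof (cexp_ctaylor_le s (S i)) as T. rewrite Rmax_right in T by lra.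
  rewrite <- Cmod_pow in T. apply Cmod_gt_0 in NP.
  apply Rle_div_l; [exact NP|]. apply Rle_trans with (1 := T). right. field. apply INR_fact_neq_0.
Qed.

(** The pivot of the triangular system solved in [pwsum_error]; the square of 0.579 is below
    0.336. *)
Lemma Cmod_kap_0_ge s : 0 < Re s -> Rabs (Im s) <= PI -> 0.579 <= Cmod (kap s 0).
Proof.
  intros Hs Hi. assert (NZ : s <> RtoC 0) by (intros E; rewrite E in Hs; simpl in Hs; lra).
  pose proof (Cmod_cexp_minus_1_ge s Hs Hi) as H.
  rewrite <- kap_0, Cmod_mult in H by exact NZ.
  apply Cmod_gt_0 in NZ. pose proof (Cmod_ge_0 (kap s 0)).
  rewrite Rpow_mult_distr in H.
  assert (0.336 <= Cmod (kap s 0) ^ 2).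
  { apply Rmult_le_reg_l with (Cmod s ^ 2); [apply pow_lt; assumption|]. lra. }
  nra.
Qed.

(* In generating-function form: with T(w) = sum T_j w^j, (e^s - e^w) T(w) = e^s. *)
Lemma pwsum_rec s T j : pwsum_lim (cexp (- s)) T ->
  csum (fun i => T i * kcoef s (j - i))%C (S j) = (if Nat.eqb j 0 then cexp s else RtoC 0).
Proof.
  intros HT. set (q := cexp (- s)) in *.
  assert (qe : (q * cexp s)%C = RtoC 1).
  { unfold q. rewrite cexp_opp. field. apply cexp_neq_0. }
  assert (B : forall n, pw j (S n) = rsum (fun i => pw i n * / INR (fact (j - i))) (S j)).
  { intros n. unfold pw. rewrite S_INR, binomial, rsum_sum_f_R0.
    unfold Rdiv at 1. rewrite Rmult_comm, <- rsum_scal. apply rsum_ext. intros i Hi.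
    unfold Binomial.C. rewrite pow1.
    pose proof (INR_fact_neq_0 j). pose proof (INR_fact_neq_0 i). pose proof (INR_fact_neq_0 (j - i)).
    field. auto. }
  (* The power sum with n shifted by one, expanded by the binomial theorem; the term n = 0
     contributes only for j = 0. *)
  assert (L : (q * csum (fun i => T i * / INR (fact (j - i))) (S j)
     = T j - if Nat.eqb j 0 then RtoC 1 else RtoC 0)%C).
  { apply Clim_unique with (fun N => csum (fun n => RtoC (pw j n) * q ^ n)%C (N + 1) - if Nat.eqb j 0 then RtoC 1 else RtoC 0)%C.
    - apply Clim_ext with (fun N => q * csum (fun i => csum (fun n => RtoC (pw i n) * q ^ n) N * / INR (fact (j - i))) (S j))%C.
      + intros N. cbv beta. rewrite Nat.add_1_r, (csum_shift (fun n => RtoC (pw j n) * q ^ n)%C).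
        replace (RtoC (pw j 0) * q ^ 0)%C with (if Nat.eqb j 0 then RtoC 1 else RtoC 0).
        2:{ unfold pw. destruct j; simpl.
            - unfold Rdiv. rewrite Rinv_1, Rmult_1_r. ring.
            - rewrite Rmult_0_l. unfold Rdiv. rewrite Rmult_0_l. ring. }
        rewrite (csum_ext (fun i => csum (fun n => RtoC (pw i n) * q ^ n) N * / INR (fact (j - i)))%C
          (fun i => csum (fun n => / INR (fact (j - i)) * (RtoC (pw i n) * q ^ n)) N)%C)
          by (intros; rewrite csum_scal; ring).
        rewrite csum_exchange, <- csum_scal.
        rewrite (csum_ext (fun i => RtoC (pw j (S i)) * q ^ S i)%C
           (fun n => q * csum (fun i => / INR (fact (j - i)) * (RtoC (pw i n) * q ^ n)) (S j))%C).
        { ring. }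
        intros n _. rewrite B, RtoC_rsum, Cpow_S.
        rewrite (csum_ext (fun i => / INR (fact (j - i)) * (RtoC (pw i n) * q ^ n))%C
           (fun i => q ^ n * RtoC (pw i n * / INR (fact (j - i))))%C).
        { rewrite csum_scal. ring. }
        intros i _. rewrite RtoC_mult, RtoC_inv by apply INR_fact_neq_0. ring.
      + apply Clim_scal. generalize (S j). intros M. induction M; cbn [csum]; [apply Clim_const|].
        apply Clim_plus; [assumption|]. apply Clim_mult; [apply HT|apply Clim_const].
    - apply Clim_minus; [|apply Clim_const].
      apply Clim_incr with (u := csum (fun n => RtoC (pw j n) * q ^ n)%C). apply HT. }
  cbn [csum] in *. rewrite Nat.sub_diag in *. simpl kcoef.
  rewrite (csum_ext (fun i => T i * kcoef s (j - i))%C (fun i => - (1) * (T i * / INR (fact (j - i))))%C).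
  2:{ intros i Hi. destruct (j - i)%nat eqn:E; [lia|]. unfold kcoef. ring. }
  rewrite csum_scal.
  set (X := csum (fun i => T i * / INR (fact (j - i)))%C j) in *.
  replace (T j * / INR (fact 0))%C with (T j) in L by (simpl; field).
  assert (L2 : (X + T j = cexp s * (T j - if Nat.eqb j 0 then RtoC 1 else RtoC 0))%C).
  { rewrite <- L. transitivity ((q * cexp s) * (X + T j))%C; [rewrite qe|]; ring. }
  transitivity (cexp s * T j - (X + T j))%C; [ring|]. rewrite L2.
  destruct (Nat.eqb j 0); ring.
Qed.

Lemma pole_rec s j : s <> RtoC 0 ->
  csum (fun i => / s ^ S i * kcoef s (j - i))%C (S j) = kap s j.
Proof.
  intros NZ. induction j.
  - simpl. unfold kap, ctaylor. simpl. field. exact NZ.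
  - rewrite csum_shift, Nat.sub_0_r.
    rewrite (csum_ext _ (fun i => / s * (/ s ^ S i * kcoef s (j - i)))%C).
    + rewrite csum_scal, IHj, Cpow_1_r.
      transitivity (/ s * (kap s j + kcoef s (S j)))%C; [ring|].
      rewrite <- kap_S by exact NZ. field. exact NZ.
    + intros i _. replace (S j - S i)%nat with (j - i)%nat by lia.
      rewrite (Cpow_S s (S i)). pose proof (Cpow_nz s (S i) NZ).
      generalize dependent (s ^ S i)%C. intros w Hw. field. auto.
Qed.

(* Dividing (e^s - e^w)(T(w) - 1/(s-w)) by s - w. *)
Lemma pwsum_error_conv s T j : s <> RtoC 0 -> pwsum_lim (cexp (- s)) T ->
  csum (fun i => (T i - / s ^ S i) * kap s (j - i))%C (S j)
  = (kap s j - INR (S j) * kap s (S j))%C.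
Proof.
  intros NZ HT. set (e := fun i => (T i - / s ^ S i)%C).
  assert (EC : forall j, csum (fun i => e i * kcoef s (j - i))%C (S j)
     = ((if Nat.eqb j 0 then cexp s else RtoC 0) - kap s j)%C).
  { intros i. rewrite <- (pwsum_rec s T i HT), <- (pole_rec s i NZ), <- csum_minus.
    apply csum_ext. intros; unfold e; ring. }
  assert (Inj : forall a b, (s * a = s * b)%C -> a = b).
  { intros a b E. replace a with (/ s * (s * a))%C by (field; exact NZ). rewrite E. field. exact NZ. }
  induction j.
  - apply Inj. cbn [csum]. rewrite Nat.sub_diag.
    pose proof (EC O) as E0. cbn [csum Nat.eqb] in E0. rewrite Nat.sub_diag in E0. simpl kcoef in E0.
    replace (s * (0 + (T O - / s ^ 1) * kap s 0))%C with ((T O - / s ^ 1) * (s * kap s 0))%C by ring.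
    rewrite kap_0 by exact NZ.
    transitivity (0 + e O * (cexp s - 1))%C; [unfold e; ring|]. rewrite E0.
    replace (s * (kap s 0 - INR 1 * kap s 1))%C with (s * kap s 0 - (s * kap s 1))%C by (simpl; ring).
    rewrite kap_S, kap_0 by exact NZ. simpl. field.
  - apply Inj. rewrite <- csum_scal.
    transitivity (csum (fun i => e i * kap s (j - i)) (S j) + csum (fun i => e i * kcoef s (S j - i)) (S (S j)))%C.
    + change (csum ?f (S (S j))) with (csum f (S j) + f (S j))%C. cbv beta.
      rewrite Nat.sub_diag, Cplus_assoc, <- csum_plus. f_equal.
      * apply csum_ext. intros i Hi. replace (S j - i)%nat with (S (j - i)) by lia.
        transitivity (e i * (s * kap s (S (j - i))))%C; [unfold e; ring|]. rewrite kap_S by exact NZ. ring.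
      * transitivity (e (S j) * (s * kap s 0))%C; [unfold e; ring|]. rewrite kap_0 by exact NZ. reflexivity.
    + rewrite EC. unfold e. rewrite IHj. simpl Nat.eqb. cbv iota.
      replace (s * (kap s (S j) - INR (S (S j)) * kap s (S (S j))))%C
        with (s * kap s (S j) - INR (S (S j)) * (s * kap s (S (S j))))%C by ring.
      rewrite !kap_S by exact NZ. unfold kcoef.
      rewrite (fact_simpl (S j)), mult_INR, RtoC_mult.
      pose proof (Cfact_neq_0 (S j)) as N1.
      assert (N2 : RtoC (INR (S (S j))) <> RtoC 0) by (apply RtoC_neq_0, not_0_INR; lia).
      replace (RtoC (INR (S j))) with (RtoC (INR (S (S j))) - 1)%C
        by (rewrite (S_INR (S j)), RtoC_plus; ring).
      generalize dependent (RtoC (INR (fact (S j)))). generalize dependent (RtoC (INR (S (S j)))).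
      intros a Ha f Hf. field. auto.
Qed.

Lemma INR_fact_ge l : 2 * 3 ^ l <= INR (fact (S (S l))).
Proof.
  induction l; [simpl; lra|]. rewrite fact_simpl, mult_INR. simpl pow.
  assert (3 <= INR (S (S (S l)))) by (rewrite !S_INR; pose proof (pos_INR l); lra).
  assert (0 <= 3 ^ l) by (apply pow_le; lra). nra.
Qed.

(** Strong induction on [j]: the convolution is solved for its last unknown by dividing by
    [kap s 0], while |kap s l| <= e^(Re s) / (2 3^(l-1)) for l >= 1 makes the weighted sum over
    earlier indices at most 0.6 2^j. The constant 10 closes the induction because 1.053 (2 + 3) <
    5.79. *)
Lemma pwsum_error s T : 0 < Re s <= / 20 -> Rabs (Im s) <= PI -> pwsum_lim (cexp (- s)) T ->
  forall j, Cmod (T j - / s ^ S j) <= 10 * 2 ^ j.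
Proof.
  intros Hs Hi HT. assert (NZ : s <> RtoC 0) by (intros E; rewrite E in Hs; simpl in Hs; lra).
  set (e := fun i => (T i - / s ^ S i)%C).
  assert (Et : exp (Re s) <= 1.053).
  { pose proof (exp_ineq1_le (- Re s)) as Q. rewrite exp_Ropp in Q.
    pose proof (exp_pos (Re s)) as P.
    assert (exp (Re s) * (1 + - Re s) <= 1).
    { replace 1 with (exp (Re s) * / exp (Re s)) at 2 by (field; lra). apply Rmult_le_compat_l; lra. }
    nra. }
  pose proof (Cmod_kap_0_ge s (proj1 Hs) Hi) as K0.
  intros j. change (Cmod (e j) <= 10 * 2 ^ j).
  induction j as [j IH] using lt_wf_ind.
  pose proof (pwsum_error_conv s T j NZ HT) as E. cbn [csum] in E. rewrite Nat.sub_diag in E.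
  change (csum (fun i => e i * kap s (j - i)) j + e j * kap s 0 = kap s j - INR (S j) * kap s (S j))%C in E.
  assert (E2 : (e j * kap s 0 = (kap s j - INR (S j) * kap s (S j)) - csum (fun i => e i * kap s (j - i)) j)%C)
    by (rewrite <- E; ring).
  assert (M : Cmod (e j) * Cmod (kap s 0) <= 2 * exp (Re s) + 10 * exp (Re s) / 2 * (0.6 * 2 ^ j)).
  { rewrite <- Cmod_mult, E2. eapply Rle_trans; [apply Cmod_minus_triangle|]. apply Rplus_le_compat.
    - eapply Rle_trans; [apply Cmod_minus_triangle|]. rewrite Cmod_mult, Cmod_R, Rabs_pos_eq by apply pos_INR.
      pose proof (Cmod_kap_le s j (proj1 Hs)) as A1. pose proof (Cmod_kap_le s (S j) (proj1 Hs)) as A2.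
      pose proof (exp_pos (Re s)) as P.
      assert (F1 : 1 <= INR (fact (S j))) by (apply (le_INR 1), lt_O_fact).
      assert (F2 : INR (S j) <= INR (fact (S (S j)))).
      { rewrite fact_simpl, mult_INR, (S_INR (S j)). pose proof (pos_INR (S j)). nra. }
      assert (B1 : Cmod (kap s j) <= exp (Re s)).
      { apply Rle_trans with (1 := A1). apply Rle_div_l; [lra|]. nra. }
      assert (B2 : INR (S j) * Cmod (kap s (S j)) <= exp (Re s)).
      { apply Rle_trans with (INR (S j) * (exp (Re s) / INR (fact (S (S j))))).
        - apply Rmult_le_compat_l; [apply pos_INR|assumption].
        - pose proof (INR_S_pos j).
          replace (INR (S j) * (exp (Re s) / INR (fact (S (S j))))) with ((INR (S j) * exp (Re s)) / INR (fact (S (S j)))) by (unfold Rdiv; ring).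
          apply Rle_div_l; [lra|]. nra. }
      lra.
    - eapply Rle_trans; [apply Cmod_csum|].
      apply Rle_trans with (rsum (fun i => 10 * exp (Re s) / 2 * (2 ^ i * (/ 3) ^ (j - S i))) j).
      + apply rsum_le. intros i Hij. rewrite Cmod_mult. specialize (IH i Hij).
        pose proof (Cmod_kap_le s (j - i) (proj1 Hs)) as A.
        replace (10 * exp (Re s) / 2 * (2 ^ i * (/ 3) ^ (j - S i)))
          with ((10 * 2 ^ i) * (exp (Re s) * (/ (2 * 3 ^ (j - S i))))).
        2:{ rewrite pow_inv. field. apply pow_nonzero; lra. }
        apply Rmult_le_compat; [apply Cmod_ge_0|apply Cmod_ge_0|assumption|].
        apply Rle_trans with (1 := A). unfold Rdiv. apply Rmult_le_compat_l; [left; apply exp_pos|].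
        apply Rinv_le_contravar.
        * assert (0 < 3 ^ (j - S i)) by (apply pow_lt; lra). lra.
        * replace (S (j - i)) with (S (S (j - S i))) by lia. apply INR_fact_ge.
      + rewrite rsum_scal. apply Rmult_le_compat_l; [pose proof (exp_pos (Re s)); lra|].
        assert (Z : rsum (fun i => 2 ^ i * (/ 3) ^ (j - S i)) j <= 0.6 * 2 ^ j); [|exact Z].
        clear. induction j; [simpl; lra|].
        cbn [rsum]. rewrite Nat.sub_diag. cbn [pow].
        rewrite (rsum_ext _ (fun i => / 3 * (2 ^ i * (/ 3) ^ (j - S i)))).
        * rewrite rsum_scal. assert (0 < 2 ^ j) by (apply pow_lt; lra). lra.
        * intros i Hi. replace (S j - S i)%nat with (S (j - S i)) by lia. simpl. ring. }
  assert (P2 : 1 <= 2 ^ j) by (apply pow_R1_Rle; lra).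
  pose proof (Cmod_ge_0 (e j)).
  assert (Cmod (e j) * 0.579 <= Cmod (e j) * Cmod (kap s 0)) by (apply Rmult_le_compat_l; lra).
  assert (exp (Re s) * 2 ^ j <= 1.053 * 2 ^ j) by (apply Rmult_le_compat_r; lra).
  lra.
Qed.

(** * The overpartition series on the circle |q| = e^(-t) *)

(* Antiderivative of [(1 - v^2)^j]. *)
Fixpoint wal (j : nat) (v : R) : R :=
  match j with
  | O => v
  | S k => (2 * INR (S k) * wal k v + v * (1 - v ^ 2) ^ S k) / (2 * INR (S k) + 1)
  end.

Lemma is_derive_wal j v : is_derive (wal j) v ((1 - v ^ 2) ^ j).
Proof.
  revert v. induction j; intros v; [apply (is_derive_id v)|].
  pose proof (INR_S_pos j) as P.
  assert (Q : is_derive (fun v => v * (1 - v ^ 2) ^ S j) v ((1 - v ^ 2) ^ S j - 2 * INR (S j) * v ^ 2 * (1 - v ^ 2) ^ j)).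
  { assert (Q : forall k, is_derive (fun v => v * (1 - v ^ 2) ^ k) v
        ((1 - v ^ 2) ^ k + v * (INR k * (- 2 * v) * (1 - v ^ 2) ^ pred k))).
    { intros k. eapply is_derive_Req.
      - apply (is_derive_Rmult (fun v => v) (fun v => (1 - v ^ 2) ^ k)); [apply (is_derive_id v)|].
        apply (is_derive_pow (fun v => 1 - v ^ 2) k v (- 2 * v)). auto_derive; [trivial|ring].
      - change one with 1. ring. }
    eapply is_derive_Req; [apply Q|]. simpl pred. ring. }
  apply is_derive_ext with (fun v => / (2 * INR (S j) + 1) * (2 * INR (S j) * wal j v + v * (1 - v ^ 2) ^ S j)).
  { intros u. apply Rmult_comm. }
  eapply is_derive_Req.
  - apply (is_derive_scal (fun v => 2 * INR (S j) * wal j v + v * (1 - v ^ 2) ^ S j)).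
    apply is_derive_Rplus; [apply (is_derive_scal (wal j)), IHj|exact Q].
  - simpl pow. field. lra.
Qed.

Lemma wal_0 j : wal j 0 = 0.
Proof. induction j; [reflexivity|]. unfold wal; fold wal. rewrite IHj. unfold Rdiv. ring. Qed.

Lemma wal_1_S j : wal (S j) 1 = 2 * INR (S j) / (2 * INR (S j) + 1) * wal j 1.
Proof.
  unfold wal at 1; fold wal. pose proof (INR_S_pos j).
  replace (1 - 1 ^ 2) with 0 by ring. rewrite pow_i by lia. field. lra.
Qed.

Lemma wal_1_bounds j : 0 <= wal j 1 <= 1.
Proof.
  induction j; [simpl; lra|]. rewrite wal_1_S. pose proof (INR_S_pos j).
  assert (0 <= 2 * INR (S j) / (2 * INR (S j) + 1) <= 1).
  { split; [apply Rdiv_le_0_compat; lra|apply Rle_div_l; lra]. }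
  nra.
Qed.

(** The Wallis integral in closed form; combined with the factorials of [beta] and [pw] it produces
    the coefficients of cosh and sinh in [approx_lim]. *)
Lemma wal_1_fact j : wal j 1 = 4 ^ j * INR (fact j) ^ 2 / INR (fact (2 * j + 1)).
Proof.
  induction j; [simpl; field|].
  rewrite wal_1_S, IHj. replace (2 * S j + 1)%nat with (S (S (2 * j + 1))) by lia.
  rewrite (fact_simpl j), (fact_simpl (S (2 * j + 1))), (fact_simpl (2 * j + 1)), !mult_INR.
  pose proof (INR_fact_lt_0 j). pose proof (INR_fact_lt_0 (2 * j + 1)).
  replace (INR (S (S (2 * j + 1)))) with (2 * INR (S j) + 1)
    by (rewrite !S_INR, plus_INR, mult_INR; simpl; ring).
  replace (INR (S (2 * j + 1))) with (2 * INR (S j)) by (rewrite !S_INR, plus_INR, mult_INR; simpl; ring).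
  pose proof (INR_S_pos j). rewrite <- (tech_pow_Rmult 4 j). field. repeat split; lra.
Qed.

(* Taylor polynomial in [p] of the integral of [exp (p (1 - v^2))] over [0 <= v <= 1]. *)
Definition psi (J : nat) (p : C) : C := csum (fun j => p ^ j / INR (fact j) * RtoC (wal j 1))%C J.

(** With v = 2 u the integrand is exp (p (1 - v^2)), and 0 <= 1 - v^2 <= 1 keeps the pointwise
    Taylor remainder below the bound at v = 0. *)
Lemma psi_approx J p : 0 <= Re p ->
  Cmod (2 * cexp p * CInt (cgauss (4 * p) 0) (/ 2) - psi J p)
  <= exp (Re p) * Cmod p ^ J / INR (fact J).
Proof.
  intros Hp.
  set (F := fun u => (2 * cexp p * CInt (cgauss (4 * p) 0) u
     - csum (fun j => p ^ j / INR (fact j) * RtoC (wal j (2 * u))) J)%C).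
  pose proof (Cmvt F (fun u => 2 * (cexp (p * RtoC (1 - (2 * u) ^ 2)) - ctaylor (p * RtoC (1 - (2 * u) ^ 2)) J))%C
    (fun u => 2 * (exp (Re p) * Cmod p ^ J / INR (fact J)) * u)
    (fun _ => 2 * (exp (Re p) * Cmod p ^ J / INR (fact J))) 0 (/ 2) ltac:(lra)) as M.
  set (X := exp (Re p) * Cmod p ^ J / INR (fact J)) in *.
  replace X with (2 * X * / 2 - 2 * X * 0) by field.
  replace (2 * cexp p * CInt (cgauss (4 * p) 0) (/ 2) - psi J p)%C with (F (/ 2)%R - F 0%R)%C.
  2:{ unfold F, psi. rewrite CInt_0. replace (2 * / 2) with 1 by field.
      rewrite (csum_ext (fun j => p ^ j / INR (fact j) * RtoC (wal j (2 * 0)))%C (fun j => 0 * 0)%C).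
      - rewrite csum_scal. ring.
      - intros i _. rewrite Rmult_0_r, wal_0. ring. }
  apply M.
  - intros u _. unfold F. eapply CD_eq.
    + apply CD_minus.
      * apply CD_scal, CD_CInt, Ccont_cgauss.
      * apply (CD_csum (fun j u => p ^ j / INR (fact j) * RtoC (wal j (2 * u)))%C
          (fun j u => p ^ j / INR (fact j) * RtoC (2 * (1 - (2 * u) ^ 2) ^ j))%C).
        intros j. apply CD_scal, CD_RtoC. eapply is_derive_Req.
        -- apply (is_derive_comp (wal j) (fun u => 2 * u)); [apply is_derive_wal|apply is_derive_Rlin].
        -- unfold scal; simpl. unfold mult; simpl. reflexivity.
    + transitivity (2 * cexp (p * RtoC (1 - (2 * u) ^ 2)) - 2 * ctaylor (p * RtoC (1 - (2 * u) ^ 2)) J)%C; [|ring].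
      f_equal.
      * unfold cgauss, gauss. rewrite Rmult_0_l, cos_0.
        transitivity (2 * (cexp p * cexp (- (4 * p) * (RtoC u * RtoC u))))%C; [ring|].
        rewrite <- cexp_plus. f_equal. f_equal. rewrite RtoC_minus, RtoC_pow, RtoC_mult. ring.
      * unfold ctaylor. rewrite <- csum_scal. apply csum_ext. intros j _.
        rewrite Cpow_mult_l, RtoC_mult, <- RtoC_pow. unfold Cdiv. ring.
  - intros u _. apply is_derive_Rlin.
  - intros u Hu. rewrite Cmod_mult, Cmod_R, (Rabs_pos_eq 2) by lra.
    apply Rmult_le_compat_l; [lra|].
    apply Rle_trans with (1 := cexp_ctaylor_le _ _). unfold X.
    assert (V : 0 <= 1 - (2 * u) ^ 2 <= 1) by nra.
    unfold Rdiv. apply Rmult_le_compat_r; [left; apply Rinv_0_lt_compat, INR_fact_lt_0|].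
    apply Rmult_le_compat; [left; apply exp_pos|apply pow_le, Cmod_ge_0| |].
    + apply exp_le. apply Rmax_lub; [assumption|]. rewrite re_scal_r. nra.
    + apply pow_incr. split; [apply Cmod_ge_0|]. rewrite Cmod_mult, Cmod_R, Rabs_pos_eq by lra.
      pose proof (Cmod_ge_0 p). nra.
Qed.

Lemma Cmod_cgauss_0 s u : Cmod (cgauss s 0 u) = exp (- (Re s * u ^ 2)).
Proof. unfold cgauss. rewrite Rmult_0_l, cos_0, Cmod_mult, Cmod_1, Rmult_1_l. apply Cmod_gauss. Qed.

Lemma CInt_cgauss_half s : 0 <= Re s -> Cmod (CInt (cgauss s 0) (/ 2)) <= / 2.
Proof.
  intros Hs. replace (CInt (cgauss s 0) (/ 2)) with (CInt (cgauss s 0) (/ 2) - CInt (cgauss s 0) 0)%C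
    by (rewrite CInt_0; ring).
  replace (/ 2) with (1 * / 2 - 1 * 0) at 2 by ring.
  apply (Cmvt (CInt (cgauss s 0)) (cgauss s 0) (fun y => 1 * y) (fun _ => 1)); [lra| | |].
  - intros; apply CD_CInt, Ccont_cgauss.
  - intros; apply is_derive_Rlin.
  - intros u _. rewrite Cmod_cgauss_0, <- exp_0. apply exp_le.
    assert (0 <= Re s * u ^ 2) by (apply Rmult_le_pos; [assumption|apply pow2_ge_0]). lra.
Qed.

Lemma Re_4 p : Re (4 * p) = 4 * Re p.
Proof. unfold Re; simpl; ring. Qed.

(** For u >= 1/2 and Re p >= 1 one has 4 Re p u^2 >= Re p + 4 (u - 1/2). After multiplication by e^p
    the bound is 1/4, which permits the cut at 1/2. *)
Lemma CInt_cgauss_tail p g : 1 <= Re p ->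
  Clim (fun N => CInt (cgauss (4 * p) 0) (INR N + / 2)) g ->
  Cmod (g - CInt (cgauss (4 * p) 0) (/ 2)) <= exp (- Re p) / 4.
Proof.
  intros Hp Hg. apply Clim_dist_le with (1 := Hg). exists O. intros N _.
  set (G := fun y => - (exp (- Re p) / 4) * exp (- 4 * (y - / 2))).
  pose proof (pos_INR N).
  apply Rle_trans with (G (INR N + / 2) - G (/ 2)).
  - apply (Cmvt (CInt (cgauss (4 * p) 0)) (cgauss (4 * p) 0) G (fun y => exp (- Re p) * exp (- 4 * (y - / 2)))); [lra| | |].
    + intros; apply CD_CInt, Ccont_cgauss.
    + intros y _. unfold G. auto_derive; [trivial|]. replace (y + - / 2) with (y - / 2) by ring. field.
    + intros y Hy. rewrite Cmod_cgauss_0, Re_4, <- exp_plus. apply exp_le.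
      assert (0 <= (Re p * (y + / 2) - 1) * (y - / 2)) by (apply Rmult_le_pos; nra). lra.
  - unfold G. replace (- 4 * (/ 2 - / 2)) with 0 by ring. rewrite exp_0.
    pose proof (exp_pos (- Re p)). pose proof (exp_pos (- 4 * (INR N + / 2 - / 2))). nra.
Qed.

Lemma exp_opp_small P : 1 <= P -> exp (- P) <= / 2.
Proof.
  intros HP. rewrite exp_Ropp. apply Rinv_le_contravar; [lra|]. pose proof (exp_ineq1_le P). lra.
Qed.

(** The exponents 4 p (m + 1/2)^2 are p, 9 p, 25 p and so on, so beyond the first the terms are
    dominated by e^(-9 Re p) times a geometric series. *)
Lemma gauss_series_tail p H : 1 <= Re p ->
  Clim (csum (fun m => gauss (4 * p) (INR m + / 2))) H ->
  Cmod (H - cexp (- p)) <= 2 * exp (- (9 * Re p)).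
Proof.
  intros Hp HH. apply Clim_dist_le with (1 := HH). exists 1%nat. intros N HN.
  destruct N; [lia|]. rewrite csum_shift.
  replace (gauss (4 * p) (INR 0 + / 2)) with (cexp (- p)).
  2:{ unfold gauss. f_equal. simpl INR. rewrite Rplus_0_l, <- RtoC_mult.
      replace (/ 2 * / 2) with (/ 4) by field. rewrite RtoC_inv by lra. field. }
  replace (cexp (- p) + csum (fun i => gauss (4 * p) (INR (S i) + / 2)) N - cexp (- p))%C
    with (csum (fun i => gauss (4 * p) (INR (S i) + / 2)) N) by ring.
  eapply Rle_trans; [apply Cmod_csum|].
  apply Rle_trans with (rsum (fun i => exp (- (9 * Re p)) * (/ 2) ^ i) N).
  - apply rsum_le. intros i _. rewrite Cmod_gauss, Re_4.
    apply Rle_trans with (exp (- (9 * Re p)) * exp (- (1)) ^ i).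
    + rewrite exp_opp_pow, <- exp_plus. apply exp_le. rewrite S_INR. pose proof (pos_INR i).
      replace (4 * Re p * (INR i + 1 + / 2) ^ 2) with (Re p * (2 * INR i + 3) ^ 2) by field. nra.
    + apply Rmult_le_compat_l; [left; apply exp_pos|]. apply pow_incr.
      split; [left; apply exp_pos|apply exp_opp_small; lra].
  - rewrite rsum_scal. rewrite (Rmult_comm 2). apply Rmult_le_compat_l; [left; apply exp_pos|].
    apply Rle_trans with (1 := rsum_geom_le (/ 2) N ltac:(lra)). lra.
Qed.

(* The overpartition series at q = e^(-s) grows like exp (pi^2 / (4 s)) as s -> 0. *)
Definition pole (s : C) : C := (RtoC (PI ^ 2) / (4 * s))%C.

Lemma Re_pole s : Re (pole s) = PI ^ 2 * Re s / (4 * Cmod s ^ 2).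
Proof.
  unfold pole. destruct (Req_dec (Cmod s) 0) as [Z|NZ].
  - apply Cmod_eq_0 in Z. subst. unfold Cdiv. rewrite re_scal_l.
    replace (4 * 0)%C with (RtoC 0) by ring.
    rewrite Cmod_0. unfold Cinv, Re. simpl. unfold Rdiv. ring.
  - assert (NZ' : Cmod s ^ 2 <> 0) by (apply pow_nonzero; assumption).
    rewrite Cmod2_alt in *. unfold Cdiv. rewrite re_scal_l. unfold Cinv, Re, Im in *. simpl.
    destruct s as [a b]. simpl in *. field. split; intros Z; apply NZ'; nra.
Qed.

Lemma Cmod_pole s : s <> RtoC 0 -> Cmod (pole s) = PI ^ 2 / (4 * Cmod s).
Proof.
  intros NZ. unfold pole. rewrite Cmod_div, Cmod_mult, !Cmod_R, !Rabs_pos_eq; try lra; try apply pow2_ge_0.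
  intros E. apply NZ. replace s with (/ 4 * (4 * s))%C by field. rewrite E. ring.
Qed.

(** The product tends to g / H, where H is close to e^(-p) and g to its part c over [0, 1/2]. With E
    = e^(-Re p) <= 1/2, the numerator of g / H - e^p c is at most E / 4 + E^8 <= E / 2 <= |H|,
    whence the bound 1. *)
Lemma FK_near s : 0 < Re s -> 1 <= Re (pole s) ->
  exists F, Clim (fun K => FK K (cexp (- s))) F /\
    Cmod (F - cexp (pole s) * CInt (cgauss (4 * pole s) 0) (/ 2)) <= 1 /\
    Cmod F <= 2 * exp (Re (pole s)).
Proof.
  intros Hs Hp. set (p := pole s) in *.
  pose proof (Re_pos_neq_0 s Hs) as NZ.
  assert (NPI : RtoC PI <> RtoC 0) by (apply RtoC_neq_0, PI_neq0).
  assert (Hsig : 0 < Re (4 * p)) by (rewrite Re_4; lra).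
  destruct (poisson_gauss (4 * p) Hsig) as [g [H [Hg [HH HT]]]].
  replace (- (RtoC (PI ^ 2) / (4 * p)))%C with (- s)%C in HT.
  2:{ unfold p, pole. rewrite RtoC_pow. field. auto. }
  set (q := cexp (- s)) in *. set (c := CInt (cgauss (4 * p) 0) (/ 2)) in *.
  assert (Hq : Cmod q < 1).
  { unfold q. rewrite Cmod_cexp, <- exp_0. apply exp_increasing. rewrite re_opp. lra. }
  set (E := exp (- Re p)).
  assert (E0 : 0 < E) by apply exp_pos.
  assert (E1 : E <= / 2) by (apply exp_opp_small; assumption).
  assert (EE : exp (Re p) * E = 1) by (unfold E; rewrite <- exp_plus, Rplus_opp_r, exp_0; reflexivity).
  assert (E9 : exp (- (9 * Re p)) = E ^ 9) by (unfold E; rewrite exp_opp_pow; f_equal; simpl; ring).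
  pose proof (gauss_series_tail p H Hp HH) as B1. rewrite E9 in B1.
  pose proof (CInt_cgauss_tail p g Hp Hg) as B2. fold c E in B2.
  pose proof (CInt_cgauss_half (4 * p) ltac:(lra)) as B3. fold c in B3.
  assert (Em : Cmod (cexp (- p)) = E) by (rewrite Cmod_cexp, re_opp; reflexivity).
  assert (E8 : E ^ 8 <= / 256) by (replace (/ 256) with ((/ 2) ^ 8) by field; apply pow_incr; lra).
  assert (E8' : E ^ 9 <= E / 256) by (replace (E ^ 9) with (E * E ^ 8) by ring; unfold Rdiv; apply Rmult_le_compat_l; lra).
  assert (HL : E / 2 <= Cmod H).
  { pose proof (Cmod_minus_rev (cexp (- p)) H) as M. rewrite Cmod_minus_sym, Em in M. lra. }
  assert (HN : H <> RtoC 0) by (apply Cmod_gt_0; lra).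
  assert (gN : g <> RtoC 0).
  { intros G. apply HN. apply Clim_unique with (fun K => g * theta q K)%C; [assumption|].
    apply Clim_ext with (fun _ => RtoC 0); [intros; rewrite G; ring|apply Clim_const]. }
  assert (TL : Clim (theta q) (H / g)%C).
  { apply Clim_ext with (fun K => / g * (g * theta q K))%C; [intros; field; exact gN|].
    replace (H / g)%C with (/ g * H)%C by (unfold Cdiv; ring). apply Clim_scal; assumption. }
  exists (/ (H / g))%C. split.
  { apply FK_lim; [assumption|assumption|].
    intros Z. apply HN. replace H with (H / g * g)%C by (field; exact gN). rewrite Z. ring. }
  assert (X : Cmod (cexp p) = exp (Re p)) by apply Cmod_cexp.
  assert (XE : (cexp p * cexp (- p))%C = RtoC 1).
  { rewrite cexp_opp. field. apply cexp_neq_0. }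
  pose proof (exp_pos (Re p)) as P0.
  split.
  - replace (/ (H / g) - cexp p * c)%C with (((g - c) - c * (cexp p * (H - cexp (- p)))) / H)%C.
    2:{ replace (cexp p * (H - cexp (- p)))%C with (cexp p * H - 1)%C by (rewrite <- XE; ring). field. auto. }
    rewrite Cmod_div by exact HN. apply Rle_div_l; [lra|]. rewrite Rmult_1_l.
    eapply Rle_trans; [apply Cmod_minus_triangle|]. rewrite !Cmod_mult, X.
    assert (Cmod c * (exp (Re p) * Cmod (H - cexp (- p))) <= / 2 * (exp (Re p) * (2 * E ^ 9))).
    { apply Rmult_le_compat; [apply Cmod_ge_0| |assumption|].
      - apply Rmult_le_pos; [lra|apply Cmod_ge_0].
      - apply Rmult_le_compat_l; lra. }
    replace (/ 2 * (exp (Re p) * (2 * E ^ 9))) with ((exp (Re p) * E) * E ^ 8) in H0 by field.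
    rewrite EE, Rmult_1_l in H0.
    assert (E ^ 8 <= E / 128).
    { replace (E ^ 8) with (E * E ^ 7) by ring. unfold Rdiv. apply Rmult_le_compat_l; [lra|].
      replace (/ 128) with ((/ 2) ^ 7) by field. apply pow_incr; lra. }
    lra.
  - replace (/ (H / g))%C with (g / H)%C by (field; auto). rewrite Cmod_div by exact HN.
    apply Rle_div_l; [lra|].
    assert (Cmod g <= 1).
    { pose proof (Cmod_triangle (g - c) c) as M. replace (g - c + c)%C with g in M by ring. lra. }
    apply Rle_trans with (1 := H0).
    assert (exp (Re p) * (E / 2) <= exp (Re p) * Cmod H) by (apply Rmult_le_compat_l; lra). lra.
Qed.

Lemma sin_diff_PI a b : sin ((INR a - INR b) * PI) = 0.
Proof.
  rewrite Rmult_minus_distr_r, sin_minus, !sin_INR_PI. ring.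
Qed.

(* Multiplying by e^(i n th), the real part of the series has an explicit termwise antiderivative
   whose increment over [-pi, pi] isolates [d n]; the mean value inequality replaces the
   contour integral. *)
Lemma cauchy_coef (d : nat -> R) (t B c : R) :
  is_lim_seq (rsum (fun m => Rabs (d m) * exp (- t) ^ m)) c ->
  (forall th, Rabs th <= PI -> exists L,
    Clim (csum (fun m => RtoC (d m) * cexp (- (t, th)) ^ m)%C) L /\ Cmod L <= B) ->
  forall n, Rabs (d n) <= B * exp (INR n * t).
Proof.
  intros Hc HB n. pose proof PI_RGT_0 as P.
  set (g := fun m => Rabs (d m) * exp (- t) ^ m) in *.
  assert (F : forall M, (n < M)%nat -> Rabs (d n) * exp (- (INR n * t)) <= B + (c - rsum g M)).
  { intros M HM.
    set (w := fun m => d m * exp (- (INR m * t))).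
    set (U := fun th => rsum (fun m => w m * (if Nat.eqb m n then th else sin ((INR n - INR m) * th) / (INR n - INR m))) M).
    set (u := fun th => rsum (fun m => w m * cos ((INR n - INR m) * th)) M).
    assert (DU : forall th, is_derive U th (u th)).
    { intros th. unfold U, u.
      apply (is_derive_rsum (fun m th => w m * (if Nat.eqb m n then th else sin ((INR n - INR m) * th) / (INR n - INR m)))
        (fun m th => w m * cos ((INR n - INR m) * th))).
      intros m. apply (is_derive_scal (fun th => if Nat.eqb m n then th else sin ((INR n - INR m) * th) / (INR n - INR m))).
      destruct (Nat.eqb_spec m n) as [->|Hmn].
      - rewrite Rminus_diag, Rmult_0_l, cos_0 by reflexivity. apply (is_derive_id th).
      - assert (INR n - INR m <> 0) by (apply Rminus_eq_contra; intros E; apply INR_eq in E; auto).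
        auto_derive; [trivial|]. field. assumption. }
    assert (Bu : forall th, Rabs th <= PI -> Rabs (u th) <= B + (c - rsum g M)).
    { intros th Hth. destruct (HB th Hth) as [L [HL LB]].
      set (f := fun m => (RtoC (d m) * cexp (- (t, th)) ^ m)%C) in *.
      assert (Hf : forall m, Cmod (f m) <= g m).
      { intros m. unfold f, g. rewrite Cmod_mult, Cmod_R, Cmod_pow, Cmod_cexp. simpl. apply Rle_refl. }
      assert (E : u th = Re (csum f M * cexp (RtoC (INR n) * (0, th)))).
      { rewrite Cmult_comm, <- csum_scal, Re_csum. apply rsum_ext. intros m _. unfold f, w.
        rewrite cexp_pow.
        transitivity (d m * Re (cexp (RtoC (INR n) * (0, th)) * cexp (RtoC (INR m) * - (t, th)))).
        - rewrite <- cexp_plus. unfold cexp, Re, Im; simpl.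
          rewrite (Rmult_assoc (d m)). f_equal. f_equal; f_equal; ring.
        - rewrite <- re_scal_l. f_equal. ring. }
      rewrite E. apply Rle_trans with (1 := re_le_Cmod _). rewrite Cmod_mult, Cmod_cexp.
      replace (Re (RtoC (INR n) * (0, th))) with 0 by (rewrite re_scal_l; unfold Re; simpl; ring).
      rewrite exp_0, Rmult_1_r.
      destruct (csum_conv f g c Hf Hc) as [L' [HL' D]].
      rewrite (Clim_unique _ _ _ HL' HL) in D. specialize (D M).
      pose proof (Cmod_triangle (csum f M - L) L) as T.
      replace (csum f M - L + L)%C with (csum f M) in T by ring. lra. }
    pose proof (Cmvt (fun th => RtoC (U th)) (fun th => RtoC (u th)) (fun th => (B + (c - rsum g M)) * th)
       (fun _ => B + (c - rsum g M)) (- PI) PI ltac:(lra)) as MV.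
    cbv beta in MV. rewrite <- RtoC_minus, Cmod_R in MV.
    assert (EU : U PI - U (- PI) = 2 * PI * w n).
    { unfold U. clear - HM. revert HM.
      assert (G : forall M', rsum (fun m => w m * (if Nat.eqb m n then PI else sin ((INR n - INR m) * PI) / (INR n - INR m))) M'
         - rsum (fun m => w m * (if Nat.eqb m n then - PI else sin ((INR n - INR m) * - PI) / (INR n - INR m))) M'
         = if Nat.ltb n M' then 2 * PI * w n else 0).
      { clear. induction M' as [|M IHM]; [simpl; ring|]. cbn [rsum].
        replace (sin ((INR n - INR M) * - PI)) with 0
          by (rewrite <- Ropp_mult_distr_r, sin_neg, sin_diff_PI; ring).
        rewrite sin_diff_PI.
        destruct (Nat.ltb_spec n M); destruct (Nat.ltb_spec n (S M)); destruct (Nat.eqb_spec M n);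
          try lia; subst; unfold Rdiv; rewrite ?Rmult_0_l, ?Rmult_0_r; lra. }
      intros HM. rewrite G. destruct (Nat.ltb_spec n M); [reflexivity|lia]. }
    rewrite EU in MV.
    assert (MV2 : Rabs (2 * PI * w n) <= (B + (c - rsum g M)) * PI - (B + (c - rsum g M)) * - PI).
    { apply MV.
      - intros x _. apply CD_RtoC, DU.
      - intros x _. apply is_derive_Rlin.
      - intros x Hx. rewrite Cmod_R. apply Bu. apply Rabs_le. lra. }
    rewrite Rabs_mult, (Rabs_pos_eq (2 * PI)) in MV2 by lra.
    assert (W : Rabs (w n) = Rabs (d n) * exp (- (INR n * t))).
    { unfold w. rewrite Rabs_mult, (Rabs_pos_eq (exp _)); [reflexivity|left; apply exp_pos]. }
    rewrite W in MV2.
    apply Rmult_le_reg_l with (2 * PI); [lra|]. lra. }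
  assert (F2 : Rabs (d n) * exp (- (INR n * t)) <= B).
  { assert (H : Rbar_le (Rabs (d n) * exp (- (INR n * t))) B); [|exact H].
    apply is_lim_seq_le_loc with (u := fun _ => Rabs (d n) * exp (- (INR n * t))) (v := fun M => B + (c - rsum g M)).
    - exists (S n). intros M HM. apply F. lia.
    - apply is_lim_seq_const.
    - replace (Finite B) with (Finite (B + (c - c))) by (f_equal; ring).
      apply is_lim_seq_plus'; [apply is_lim_seq_const|]. apply is_lim_seq_minus'; [apply is_lim_seq_const|assumption]. }
  apply (Rmult_le_compat_r (exp (INR n * t))) in F2; [|left; apply exp_pos].
  rewrite Rmult_assoc, <- exp_plus, Rplus_opp_l, exp_0, Rmult_1_r in F2. exact F2.
Qed.

Lemma exp_small_bound t : 0 <= t <= / 20 -> exp t <= 1.053.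
Proof.
  intros Ht. pose proof (exp_ineq1_le (- t)) as Q. rewrite exp_Ropp in Q.
  pose proof (exp_pos t) as P.
  assert (exp t * (1 + - t) <= 1).
  { replace 1 with (exp t * / exp t) at 2 by (field; lra). apply Rmult_le_compat_l; lra. }
  nra.
Qed.

Lemma Clim_pow q : Cmod q < 1 -> Clim (fun n => q ^ S n)%C 0.
Proof.
  intros Hq. apply Clim_of_dist with (fun n => Cmod q ^ S n).
  - intros n. replace (q ^ S n - 0)%C with (q ^ S n)%C by ring. rewrite Cmod_pow. lra.
  - apply (is_lim_seq_incr_1 (fun n => Cmod q ^ n)). apply is_lim_seq_geom.
    rewrite Rabs_pos_eq; [assumption|apply Cmod_ge_0].
Qed.

(** Here Re p < 1 says Re s < 4 |s|^2 / pi^2. The real part of 1 / (e^s - 1) is at most (e^(Re s) -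
    1) / |e^s - 1|^2, and the lower bound on the strip gives 4 1.053 / (0.336 9.869) < 1.3. *)
Lemma Re_geom_le s : 0 < Re s <= / 20 -> Rabs (Im s) <= PI -> Re (pole s) < 1 ->
  Re (cexp (- s) / (1 - cexp (- s))) <= 1.3.
Proof.
  intros Hs Hi Hp. pose proof PI_coarse as P.
  assert (NZ : s <> RtoC 0) by (apply Re_pos_neq_0; lra).
  pose proof (Cmod_cexp_minus_1_ge s (proj1 Hs) Hi) as L.
  apply Cmod_gt_0 in NZ.
  assert (S2 : 0 < Cmod s ^ 2) by (apply pow_lt; assumption).
  assert (N1 : (cexp s - 1)%C <> RtoC 0).
  { intros E. rewrite E, Cmod_0 in L. nra. }
  replace (cexp (- s) / (1 - cexp (- s)))%C with (/ (cexp s - 1))%C.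
  2:{ rewrite cexp_opp. pose proof (cexp_neq_0 s). field. split; [assumption|exact N1]. }
  assert (R1 : Re (/ (cexp s - 1)) <= (exp (Re s) - 1) / Cmod (cexp s - 1) ^ 2).
  { rewrite Cmod2_alt. change (Re (/ (cexp s - 1))) with (Re (cexp s - 1) / (Re (cexp s - 1) ^ 2 + Im (cexp s - 1) ^ 2)).
    unfold Rdiv. apply Rmult_le_compat_r.
    - rewrite <- Cmod2_alt. left. apply Rinv_0_lt_compat. lra.
    - unfold Re at 1; simpl. pose proof (COS_bound (Im s)). pose proof (exp_pos (Re s)). nra. }
  apply Rle_trans with (1 := R1). apply Rle_div_l; [lra|].
  rewrite Re_pole in Hp. apply Rlt_div_l in Hp; [|lra].
  pose proof (exp_small_bound (Re s) ltac:(lra)) as Et.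
  assert (E1 : exp (Re s) - 1 <= 1.053 * Re s).
  { pose proof (exp_ineq1_le (- Re s)) as Q.
    assert (exp (Re s) * exp (- Re s) = 1) by (rewrite <- exp_plus, Rplus_opp_r; apply exp_0).
    pose proof (exp_pos (Re s)). nra. }
  assert (E2 : 9.869 * Re s <= PI ^ 2 * Re s) by (apply Rmult_le_compat_r; nra).
  lra.
Qed.

(** Against the real point e^(-t), the logarithm loses twice the difference of two geometric series:
    the real one is at least 1/t - 1, the other has real part at most 1.3 by [Re_geom_le], and 2 (1
    + 1.3) = 4.6. At the real point [FK_near] gives 2 e^(pi^2 / (4 t)). *)
Lemma FK_far s F : 0 < Re s <= / 20 -> Rabs (Im s) <= PI -> Re (pole s) < 1 ->
  Clim (fun K => FK K (cexp (- s))) F ->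
  Cmod F <= 2 * exp (PI ^ 2 / (4 * Re s) - 2 / Re s + 4.6).
Proof.
  intros Hs Hi Hp HF. set (t := Re s) in *. set (q := cexp (- s)) in *.
  pose proof PI_coarse as P.
  assert (Hr : Cmod q = exp (- t)) by (unfold q; rewrite Cmod_cexp, re_opp; reflexivity).
  assert (Hr1 : exp (- t) < 1) by (rewrite <- exp_0; apply exp_increasing; lra).
  pose proof (exp_pos (- t)) as Hr0.
  assert (Hq : Cmod q < 1) by lra.
  assert (Ept : Re (pole (RtoC t)) = PI ^ 2 / (4 * t)).
  { rewrite Re_pole, Cmod_R, re_RtoC, Rabs_pos_eq by lra. field. lra. }
  destruct (FK_near (RtoC t)) as [Fr [HFr [_ BFr]]].
  { rewrite re_RtoC. lra. }
  { rewrite Ept. apply Rle_div_r; [lra|]. nra. }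
  rewrite Ept in BFr.
  replace (cexp (- RtoC t)) with (RtoC (Cmod q)) in HFr.
  2:{ rewrite Hr, <- RtoC_opp, cexp_RtoC. reflexivity. }
  assert (G1 : is_lim_seq (fun K => gsum (Cmod q) K) (exp (- t) / (1 - exp (- t)))).
  { apply is_lim_seq_ext with (fun K => (exp (- t) - exp (- t) ^ S K) * / (1 - exp (- t))).
    - intros K. rewrite Hr, gsum_eq by lra. reflexivity.
    - replace (exp (- t) / (1 - exp (- t))) with ((exp (- t) - 0) * / (1 - exp (- t))) by (unfold Rdiv; ring).
      apply is_lim_seq_mult'; [|apply is_lim_seq_const].
      apply is_lim_seq_minus'; [apply is_lim_seq_const|].
      apply (is_lim_seq_incr_1 (fun n => exp (- t) ^ n)). apply is_lim_seq_geom. rewrite Rabs_pos_eq; lra. }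
  assert (G2 : Clim (gsumC q) (q / (1 - q))%C).
  { apply Clim_ext with (fun K => (q - q ^ S K) * / (1 - q))%C.
    - intros K. rewrite gsumC_eq by assumption. reflexivity.
    - replace (q / (1 - q))%C with ((q - 0) * / (1 - q))%C by (unfold Cdiv; ring).
      apply Clim_mult; [|apply Clim_const]. apply Clim_minus; [apply Clim_const|apply Clim_pow; assumption]. }
  apply Rle_trans with (Cmod Fr * exp (-2 * (exp (- t) / (1 - exp (- t)) - Re (q / (1 - q))))).
  - apply Clim_Cmod_le with (1 := HF)
      (v := fun K => Cmod (FK K (RtoC (Cmod q))) * exp (-2 * (gsum (Cmod q) K - Re (gsumC q K)))).
    + apply is_lim_seq_mult'; [apply Clim_Cmod; assumption|].
      apply is_lim_seq_continuous; [apply derivable_continuous_pt, derivable_pt_exp|].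
      apply is_lim_seq_mult'; [apply is_lim_seq_const|].
      apply is_lim_seq_minus'; [assumption|apply G2].
    + exists O. intros K _. apply Cmod_FK_le. assumption.
  - replace (2 * exp (PI ^ 2 / (4 * t) - 2 / t + 4.6)) with (2 * exp (PI ^ 2 / (4 * t)) * exp (- (2 / t) + 4.6))
      by (rewrite Rmult_assoc, <- exp_plus; do 2 f_equal; ring).
    apply Rmult_le_compat; [apply Cmod_ge_0|left; apply exp_pos|assumption|].
    apply exp_le. pose proof (Re_geom_le s Hs Hi Hp) as R1. fold q in R1.
    assert (R2 : / t - 1 <= exp (- t) / (1 - exp (- t))).
    { apply Rle_div_r; [lra|]. pose proof (exp_ineq1_le (- t)).
      assert ((/ t - 1) * (1 - exp (- t)) <= (/ t - 1) * t); [|replace ((/ t - 1) * t) with (1 - t) in H0 by (field; lra); lra].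
      apply Rmult_le_compat_l; [|lra].
      assert (20 <= / t) by (replace 20 with (/ / 20) by field; apply Rinv_le_contravar; lra). lra. }
    unfold Rdiv. unfold Rdiv in R1, R2 |- *. lra.
Qed.

(* By [beta_pole_sum] the coefficients of (psi - 1) / 2 in powers of 1/s; since
   [sum_m pw i m e^(-m s)] is 1/s^(i+1) up to a bounded error, the polynomials [approx I]
   reproduce the singular part of the overpartition series at s = 0. *)
Definition beta (i : nat) : R := / 2 * ((PI ^ 2 / 4) ^ S i / INR (fact (S i)) * wal (S i) 1).

Lemma beta_ge0 i : 0 <= beta i.
Proof.
  unfold beta. apply Rmult_le_pos; [lra|]. apply Rmult_le_pos; [|apply wal_1_bounds].
  apply Rdiv_le_0_compat; [apply pow_le|apply INR_fact_lt_0]. pose proof (pow2_ge_0 PI). lra.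
Qed.

Definition approx (I m : nat) : R := rsum (fun i => beta i * pw i m) I.

Lemma beta_pole_sum s I : s <> RtoC 0 ->
  csum (fun i => RtoC (beta i) * / s ^ S i)%C I = (/ 2 * (psi (S I) (pole s) - 1))%C.
Proof.
  intros NZ. unfold psi. rewrite csum_shift.
  replace (pole s ^ 0 / INR (fact 0) * RtoC (wal 0 1))%C with (RtoC 1)
    by (change (pole s ^ 0)%C with (RtoC 1); change (INR (fact 0)) with 1; change (wal 0 1) with 1; field).
  transitivity (/ 2 * csum (fun i => pole s ^ S i / INR (fact (S i)) * RtoC (wal (S i) 1)) I)%C; [|ring].
  rewrite <- csum_scal. apply csum_ext. intros i _. unfold beta.
  rewrite !RtoC_mult, RtoC_inv, RtoC_div by (try lra; apply INR_fact_neq_0).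
  replace (pole s) with (RtoC (PI ^ 2 / 4) * / s)%C
    by (unfold pole; rewrite RtoC_div by lra; field; exact NZ).
  rewrite Cpow_mult_l, Cpow_inv, RtoC_pow by exact NZ. unfold Cdiv. ring.
Qed.

Lemma exp_5_le : exp 5 <= 243.
Proof.
  replace 5 with (1 + 1 + 1 + 1 + 1) by ring. rewrite !exp_plus.
  pose proof exp_le_3 as E. pose proof (exp_pos 1).
  assert (exp 1 * exp 1 <= 9) by nra.
  assert (exp 1 * exp 1 * exp 1 <= 27) by nra.
  assert (exp 1 * exp 1 * exp 1 * exp 1 <= 81) by nra. nra.
Qed.

(** The weights 10 2^i are the errors allowed by [pwsum_error]. As pi^2 / 2 <= 5 and the Wallis
    integrals are at most 1, the sum is at most (5/2) e^5 <= (5/2) 243. *)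
Lemma beta_weight I : rsum (fun i => beta i * (10 * 2 ^ i)) I <= 608.
Proof.
  pose proof PI_coarse as P.
  apply Rle_trans with (5 / 2 * exp 5).
  - apply Rle_trans with (rsum (fun i => 5 / 2 * (5 ^ S i / INR (fact (S i)))) I).
    + apply rsum_le. intros i _. unfold beta.
      pose proof (wal_1_bounds (S i)) as W. pose proof (INR_fact_lt_0 (S i)) as Fp.
      assert (Q : (PI ^ 2 / 4) ^ S i * 2 ^ S i <= 5 ^ S i).
      { rewrite <- Rpow_mult_distr. apply pow_incr. nra. }
      assert (Z : 0 <= (PI ^ 2 / 4) ^ S i * 2 ^ S i).
      { rewrite <- Rpow_mult_distr. apply pow_le. nra. }
      replace (/ 2 * ((PI ^ 2 / 4) ^ S i / INR (fact (S i)) * wal (S i) 1) * (10 * 2 ^ i))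
        with (5 / 2 * (((PI ^ 2 / 4) ^ S i * 2 ^ S i) * wal (S i) 1 / INR (fact (S i))))
        by (rewrite <- (tech_pow_Rmult 2 i); generalize ((PI ^ 2 / 4) ^ S i), (wal (S i) 1); intros; field; lra).
      apply Rmult_le_compat_l; [lra|]. unfold Rdiv at 1 2.
      apply Rmult_le_compat_r; [left; apply Rinv_0_lt_compat; assumption|]. nra.
    + rewrite rsum_scal. apply Rmult_le_compat_l; [lra|].
      apply Rle_trans with (2 := exp_ge_taylor 5 I ltac:(lra)).
      rewrite rsum_sum_f_R0, rsum_shift. simpl (5 ^ 0 / INR (fact 0)). lra.
  - pose proof exp_5_le. lra.
Qed.

(** The limit as a function of the sequence, so that [pwsum_exists] can give one family for all
    exponents. *)
Definition Clim_val (u : nat -> C) : C :=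
  (real (Lim_seq (fun n => Re (u n))), real (Lim_seq (fun n => Im (u n)))).

Lemma Clim_val_correct u l : Clim u l -> Clim u (Clim_val u).
Proof.
  intros [H1 H2]. split; simpl;
    [rewrite (is_lim_seq_unique _ _ H1)|rewrite (is_lim_seq_unique _ _ H2)]; assumption.
Qed.

Lemma pwsum_exists s : 0 < Re s -> exists T, pwsum_lim (cexp (- s)) T.
Proof.
  intros Hs. exists (fun j => Clim_val (csum (fun n => RtoC (pw j n) * cexp (- s) ^ n)%C)).
  intros j. destruct (pw_conv j (Re s) Hs) as [c Hc].
  destruct (csum_conv (fun n => RtoC (pw j n) * cexp (- s) ^ n)%C (fun n => pw j n * exp (- Re s) ^ n) c)
    as [l [Hl _]]; [|assumption|].
  - intros n. rewrite Cmod_mult, Cmod_R, Rabs_pos_eq, Cmod_pow, Cmod_cexp, re_opp by apply pw_ge0. lra.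
  - apply Clim_val_correct with l. assumption.
Qed.

Definition tail (I : nat) (x : R) : R := exp x * x ^ S I / INR (fact (S I)).

(** Three discrepancies add up: F against e^p c (2 plus the exponential, by [FK_near] or [FK_far]),
    e^p c against the polynomial in 1/s (1 plus [tail]), and this polynomial against the power sums
    (608, by [beta_weight]). The absolute convergence is what [cauchy_coef] asks for. *)
Lemma series_bound s I : 0 < Re s <= / 20 -> Rabs (Im s) <= PI ->
  (exists c : R, is_lim_seq (rsum (fun m => Rabs (INR (pbar m) - approx I m) * exp (- Re s) ^ m)) c) /\
  exists L, Clim (csum (fun m => RtoC (INR (pbar m) - approx I m) * cexp (- s) ^ m)%C) L /\
    Cmod L <= 611 + 2 * exp (PI ^ 2 / (4 * Re s) - 2 / Re s + 4.6) + tail I (PI ^ 2 / (4 * Re s)).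
Proof.
  intros Hs Hi. set (t := Re s) in *. set (q := cexp (- s)).
  pose proof PI_coarse as P.
  assert (NZ : s <> RtoC 0) by (apply Re_pos_neq_0; fold t; lra).
  assert (Hr : Cmod q = exp (- t)) by (unfold q; rewrite Cmod_cexp, re_opp; reflexivity).
  assert (Hr1 : exp (- t) < 1) by (rewrite <- exp_0; apply exp_increasing; lra).
  pose proof (exp_pos (- t)) as Hr0.
  destruct (pbar_gf q ltac:(lra)) as [[cp Hcp] [F [HF HFK]]].
  rewrite Hr in Hcp.
  destruct (pwsum_exists s ltac:(fold t; lra)) as [T HT]. fold q in HT.
  pose proof (pwsum_error s T Hs Hi HT) as ET.
  split.
  { assert (CA : exists ca : R, is_lim_seq (rsum (fun m => approx I m * exp (- t) ^ m)) ca).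
    { induction I as [|I [ca Hca]].
      - exists 0. apply is_lim_seq_ext with (fun _ => 0); [|apply is_lim_seq_const].
        intros n. symmetry. apply rsum_0. intros; unfold approx; simpl; ring.
      - destruct (pw_conv I t ltac:(lra)) as [cI HcI].
        exists (ca + beta I * cI).
        apply is_lim_seq_ext with (fun n => rsum (fun m => approx I m * exp (- t) ^ m) n + beta I * rsum (fun m => pw I m * exp (- t) ^ m) n).
        + intros n. rewrite <- rsum_scal, <- rsum_plus. apply rsum_ext. intros; unfold approx; simpl; ring.
        + apply is_lim_seq_plus'; [assumption|]. apply is_lim_seq_mult'; [apply is_lim_seq_const|assumption]. }
    destruct CA as [ca Hca].
    assert (AP : forall m, 0 <= approx I m).
    { intros m. apply rsum_ge0. intros i _. apply Rmult_le_pos; [apply beta_ge0|apply pw_ge0]. }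
    assert (EP : forall m, 0 <= exp (- t) ^ m) by (intros; apply pow_le; lra).
    apply rsum_bounded_conv with (cp + ca).
    - intros m. apply Rmult_le_pos; [apply Rabs_pos|apply EP].
    - intros n. apply Rle_trans with (rsum (ssum pbar (exp (- t))) n + rsum (fun m => approx I m * exp (- t) ^ m) n).
      + rewrite <- rsum_plus. apply rsum_le. intros m _. unfold ssum. rewrite <- Rmult_plus_distr_r.
        apply Rmult_le_compat_r; [apply EP|].
        unfold Rminus. eapply Rle_trans; [apply Rabs_triang|].
        rewrite Rabs_Ropp, !Rabs_pos_eq; [lra|apply AP|apply pos_INR].
      + apply Rplus_le_compat; apply rsum_le_lim; try assumption.
        * intros; apply ssum_ge0; lra.
        * intros; apply Rmult_le_pos; [apply AP|apply EP]. }
  set (LA := csum (fun i => RtoC (beta i) * T i)%C I).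
  exists (F - LA)%C. split.
  { apply Clim_ext with (fun N => csum (gterm pbar q) N
       - csum (fun i => RtoC (beta i) * csum (fun n => RtoC (pw i n) * q ^ n) N) I)%C.
    - intros N.
      rewrite (csum_ext (fun i => RtoC (beta i) * csum (fun n => RtoC (pw i n) * q ^ n) N)%C
        (fun i => csum (fun n => RtoC (beta i) * (RtoC (pw i n) * q ^ n)) N)%C)
        by (intros; rewrite csum_scal; reflexivity).
      rewrite csum_exchange, <- csum_minus. apply csum_ext. intros m _. unfold gterm, approx.
      rewrite RtoC_minus, RtoC_rsum.
      rewrite (csum_ext (fun i => RtoC (beta i) * (RtoC (pw i m) * q ^ m))%C
        (fun i => q ^ m * RtoC (beta i * pw i m))%C) by (intros; rewrite RtoC_mult; ring).
      rewrite csum_scal. ring.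
    - apply Clim_minus; [assumption|]. unfold LA. clear - HT.
      induction I; cbn [csum]; [apply Clim_const|]. apply Clim_plus; [assumption|].
      apply Clim_scal, HT. }
  set (p := pole s).
  assert (Ep : Re p = PI ^ 2 * t / (4 * Cmod s ^ 2)) by apply Re_pole.
  assert (Sp : 0 < Cmod s) by (apply Cmod_gt_0; exact NZ).
  assert (St : t <= Cmod s) by (eapply Rle_trans; [apply Rle_abs|apply re_le_Cmod]).
  assert (S2 : 0 < Cmod s ^ 2) by (apply pow_lt; assumption).
  assert (P2 : 0 < PI ^ 2) by (apply pow_lt; lra).
  assert (Hp0 : 0 <= Re p) by (rewrite Ep; apply Rdiv_le_0_compat; [apply Rmult_le_pos; lra|lra]).
  assert (Hpm : Cmod p <= PI ^ 2 / (4 * t)).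
  { unfold p. rewrite Cmod_pole by exact NZ. unfold Rdiv. apply Rmult_le_compat_l; [lra|].
    apply Rinv_le_contravar; lra. }
  assert (Hpr : Re p <= PI ^ 2 / (4 * t)).
  { apply Rle_trans with (2 := Hpm). eapply Rle_trans; [apply Rle_abs|apply re_le_Cmod]. }
  set (c := CInt (cgauss (4 * p) 0) (/ 2)).
  pose proof (CInt_cgauss_half (4 * p) ltac:(rewrite Re_4; lra)) as Hc. fold c in Hc.
  assert (B1 : Cmod (csum (fun i => RtoC (beta i) * / s ^ S i)%C I - LA) <= 608).
  { apply Rle_trans with (2 := beta_weight I). unfold LA. rewrite <- csum_minus.
    eapply Rle_trans; [apply Cmod_csum|]. apply rsum_le. intros i _.
    replace (RtoC (beta i) * / s ^ S i - RtoC (beta i) * T i)%C with (- (RtoC (beta i) * (T i - / s ^ S i)))%C by ring.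
    rewrite Cmod_opp, Cmod_mult, Cmod_R, Rabs_pos_eq by apply beta_ge0.
    apply Rmult_le_compat_l; [apply beta_ge0|apply ET]. }
  assert (B2 : Cmod (cexp p * c - csum (fun i => RtoC (beta i) * / s ^ S i)%C I) <= 1 + tail I (PI ^ 2 / (4 * t))).
  { rewrite beta_pole_sum by exact NZ. fold p.
    replace (cexp p * c - / 2 * (psi (S I) p - 1))%C with (/ 2 * (2 * cexp p * c - psi (S I) p) + / 2)%C by field.
    assert (H2 : Cmod (/ 2) = / 2) by (rewrite <- RtoC_inv by lra; rewrite Cmod_R; apply Rabs_pos_eq; lra).
    eapply Rle_trans; [apply Cmod_triangle|]. rewrite Cmod_mult, H2.
    pose proof (psi_approx (S I) p Hp0) as A. fold c in A.
    assert (A2 : exp (Re p) * Cmod p ^ S I / INR (fact (S I)) <= tail I (PI ^ 2 / (4 * t))).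
    { unfold tail, Rdiv at 1 2. apply Rmult_le_compat_r; [left; apply Rinv_0_lt_compat, INR_fact_lt_0|].
      apply Rmult_le_compat; [left; apply exp_pos|apply pow_le, Cmod_ge_0|apply exp_le; assumption|].
      apply pow_incr. split; [apply Cmod_ge_0|assumption]. }
    pose proof (Cmod_ge_0 (2 * cexp p * c - psi (S I) p)). lra. }
  assert (B3 : Cmod (F - cexp p * c) <= 2 + 2 * exp (PI ^ 2 / (4 * t) - 2 / t + 4.6)).
  { pose proof (exp_pos (PI ^ 2 / (4 * t) - 2 / t + 4.6)) as EP.
    destruct (Rle_lt_dec 1 (Re p)) as [L|L].
    - destruct (FK_near s ltac:(fold t; lra) L) as [F' [HF' [A _]]].
      rewrite (Clim_unique _ _ _ HF' HFK) in A. fold p c in A. lra.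
    - pose proof (FK_far s F Hs Hi L HFK) as A. fold t in A.
      eapply Rle_trans; [apply Cmod_minus_triangle|].
      rewrite Cmod_mult, Cmod_cexp.
      assert (exp (Re p) <= 3) by (apply Rle_trans with (2 := exp_le_3); apply exp_le; lra).
      pose proof (exp_pos (Re p)).
      assert (exp (Re p) * Cmod c <= 3 * / 2) by (apply Rmult_le_compat; try lra; apply Cmod_ge_0). lra. }
  replace (F - LA)%C with ((F - cexp p * c) + (cexp p * c - csum (fun i => RtoC (beta i) * / s ^ S i)%C I)
     + (csum (fun i => RtoC (beta i) * / s ^ S i)%C I - LA))%C by ring.
  eapply Rle_trans; [apply Cmod_triangle|].
  eapply Rle_trans; [apply Rplus_le_compat_r, Cmod_triangle|]. lra.
Qed.

Lemma approx_bound t n I : 0 < t <= / 20 ->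
  Rabs (INR (pbar n) - approx I n)
  <= (611 + 2 * exp (PI ^ 2 / (4 * t) - 2 / t + 4.6) + tail I (PI ^ 2 / (4 * t))) * exp (INR n * t).
Proof.
  intros Ht. pose proof PI_coarse.
  destruct (series_bound (t, 0) I) as [[c Hc] _]; [exact Ht|unfold Im; simpl; rewrite Rabs_R0; lra|].
  apply (cauchy_coef (fun m => INR (pbar m) - approx I m) t _ c); [exact Hc|].
  intros th Hth. destruct (series_bound (t, th) I) as [_ [L HL]]; [exact Ht|exact Hth|].
  exists L. exact HL.
Qed.

(** * The main term in closed form *)

Lemma exp_taylor_lim x : is_lim_seq (fun N => rsum (fun m => x ^ m / INR (fact m)) N) (exp x).
Proof.
  assert (H : Clim (fun N => ctaylor (RtoC x) N) (cexp (RtoC x))).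
  { apply Clim_of_dist with (fun N => exp (Rmax 0 x) * (Rabs x ^ N / INR (fact N))).
    - intros N. rewrite Cmod_minus_sym. apply Rle_trans with (1 := cexp_ctaylor_le _ _).
      rewrite re_RtoC, Cmod_R. right. unfold Rdiv. ring.
    - replace (Finite 0) with (Finite (exp (Rmax 0 x) * 0)) by (f_equal; ring).
      apply is_lim_seq_mult'; [apply is_lim_seq_const|]. apply is_lim_seq_Reals, cv_speed_pow_fact. }
  rewrite cexp_RtoC in H. destruct H as [H _]. rewrite re_RtoC in H.
  eapply is_lim_seq_ext; [|exact H]. intros N. cbv beta. unfold ctaylor. rewrite Re_csum.
  apply rsum_ext. intros m _. rewrite <- RtoC_pow, <- RtoC_div, re_RtoC by apply INR_fact_neq_0. reflexivity.
Qed.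

Definition main_term (n : nat) : R :=
  / (8 * INR n) * (exp (mu n) * (1 - / mu n) + exp (- mu n) * (1 + / mu n)).

Lemma mu_pos n : (0 < n)%nat -> 0 < mu n.
Proof.
  intros H. apply Rmult_lt_0_compat; [apply PI_RGT_0|]. apply sqrt_lt_R0, lt_0_INR. assumption.
Qed.

Lemma mu_sqr n : mu n ^ 2 = PI ^ 2 * INR n.
Proof. unfold mu. rewrite Rpow_mult_distr, pow2_sqrt; [reflexivity|apply pos_INR]. Qed.

(** With k = 2 (i + 1) the term [beta i * pw i n] is mu^k (1/k! - 1/(k+1)!) / (4 n), so [approx] is
    a Taylor truncation of (cosh mu - sinh mu / mu) / (4 n), the constant terms 1 and 1
    cancelling. *)
Lemma approx_lim n : (0 < n)%nat -> is_lim_seq (fun I => approx I n) (main_term n).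
Proof.
  intros Hn. pose proof (mu_pos n Hn) as Hm. assert (Hn' : 0 < INR n) by (apply lt_0_INR; assumption).
  set (E := fun x N => rsum (fun m => x ^ m / INR (fact m)) N).
  assert (Q : forall I, approx I n = / (8 * INR n) *
     ((E (mu n) (2 * S I)%nat + E (- mu n) (2 * S I)%nat) - / mu n * (E (mu n) (2 * S I)%nat - E (- mu n) (2 * S I)%nat))).
  { induction I.
    - unfold approx, E. simpl. field. lra.
    - unfold approx in *. cbn [rsum]. rewrite IHI.
      replace (2 * S (S I))%nat with (S (S (2 * S I))) by lia. unfold E. cbn [rsum].
      set (k := (2 * S I)%nat).
      assert (Ev : (- mu n) ^ k = mu n ^ k) by (unfold k; rewrite !pow_mult; f_equal; ring).
      rewrite <- !(tech_pow_Rmult _ k), Ev.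
      assert (Em : mu n ^ k = (PI ^ 2) ^ S I * INR n ^ S I) by (unfold k; rewrite pow_mult, mu_sqr, Rpow_mult_distr; reflexivity).
      unfold beta, pw. rewrite wal_1_fact. fold k. rewrite Nat.add_1_r.
      rewrite (fact_simpl k), (fact_simpl I), !mult_INR.
      assert (Ek : INR (S k) = 2 * INR (S I) + 1) by (unfold k; rewrite S_INR, mult_INR; simpl; ring).
      rewrite Ek.
      replace ((PI ^ 2 / 4) ^ S I) with ((PI ^ 2) ^ S I / 4 ^ S I)
        by (unfold Rdiv; rewrite Rpow_mult_distr, pow_inv; reflexivity).
      pose proof (INR_fact_lt_0 k). pose proof (INR_fact_lt_0 I). pose proof (INR_S_pos I).
      assert (P4 : 0 < 4 ^ S I) by (apply pow_lt; lra).
      rewrite Em. rewrite <- (tech_pow_Rmult (INR n) I).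
      generalize dependent (INR (fact k)). generalize dependent (INR (fact I)).
      generalize dependent (4 ^ S I). generalize ((PI ^ 2) ^ S I). generalize dependent (INR (S I)).
      intros a _ Ha b c Hc f Hf g Hg.
      set (x := rsum _ k). set (y := rsum _ k). field. repeat split; lra. }
  eapply is_lim_seq_ext; [intros I; symmetry; apply Q|].
  assert (L : forall x, is_lim_seq (fun I => E x (2 * S I)%nat) (exp x)).
  { intros x. apply (is_lim_seq_subseq (E x) (exp x) (fun I => 2 * S I)%nat); [|apply exp_taylor_lim].
    apply eventually_subseq. intros; lia. }
  replace (main_term n) with (/ (8 * INR n) * ((exp (mu n) + exp (- mu n)) - / mu n * (exp (mu n) - exp (- mu n))))
    by (unfold main_term; ring).
  apply is_lim_seq_mult'; [apply is_lim_seq_const|]. apply is_lim_seq_minus'.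
  - apply is_lim_seq_plus'; apply L.
  - apply is_lim_seq_mult'; [apply is_lim_seq_const|]. apply is_lim_seq_minus'; apply L.
Qed.

(** The bound of [approx_bound] depends on [I] only through [tail], which vanishes as [I] goes to
    infinity with [t] and [n] fixed. *)
Lemma pbar_main_term t n : (0 < n)%nat -> 0 < t <= / 20 ->
  Rabs (INR (pbar n) - main_term n)
  <= (611 + 2 * exp (PI ^ 2 / (4 * t) - 2 / t + 4.6)) * exp (INR n * t).
Proof.
  intros Hn Ht.
  assert (H : Rbar_le (Rabs (INR (pbar n) - main_term n)) ((611 + 2 * exp (PI ^ 2 / (4 * t) - 2 / t + 4.6)) * exp (INR n * t)));
    [|exact H].
  apply is_lim_seq_le with (u := fun I => Rabs (INR (pbar n) - approx I n))
    (v := fun I => (611 + 2 * exp (PI ^ 2 / (4 * t) - 2 / t + 4.6) + tail I (PI ^ 2 / (4 * t))) * exp (INR n * t)).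
  - intros I. apply approx_bound. assumption.
  - apply (is_lim_seq_abs _ (INR (pbar n) - main_term n)).
    apply is_lim_seq_minus'; [apply is_lim_seq_const|apply approx_lim; assumption].
  - set (K := 611 + 2 * exp (PI ^ 2 / (4 * t) - 2 / t + 4.6)).
    replace (Finite (K * exp (INR n * t))) with (Finite ((K + exp (PI ^ 2 / (4 * t)) * 0) * exp (INR n * t))) by (f_equal; ring).
    apply is_lim_seq_mult'; [|apply is_lim_seq_const].
    apply is_lim_seq_plus'; [apply is_lim_seq_const|].
    apply is_lim_seq_ext with (fun I => exp (PI ^ 2 / (4 * t)) * ((PI ^ 2 / (4 * t)) ^ S I / INR (fact (S I)))).
    { intros I. unfold tail, Rdiv. ring. }
    apply is_lim_seq_mult'; [apply is_lim_seq_const|].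
    apply (is_lim_seq_incr_1 (fun I => (PI ^ 2 / (4 * t)) ^ I / INR (fact I))).
    apply is_lim_seq_Reals, cv_speed_pow_fact.
Qed.

(** * The recurrence from theta * F = 1 *)

(** Coefficient of q^m in the theta series 1 + 2 sum (-1)^k q^(k^2), as an integer fit for
    computation. *)
Definition bcoef (m : nat) : Z :=
  let k := Nat.sqrt m in
  if Nat.eqb (k * k) m then
    if Nat.eqb k 0 then 1%Z else if Nat.even k then 2%Z else (-2)%Z
  else 0%Z.

Lemma bcoef_sqr k : bcoef (S k * S k) = if Nat.even (S k) then 2%Z else (-2)%Z.
Proof. unfold bcoef. rewrite Nat.sqrt_square, Nat.eqb_refl. reflexivity. Qed.

Lemma bcoef_gap n j : (j < 2 * n)%nat -> bcoef (S (n * n) + j) = 0%Z.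
Proof.
  intros H. unfold bcoef. rewrite (Nat.sqrt_unique (S (n * n) + j) n) by lia.
  destruct (Nat.eqb_spec (n * n) (S (n * n) + j)); [lia|reflexivity].
Qed.

Lemma pow_m1_even k : (-1) ^ k = if Nat.even k then 1 else -1.
Proof.
  induction k; [reflexivity|]. rewrite Nat.even_succ, <- Nat.negb_even. simpl pow. rewrite IHk.
  destruct (Nat.even k); simpl; ring.
Qed.

Lemma theta_bcoef q n : csum (fun m => IZR (bcoef m) * q ^ m)%C (S (n * n)) = theta q n.
Proof.
  induction n.
  - unfold theta. cbn [csum Nat.mul]. change (bcoef 0) with 1%Z. change (q ^ 0)%C with (RtoC 1). ring.
  - assert (G : forall j, (j <= 2 * n)%nat ->
      csum (fun m => IZR (bcoef m) * q ^ m)%C (S (n * n) + j) = theta q n).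
    { induction j; intros Hj; [rewrite Nat.add_0_r; exact IHn|].
      rewrite Nat.add_succ_r. cbn [csum]. rewrite IHj, bcoef_gap by lia. ring. }
    replace (S (S n * S n)) with (S (S (n * n) + 2 * n)) by lia.
    cbn [csum]. rewrite G by lia. replace (S (n * n) + 2 * n)%nat with (S n * S n)%nat by lia.
    rewrite bcoef_sqr. unfold theta. cbn [csum].
    assert (E : RtoC (IZR (if Nat.even (S n) then 2 else -2)) = (2 * (- (1)) ^ S n)%C).
    { replace (- (1))%C with (RtoC (-1)) by (apply C_eq; unfold Re, Im; simpl; ring).
      rewrite <- RtoC_pow, pow_m1_even, <- RtoC_mult. destruct (Nat.even (S n)); f_equal; ring. }
    rewrite E. ring.
Qed.

Lemma is_series_rsum f (l : R) : is_lim_seq (rsum f) l -> is_series f l.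
Proof.
  intros H. apply (is_lim_seq_incr_1 (rsum f)) in H.
  eapply is_lim_seq_ext with (u := fun n => rsum f (S n)) (v := sum_n f) in H; [exact H|].
  intros n. induction n.
  - rewrite sum_O. simpl. ring.
  - rewrite sum_Sn, <- IHn. reflexivity.
Qed.

Lemma rsum_abs_conv f g (c : R) : (forall i, Rabs (f i) <= g i) -> is_lim_seq (rsum g) c ->
  exists l : R, is_lim_seq (rsum f) l.
Proof.
  intros H Hg. destruct (csum_conv (fun i => RtoC (f i)) g c) as [l [[Hl _] _]].
  - intros i. rewrite Cmod_R. apply H.
  - assumption.
  - exists (Re l). eapply is_lim_seq_ext; [|exact Hl]. intros n. cbv beta.
    rewrite Re_csum. apply rsum_ext. reflexivity.
Qed.

Lemma CV_radius_pos_of_ex a x : 0 < x -> ex_pseries a x -> Rbar_lt 0 (CV_radius a).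
Proof.
  intros Hx H. apply Rbar_not_le_lt. intros L.
  apply (CV_disk_outside a x).
  - apply Rbar_le_lt_trans with (1 := L). simpl. rewrite Rabs_pos_eq; lra.
  - destruct H as [l Hl]. apply is_pseries_R in Hl. apply ex_series_lim_0. exists l. exact Hl.
Qed.

Lemma CV_radius_ge_of_abs a x (c : R) : 0 <= x -> is_lim_seq (rsum (fun n => Rabs (a n) * x ^ n)) c ->
  Rbar_le x (CV_radius a).
Proof.
  intros Hx H. unfold CV_radius. destruct (Lub_Rbar_correct (CV_disk a)) as [U _].
  apply U. exists c. apply is_series_rsum. eapply is_lim_seq_ext; [|exact H].
  intros n. apply rsum_ext. intros i _. rewrite Rabs_mult, <- RPow_abs, (Rabs_pos_eq x); [reflexivity|assumption].
Qed.

Lemma geom_half_conv : exists c : R, is_lim_seq (rsum (fun n => 2 * (/ 2) ^ n)) c.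
Proof.
  apply rsum_bounded_conv with 4.
  - intros; apply Rmult_le_pos; [lra|apply pow_le; lra].
  - intros n. rewrite (rsum_scal 2 (fun i => (/ 2) ^ i)).
    assert (E : rsum (fun i => (/ 2) ^ i) n = 2 - 2 * (/ 2) ^ n).
    { induction n; [simpl; ring|]. cbn [rsum pow]. rewrite IHn. field. }
    rewrite E. assert (0 <= (/ 2) ^ n) by (apply pow_le; lra). lra.
Qed.

Lemma Rabs_bcoef m : Rabs (IZR (bcoef m)) <= 2.
Proof.
  unfold bcoef. destruct (Nat.eqb _ m); [|rewrite Rabs_R0; lra].
  destruct (Nat.eqb _ 0); [rewrite Rabs_R1; lra|].
  destruct (Nat.even _); apply Rabs_le; lra.
Qed.

(** Gauss's identity as an equality of power series on a disc: both factors have radius at least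
    1/2, and the coefficients of the product are determined by its values near 0. *)
Lemma pbar_recurrence n :
  sum_f_R0 (fun k => INR (pbar k) * IZR (bcoef (n - k))) n = if Nat.eqb n 0 then 1 else 0.
Proof.
  set (a := fun k => INR (pbar k)). set (b := fun k => IZR (bcoef k)).
  set (e := fun k => if Nat.eqb k 0 then 1 else 0).
  change (PS_mult a b n = e n).
  assert (Ra : Rbar_le (/ 2) (CV_radius a)).
  { destruct (pbar_gf (RtoC (/ 2))) as [[c Hc] _]; [rewrite Cmod_R, Rabs_pos_eq; lra|].
    apply CV_radius_ge_of_abs with c; [lra|].
    eapply is_lim_seq_ext; [|exact Hc]. intros m. apply rsum_ext. intros i _.
    unfold ssum, a. rewrite Cmod_R, !Rabs_pos_eq; [reflexivity|apply pos_INR|lra]. }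
  assert (Rb : Rbar_le (/ 2) (CV_radius b)).
  { destruct geom_half_conv as [c Hc].
    destruct (rsum_abs_conv (fun m => Rabs (b m) * (/ 2) ^ m) (fun n => 2 * (/ 2) ^ n) c) with (2 := Hc) as [l Hl].
    - intros i. assert (0 <= (/ 2) ^ i) by (apply pow_le; lra).
      rewrite Rabs_pos_eq by (apply Rmult_le_pos; [apply Rabs_pos|assumption]).
      apply Rmult_le_compat_r; [assumption|apply Rabs_bcoef].
    - apply CV_radius_ge_of_abs with l; [lra|exact Hl]. }
  assert (Re1 : forall x, is_pseries e x 1).
  { intros x. apply is_pseries_R, is_series_rsum. apply (is_lim_seq_incr_1 (rsum (fun n => e n * x ^ n))).
    apply is_lim_seq_ext with (fun _ => 1); [|apply is_lim_seq_const].
    intros m. rewrite rsum_shift, rsum_0; [unfold e; simpl; ring|]. intros; unfold e; simpl; ring. }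
  assert (In : forall x, Rabs x <= / 4 -> Rbar_lt (Rabs x) (CV_radius a) /\ Rbar_lt (Rabs x) (CV_radius b)).
  { intros x Hx. split; (apply Rbar_lt_le_trans with (/ 2); [simpl; lra|assumption]). }
  apply PSeries_ext_recip.
  - apply CV_radius_pos_of_ex with (/ 4); [lra|].
    destruct (In (/ 4)) as [I1 I2]; [rewrite Rabs_pos_eq; lra|].
    apply ex_pseries_mult; assumption.
  - apply CV_radius_pos_of_ex with 1; [lra|]. exists 1. apply Re1.
  - exists (mkposreal (/ 4) ltac:(lra)). intros x Hx.
    assert (Hx' : Rabs x <= / 4).
    { change (Rabs (x - 0) < / 4) in Hx. rewrite Rminus_0_r in Hx. lra. }
    destruct (In x Hx') as [I1 I2].
    rewrite PSeries_mult by assumption. rewrite (is_pseries_unique _ _ _ (Re1 x)).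
    assert (Hq : Cmod (RtoC x) < 1) by (rewrite Cmod_R; lra).
    destruct (pbar_gf (RtoC x) Hq) as [_ [F [HF HFK]]].
    pose proof (theta_FK_lim (RtoC x) Hq) as HT.
    assert (Ea : is_pseries a x (Re F)).
    { apply is_pseries_R, is_series_rsum. destruct HF as [HF _].
      eapply is_lim_seq_ext; [|exact HF]. intros m. cbv beta. rewrite Re_csum. apply rsum_ext.
      intros i _. rewrite gterm_RtoC, re_RtoC. reflexivity. }
    rewrite (is_pseries_unique _ _ _ Ea).
    destruct (CV_radius_inside b x I2) as [lb Hlb].
    assert (Eb : is_pseries b x lb) by exact Hlb.
    rewrite (is_pseries_unique _ _ _ Eb).
    assert (Lb : Clim (theta (RtoC x)) (RtoC lb)).
    { apply is_pseries_R in Eb.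
      assert (L : is_lim_seq (rsum (fun m => b m * x ^ m)) lb).
      { apply (is_lim_seq_incr_1 (rsum (fun m => b m * x ^ m))).
        eapply is_lim_seq_ext; [|exact Eb]. intros m. induction m.
        - rewrite sum_O. simpl. ring.
        - rewrite sum_Sn, IHm. reflexivity. }
      apply Clim_ext with (fun m => RtoC (rsum (fun m => b m * x ^ m) (S (m * m)))).
      - intros m. rewrite RtoC_rsum, <- theta_bcoef. apply csum_ext. intros i _.
        rewrite RtoC_mult, RtoC_pow. reflexivity.
      - apply Clim_RtoC.
        apply (is_lim_seq_subseq (rsum (fun m => b m * x ^ m)) lb (fun m => S (m * m))); [|exact L].
        apply eventually_subseq. intros; lia. }
    assert (E : (RtoC lb * F)%C = RtoC 1).
    { apply Clim_unique with (fun m => theta (RtoC x) m * FK m (RtoC x))%C; [|assumption].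
      apply Clim_mult; assumption. }
    apply (f_equal Re) in E. rewrite re_scal_l, re_RtoC in E. lra.
Qed.

Fixpoint dot (u v : list Z) : Z :=
  match u, v with
  | x :: u', y :: v' => (x * y + dot u' v')%Z
  | _, _ => 0%Z
  end.

(* [pbar_table n] lists the values from [pbar (n-1)] down to [pbar 0]. *)
Fixpoint pbar_table (bl : list Z) (n : nat) : list Z :=
  match n with
  | O => nil
  | S O => (1 :: nil)%Z
  | S m => let l := pbar_table bl m in (- dot bl l)%Z :: l
  end.

Lemma dot_map (f g : nat -> Z) n l k :
  (n <= k)%nat ->
  dot (map f (seq l k)) (map g (rev (seq 0 n)))
  = fold_right Z.add 0%Z (map (fun j => f (l + j)%nat * g (n - 1 - j)%nat)%Z (seq 0 n)).
Proof.
  revert l k. induction n; intros l k H.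
  - destruct k; reflexivity.
  - destruct k; [lia|]. replace (rev (seq 0 (S n))) with (n :: rev (seq 0 n)) by (rewrite seq_S, rev_app_distr; reflexivity). cbn [rev app seq map dot].
    rewrite (IHn (S l) k) by lia. cbn [fold_right].
    replace (l + 0)%nat with l by lia. replace (S n - 1 - 0)%nat with n by lia. f_equal.
    rewrite <- seq_shift, map_map. f_equal. apply map_ext_in. intros j Hj. apply in_seq in Hj.
    f_equal; f_equal; lia.
Qed.

Lemma sum_f_R0_Z (f : nat -> Z) n :
  sum_f_R0 (fun j => IZR (f j)) n = IZR (fold_right Z.add 0%Z (map f (seq 0 (S n)))).
Proof.
  assert (G : forall n l, fold_right Z.add 0%Z (map f (seq l (S n)))
     = (fold_right Z.add 0%Z (map f (seq l n)) + f (l + n)%nat)%Z).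
  { clear. induction n; intros l; [simpl; rewrite Nat.add_0_r; lia|].
    change (seq l (S (S n))) with (l :: seq (S l) (S n)). change (seq l (S n)) with (l :: seq (S l) n).
    cbn [map fold_right]. rewrite IHn. replace (S l + n)%nat with (l + S n)%nat by lia. lia. }
  induction n; [simpl; f_equal; lia|].
  rewrite G, plus_IZR, <- IHn. reflexivity.
Qed.

(** The constant theta coefficient is 1, so the recurrence gives the newest value as minus a [dot]
    product with the coefficients from index 1 on. As [dot] stops at the shorter list, one list
    serves every n <= N + 1. *)
Lemma pbar_table_spec N n : (n <= S N)%nat ->
  pbar_table (map bcoef (seq 1 N)) n = map (fun k => Z.of_nat (pbar k)) (rev (seq 0 n)).
Proof.
  induction n; intros H; [reflexivity|].
  destruct n; [reflexivity|].
  change (pbar_table (map bcoef (seq 1 N)) (S (S n)))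
    with (- dot (map bcoef (seq 1 N)) (pbar_table (map bcoef (seq 1 N)) (S n)) :: pbar_table (map bcoef (seq 1 N)) (S n))%Z.
  rewrite IHn by lia.
  rewrite (seq_S (S n)), rev_app_distr. cbn [rev app map Nat.add]. f_equal.
  rewrite dot_map by lia. apply eq_IZR. rewrite opp_IZR, <- INR_IZR_INZ.
  pose proof (pbar_recurrence (S n)) as E. simpl Nat.eqb in E. cbv iota in E.
  rewrite tech5, Nat.sub_diag in E. change (IZR (bcoef 0)) with 1 in E.
  rewrite <- (sum_f_R0_Z (fun j => bcoef (1 + j)%nat * Z.of_nat (pbar (S n - 1 - j)%nat))%Z n).
  assert (E2 : sum_f_R0 (fun k => INR (pbar k) * IZR (bcoef (S n - k))) n
     = sum_f_R0 (fun j => IZR (bcoef (1 + j)%nat * Z.of_nat (pbar (S n - 1 - j)%nat))%Z) n).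
  { rewrite !rsum_sum_f_R0, <- rsum_rev.
    apply rsum_ext. intros i Hi. rewrite mult_IZR, <- INR_IZR_INZ, Rmult_comm.
    replace (S n - (S n - 1 - i))%nat with (1 + i)%nat by lia. reflexivity. }
  rewrite <- E2. lra.
Qed.

(** * Verified fixed-point arithmetic for small indices *)

(* A real number [x] is bounded by integers [a <= SC * x <= b]. *)
Definition SC : Z := (2 ^ 44)%Z.

Record mdata : Type := MData { mlo : Z; mhi : Z; lhi : Z; ulo : Z }.

(* Bounds for [x = mu m]: [mlo], [mhi] for [x], then an upper bound for [1 - 1/x - 1/x^5]
   and a lower bound for [1 - 1/x + 1/x^5]. *)
Definition mdata_of (m : nat) : mdata :=
  (let r := Z.sqrt (Z.of_nat m * (SC * SC)) in
   let a := 31415926535897932 * r / 10 ^ 16 in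
   let b := 31415926535897933 * (r + 1) / 10 ^ 16 + 1 in
   let i := SC * SC / b in
   let i2 := i * i / SC in
   let i5 := (i2 * i2 / SC) * i / SC in
   MData a b (SC - i - i5) (SC - (SC * SC / a + 1) + i5))%Z.

(** The three counts are cut by a common 2^k that leaves at most 45 bits of [p], with q <= p / 2^k <
    q + 1. [wl] and [wh] enclose SC (x - 2 y + z), while [el] and [eh] enclose SC e^(x - 2 y + z) by
    Taylor polynomials of order 2 with cubic remainder. The last two tests are the inequalities
    cleared of denominators; each side carries SC^3. *)
Definition check (n pp p pm : Z) (dz dy dx : mdata) : bool :=
  (let k := Z.max 0 (Z.log2 p - 44) in
   let qp := Z.shiftr pp k in let q := Z.shiftr p k in let qm := Z.shiftr pm k in
   let wh := mhi dx - 2 * mlo dy + mhi dz in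
   let wl := mlo dx - 2 * mhi dy + mlo dz in
   let eh := SC + wh + (wh * wh / (2 * SC) + 1) + ((- wh) ^ 3 / (6 * (SC * SC)) + 1) in
   let el := SC + wl + wl * wl / (2 * SC) - ((- wl) ^ 3 / (6 * (SC * SC)) + 1) in
   let n2 := n * n in
   Z.leb wh 0 && Z.ltb 0 (ulo dx) && Z.ltb 0 (ulo dy) && Z.ltb 0 (ulo dz) && Z.ltb 0 el
   && Z.ltb ((eh * n2 * lhi dx * lhi dz) * ((q + 1) * (q + 1)))
         ((SC * (n2 - 1) * ulo dy * ulo dy) * (qm * qp))
   && Z.ltb ((SC * (n2 - 1) * lhi dy * lhi dy) * ((qm + 1) * (qp + 1)))
         ((el * n2 * ulo dx * ulo dz) * (q * q)))%Z%bool.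

Fixpoint check_table (l : list Z) (dl : list mdata) (n : nat) : bool :=
  match l, dl, n with
  | pp :: ((p :: pm :: _) as l'), dz :: ((dy :: dx :: _) as dl'), S n' =>
      (check (Z.of_nat n) pp p pm dz dy dx && check_table l' dl' n')%bool
  | _, _, _ => true
  end.

(** Both lists run downwards from index 1001, and the default [true] ends the run when one is
    exhausted. The [mdata] list stops at 54, so the tests cover n = 1000 down to n = 55. *)
Lemma table_checked :
  check_table (pbar_table (map bcoef (seq 1 1001)) 1002) (map mdata_of (rev (seq 54 948))) 1000 = true.
Proof. vm_compute. reflexivity. Qed.

(** * The two bounds in factored form *)

Lemma lt_div_intro a b c : 0 < c -> a * c < b -> a < b / c.
Proof. intros H. apply Rlt_div_r. exact H. Qed.

Lemma div_lt_intro a b c : 0 < c -> a < b * c -> a / c < b.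
Proof. intros H. apply Rlt_div_l. exact H. Qed.

Definition Lfac (x : R) : R := 1 - / x - / x ^ 5.
Definition Ufac (x : R) : R := 1 - / x + / x ^ 5.

Definition wexp (n : nat) : R := mu (n - 1) - 2 * mu n + mu (n + 1).
Definition nfac (n : nat) : R := INR n ^ 2 / (INR n ^ 2 - 1).

Lemma Ufac_pos x : 1 < x -> 0 < Ufac x.
Proof.
  intros H. unfold Ufac. assert (0 < / x ^ 5) by (apply Rinv_0_lt_compat, pow_lt; lra).
  assert (/ x < 1) by (rewrite <- Rinv_1; apply Rinv_lt_contravar; lra). lra.
Qed.

Lemma Lfac_pos x : 2 < x -> 0 < Lfac x.
Proof.
  intros H. unfold Lfac.
  assert (/ x < / 2) by (apply Rinv_lt_contravar; lra).
  assert (0 < / x) by (apply Rinv_0_lt_compat; lra).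
  assert (/ x ^ 5 < / 2).
  { rewrite <- pow_inv. replace (/ 2) with (/ 2 * 1) by ring. simpl pow.
    apply Rmult_le_0_lt_compat; [lra| |assumption|].
    - repeat apply Rmult_le_pos; lra.
    - rewrite <- (Rmult_1_r 1) at 1. replace 1 with (1 * (1 * (1 * (1 * 1)))) by ring.
      apply Rmult_le_0_lt_compat; try lra; repeat (apply Rmult_le_pos; try lra).
      apply Rmult_le_0_lt_compat; try lra; repeat (apply Rmult_le_pos; try lra).
      apply Rmult_le_0_lt_compat; try lra; repeat (apply Rmult_le_pos; try lra). }
  lra.
Qed.

Lemma mu_gt_3 n : (0 < n)%nat -> 3 < mu n.
Proof.
  intros H. unfold mu. pose proof PI_coarse.
  assert (1 <= sqrt (INR n)) by (rewrite <- sqrt_1; apply sqrt_le_1_alt, (le_INR 1); lia). nra.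
Qed.

(** After the fifth powers cancel there remains y^4 / (x^2 z^2), and since x^2, y^2, z^2 are
    proportional to n - 1, n, n + 1 this is n^2 / (n^2 - 1). *)
Lemma frac_normal a b c x y z (n : R) : 0 < x -> 0 < y -> 0 < z -> 1 < n ->
  x ^ 2 = PI ^ 2 * (n - 1) -> y ^ 2 = PI ^ 2 * n -> z ^ 2 = PI ^ 2 * (n + 1) -> b <> 0 ->
  y ^ 14 * (x ^ 5 * a) * (z ^ 5 * c) / (x ^ 7 * z ^ 7 * (y ^ 5 * b) ^ 2) = n ^ 2 / (n ^ 2 - 1) * a * c / b ^ 2.
Proof.
  intros Hx Hy Hz Hn Ex Ey Ez Hb. pose proof PI_RGT_0.
  transitivity ((y ^ 2) ^ 2 / (x ^ 2 * z ^ 2) * a * c / b ^ 2).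
  - field. repeat split; lra.
  - rewrite Ex, Ey, Ez. field. repeat split; nra.
Qed.

Lemma mu_sqr_shift n : (2 <= n)%nat ->
  mu (n - 1) ^ 2 = PI ^ 2 * (INR n - 1) /\ mu n ^ 2 = PI ^ 2 * INR n /\ mu (n + 1) ^ 2 = PI ^ 2 * (INR n + 1).
Proof.
  intros H. rewrite !mu_sqr, minus_INR, plus_INR by lia. simpl. repeat split; ring.
Qed.

Lemma quint_L x : 0 < x -> x ^ 5 - x ^ 4 - 1 = x ^ 5 * Lfac x.
Proof. intros. unfold Lfac. field. lra. Qed.

Lemma quint_U x : 0 < x -> x ^ 5 - x ^ 4 + 1 = x ^ 5 * Ufac x.
Proof. intros. unfold Ufac. field. lra. Qed.

Lemma f_low_eq n : (2 <= n)%nat ->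
  f_low n = exp (wexp n) * (nfac n * Lfac (mu (n - 1)) * Lfac (mu (n + 1)) / Ufac (mu n) ^ 2).
Proof.
  intros Hn. unfold f_low. cbv zeta. fold (wexp n). f_equal.
  pose proof (mu_gt_3 (n - 1) ltac:(lia)). pose proof (mu_gt_3 n ltac:(lia)). pose proof (mu_gt_3 (n + 1) ltac:(lia)).
  destruct (mu_sqr_shift n Hn) as [E1 [E2 E3]].
  rewrite !quint_L, quint_U by lra. unfold nfac. apply frac_normal; try lra; try assumption.
  - apply (lt_INR 1). lia.
  - apply Rgt_not_eq, Ufac_pos. lra.
Qed.

Lemma g_up_eq n : (2 <= n)%nat ->
  g_up n = exp (wexp n) * (nfac n * Ufac (mu (n - 1)) * Ufac (mu (n + 1)) / Lfac (mu n) ^ 2).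
Proof.
  intros Hn. unfold g_up. cbv zeta. fold (wexp n). f_equal.
  pose proof (mu_gt_3 (n - 1) ltac:(lia)). pose proof (mu_gt_3 n ltac:(lia)). pose proof (mu_gt_3 (n + 1) ltac:(lia)).
  destruct (mu_sqr_shift n Hn) as [E1 [E2 E3]].
  rewrite !quint_U, quint_L by lra. unfold nfac. apply frac_normal; try lra; try assumption.
  - apply (lt_INR 1). lia.
  - apply Rgt_not_eq, Lfac_pos. lra.
Qed.

Lemma IZR_div_le a b : (0 < b)%Z -> IZR (a / b) <= IZR a / IZR b.
Proof.
  intros H. apply IZR_lt in H as H'. apply Rle_div_r; [assumption|].
  rewrite <- mult_IZR. apply IZR_le. rewrite Z.mul_comm. apply Z.mul_div_le. assumption.
Qed.

Lemma IZR_div_ge a b : (0 < b)%Z -> IZR a / IZR b <= IZR (a / b + 1).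
Proof.
  intros H. apply IZR_lt in H as H'. apply Rle_div_l; [assumption|].
  rewrite <- mult_IZR. apply IZR_le. rewrite Z.mul_comm. apply Z.lt_le_incl.
  exact (Z.mul_succ_div_gt a b H).
Qed.

Lemma mdata_spec m : (0 < m)%nat ->
  IZR (mlo (mdata_of m)) <= IZR SC * mu m <= IZR (mhi (mdata_of m)) /\
  IZR SC * Lfac (mu m) <= IZR (lhi (mdata_of m)) /\
  IZR (ulo (mdata_of m)) <= IZR SC * Ufac (mu m).
Proof.
  intros Hm.
  assert (S0 : (0 < SC)%Z) by reflexivity.
  set (s := IZR SC). assert (s0 : 0 < s) by (apply IZR_lt in S0; exact S0).
  set (x := mu m). pose proof (mu_gt_3 m Hm) as X3. fold x in X3.
  unfold mdata_of. cbv zeta.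
  set (r := Z.sqrt (Z.of_nat m * (SC * SC))).
  set (a := (31415926535897932 * r / 10 ^ 16)%Z).
  set (b := (31415926535897933 * (r + 1) / 10 ^ 16 + 1)%Z).
  set (i := (SC * SC / b)%Z). set (i2 := (i * i / SC)%Z). set (i5 := ((i2 * i2 / SC) * i / SC)%Z).
  cbn [mlo mhi lhi ulo].
  assert (m0 : (0 <= Z.of_nat m * (SC * SC))%Z) by lia.
  pose proof (Z.sqrt_spec _ m0) as [R1 R2]. fold r in R1, R2.
  assert (r0 : (SC <= r)%Z).
  { apply Z.sqrt_le_square; [assumption|lia|]. nia. }
  assert (sq : 0 <= sqrt (INR m)) by apply sqrt_pos.
  assert (sq2 : sqrt (INR m) * sqrt (INR m) = INR m) by (apply sqrt_sqrt, pos_INR).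
  (* [r] is the integer part of SC sqrt m, so that number lies between [r] and [r + 1]. *)
  assert (Q1 : IZR r <= s * sqrt (INR m)).
  { apply IZR_le in R1. rewrite !mult_IZR, <- INR_IZR_INZ in R1. fold s in R1.
    assert (0 <= IZR r) by (apply IZR_le; lia).
    apply Rsqr_incr_0_var; [|apply Rmult_le_pos; lra]. unfold Rsqr.
    replace (s * sqrt (INR m) * (s * sqrt (INR m))) with (INR m * (s * s)) by (symmetry; transitivity ((sqrt (INR m) * sqrt (INR m)) * (s * s)); [ring|now rewrite sq2]). lra. }
  assert (Q2 : s * sqrt (INR m) <= IZR (r + 1)).
  { apply Z.lt_le_incl, IZR_le in R2. rewrite !mult_IZR, <- INR_IZR_INZ in R2. fold s in R2.
    unfold Z.succ in R2.
    assert (0 <= IZR (r + 1)) by (apply IZR_le; lia).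
    apply Rsqr_incr_0_var; [|assumption]. unfold Rsqr.
    replace (s * sqrt (INR m) * (s * sqrt (INR m))) with (INR m * (s * s)) by (symmetry; transitivity ((sqrt (INR m) * sqrt (INR m)) * (s * s)); [ring|now rewrite sq2]). lra. }
  pose proof PI_bounds as [P1 P2].
  assert (Ex : s * x = PI * (s * sqrt (INR m))) by (unfold x, mu; ring).
  assert (Ha : IZR a <= s * x).
  { apply Rle_trans with (1 := IZR_div_le (31415926535897932 * r) (10 ^ 16) eq_refl). rewrite mult_IZR, Ex.
    apply Rle_trans with (PI * IZR r); [|apply Rmult_le_compat_l; [lra|assumption]].
    assert (0 <= IZR r) by (apply IZR_le; lia).
    replace (31415926535897932 * IZR r / IZR (10 ^ 16)) with (31415926535897932 / IZR (10 ^ 16) * IZR r) by (unfold Rdiv; ring).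
    apply Rmult_le_compat_r; [assumption|]. simpl in *. lra. }
  assert (Hb : s * x <= IZR b).
  { apply Rle_trans with (2 := IZR_div_ge (31415926535897933 * (r + 1)) (10 ^ 16) eq_refl). rewrite mult_IZR, Ex.
    assert (0 <= IZR (r + 1)) by (apply IZR_le; lia).
    apply Rle_trans with (PI * IZR (r + 1)); [apply Rmult_le_compat_l; [lra|assumption]|].
    replace (31415926535897933 * IZR (r + 1) / IZR (10 ^ 16)) with (31415926535897933 / IZR (10 ^ 16) * IZR (r + 1)) by (unfold Rdiv; ring).
    apply Rmult_le_compat_r; [assumption|]. simpl in *. lra. }
  assert (a0 : (0 < a)%Z).
  { unfold a. apply Z.div_str_pos. split; [reflexivity|]. assert (2 ^ 44 <= r)%Z by exact r0. lia. }
  assert (b0 : (0 < b)%Z) by (apply lt_IZR; nra).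
  apply IZR_lt in a0 as a0'. apply IZR_lt in b0 as b0'.
  assert (Hi : IZR i <= s * / x).
  { apply Rle_trans with (1 := IZR_div_le _ _ b0). rewrite mult_IZR. fold s.
    apply Rle_div_l; [assumption|]. replace (s * / x * IZR b) with (s * (IZR b * / x)) by ring.
    apply Rmult_le_compat_l; [lra|]. apply (Rle_div_r s); lra. }
  assert (i0 : 0 <= IZR i) by (apply IZR_le, Z.div_pos; lia).
  assert (Hih : s * / x <= IZR (SC * SC / a + 1)).
  { apply Rle_trans with (2 := IZR_div_ge _ _ a0). rewrite mult_IZR. fold s.
    apply Rmult_le_reg_r with (IZR a); [exact a0'|].
    replace (s * s / IZR a * IZR a) with (s * s) by (field; lra). replace (s * / x * IZR a) with (s * (IZR a * / x)) by ring.
    apply Rmult_le_compat_l; [lra|]. apply (Rle_div_l (IZR a)); lra. }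
  assert (x0 : 0 < / x) by (apply Rinv_0_lt_compat; lra).
  (* Products rounded down remain lower bounds, so [i5] stays below SC / x^5. This is the safe
     direction in both fields: it is subtracted in the upper bound and added in the lower one. *)
  assert (step : forall u v (p q : R), 0 <= IZR u <= s * p -> 0 <= IZR v <= s * q ->
     0 <= IZR (u * v / SC) <= s * (p * q)).
  { intros u v p q [U0 U] [V0 V]. split.
    - apply IZR_le, Z.div_pos; [|assumption]. apply le_IZR in U0. apply le_IZR in V0. lia.
    - apply Rle_trans with (1 := IZR_div_le _ _ S0). fold s. rewrite mult_IZR.
      apply Rle_div_l; [assumption|]. replace (s * (p * q) * s) with ((s * p) * (s * q)) by ring.
      apply Rmult_le_compat; assumption. }
  assert (H2 := step i i _ _ (conj i0 Hi) (conj i0 Hi)). fold i2 in H2.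
  assert (H4 := step i2 i2 _ _ H2 H2).
  assert (H5 := step _ i _ _ H4 (conj i0 Hi)). fold i5 in H5.
  replace (/ x * / x * (/ x * / x) * / x) with (/ x ^ 5) in H5 by (field; lra).
  rewrite !minus_IZR, plus_IZR, minus_IZR. fold s. unfold Lfac, Ufac.
  split; [split; assumption|]. split; lra.
Qed.

Lemma exp_taylor2 w : w <= 0 -> 1 + w + w ^ 2 / 2 - (- w) ^ 3 / 6 <= exp w <= 1 + w + w ^ 2 / 2 + (- w) ^ 3 / 6.
Proof.
  intros Hw. pose proof (cexp_ctaylor_le (RtoC w) 3) as H.
  rewrite cexp_RtoC, re_RtoC, Rmax_left, exp_0, Cmod_R, Rabs_left1 in H by lra.
  replace (ctaylor (RtoC w) 3) with (RtoC (1 + w + w ^ 2 / 2)) in H.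
  - rewrite <- RtoC_minus, Cmod_R in H. simpl (INR (fact 3)) in H.
    apply Rabs_le_between in H. split; lra.
  - unfold ctaylor. cbn [csum]. rewrite <- !RtoC_pow, <- !RtoC_div by apply INR_fact_neq_0.
    rewrite <- !RtoC_plus. f_equal. simpl. field.
Qed.

Lemma shiftr_bounds (p k : Z) : (0 <= k)%Z ->
  IZR (Z.shiftr p k) * IZR (2 ^ k) <= IZR p < IZR (Z.shiftr p k + 1) * IZR (2 ^ k).
Proof.
  intros Hk. rewrite Z.shiftr_div_pow2 by assumption.
  assert (P : (0 < 2 ^ k)%Z) by (apply Z.pow_pos_nonneg; lia).
  rewrite <- !mult_IZR. split; [apply IZR_le|apply IZR_lt].
  - rewrite Z.mul_comm. apply Z.mul_div_le. assumption.
  - rewrite Z.mul_comm. exact (Z.mul_succ_div_gt p _ P).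
Qed.

Lemma check_sound n : (2 <= n)%nat -> (0 < pbar n)%nat ->
  check (Z.of_nat n) (Z.of_nat (pbar (n + 1))) (Z.of_nat (pbar n)) (Z.of_nat (pbar (n - 1)))
    (mdata_of (n + 1)) (mdata_of n) (mdata_of (n - 1)) = true ->
  f_low n < u_seq n < g_up n.
Proof.
  intros Hn Hp HC. unfold check in HC. cbv zeta in HC.
  set (k := Z.max 0 (Z.log2 (Z.of_nat (pbar n)) - 44)) in *.
  set (qp := Z.shiftr (Z.of_nat (pbar (n + 1))) k) in *.
  set (q := Z.shiftr (Z.of_nat (pbar n)) k) in *.
  set (qm := Z.shiftr (Z.of_nat (pbar (n - 1))) k) in *.
  pose proof (mdata_spec (n + 1) ltac:(lia)) as [[Az Bz] [Lz Uz]].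
  pose proof (mdata_spec n ltac:(lia)) as [[Ay By] [Ly Uy]].
  pose proof (mdata_spec (n - 1) ltac:(lia)) as [[Ax Bx] [Lx Ux]].
  destruct (mdata_of (n + 1)) as [az bz lz uz]. destruct (mdata_of n) as [ay by_ ly uy].
  destruct (mdata_of (n - 1)) as [ax bx lx ux]. cbn [mlo mhi lhi ulo] in *.
  set (wh := (bx - 2 * ay + bz)%Z) in *. set (wl := (ax - 2 * by_ + az)%Z) in *.
  set (eh := (SC + wh + (wh * wh / (2 * SC) + 1) + ((- wh) ^ 3 / (6 * (SC * SC)) + 1))%Z) in *.
  set (el := (SC + wl + wl * wl / (2 * SC) - ((- wl) ^ 3 / (6 * (SC * SC)) + 1))%Z) in *.
  set (N := Z.of_nat n) in *.
  apply andb_prop in HC. destruct HC as [HC C7]. apply andb_prop in HC. destruct HC as [HC C6].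
  apply andb_prop in HC. destruct HC as [HC C5]. apply andb_prop in HC. destruct HC as [HC C4].
  apply andb_prop in HC. destruct HC as [HC C3]. apply andb_prop in HC. destruct HC as [C1 C2].
  apply Z.leb_le, IZR_le in C1. apply Z.ltb_lt, IZR_lt in C2, C3, C4, C5, C6, C7.
  rewrite !mult_IZR in C6, C7. rewrite minus_IZR, mult_IZR in C6, C7.
  assert (S0 : (0 < SC)%Z) by reflexivity.
  set (s := IZR SC) in *. assert (s0 : 0 < s) by (apply IZR_lt in S0; exact S0).
  assert (EN : IZR N = INR n) by (unfold N; symmetry; apply INR_IZR_INZ).
  rewrite EN in C6, C7.
  assert (n2 : 2 <= INR n) by (apply (le_INR 2); lia).
  pose proof (mu_gt_3 (n - 1) ltac:(lia)) as x3. pose proof (mu_gt_3 n ltac:(lia)) as y3.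
  pose proof (mu_gt_3 (n + 1) ltac:(lia)) as z3.
  set (x := mu (n - 1)) in *. set (y := mu n) in *. set (z := mu (n + 1)) in *.
  assert (W : IZR wl <= s * wexp n <= IZR wh).
  { unfold wexp, wl, wh. fold x y z. rewrite !plus_IZR, !minus_IZR, !mult_IZR. lra. }
  assert (Wl0 : IZR wl <= 0) by lra.
  assert (EH : s * exp (wexp n) <= IZR eh).
  { set (v := IZR wh / s).
    assert (sv : s * v = IZR wh) by (unfold v; field; lra).
    assert (v0 : v <= 0) by nra.
    assert (wv : wexp n <= v) by (apply Rmult_le_reg_l with s; lra).
    destruct (exp_taylor2 v v0) as [_ T]. pose proof (exp_le _ _ wv).
    assert (D1 := IZR_div_ge (wh * wh) (2 * SC) ltac:(reflexivity)).
    assert (D2 := IZR_div_ge ((- wh) ^ 3) (6 * (SC * SC)) ltac:(reflexivity)).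
    unfold eh. rewrite !(plus_IZR _ (_ + 1)), plus_IZR. fold s.
    rewrite !mult_IZR in D1, D2. change ((- wh) ^ 3)%Z with ((- wh) * ((- wh) * ((- wh) * 1)))%Z in D2 at 1.
    rewrite !mult_IZR, opp_IZR in D2. fold s in D1, D2. rewrite <- sv in D1, D2.
    replace (s * v * (s * v) / (2 * s)) with (s * (v ^ 2 / 2)) in D1 by (field; lra).
    replace (- (s * v) * (- (s * v) * (- (s * v) * 1)) / (6 * (s * s))) with (s * ((- v) ^ 3 / 6)) in D2 by (field; lra).
    assert (s * exp (wexp n) <= s * (1 + v + v ^ 2 / 2 + (- v) ^ 3 / 6)) by (apply Rmult_le_compat_l; lra).
    lra. }
  assert (EL : IZR el <= s * exp (wexp n)).
  { set (v := IZR wl / s).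
    assert (sv : s * v = IZR wl) by (unfold v; field; lra).
    assert (v0 : v <= 0) by nra.
    assert (wv : v <= wexp n) by (apply Rmult_le_reg_l with s; lra).
    destruct (exp_taylor2 v v0) as [T _]. pose proof (exp_le _ _ wv).
    assert (D1 := IZR_div_le (wl * wl) (2 * SC) ltac:(reflexivity)).
    assert (D2 := IZR_div_ge ((- wl) ^ 3) (6 * (SC * SC)) ltac:(reflexivity)).
    unfold el. rewrite minus_IZR, !(plus_IZR (SC + wl)), (plus_IZR SC). fold s.
    rewrite !mult_IZR in D1, D2. change ((- wl) ^ 3)%Z with ((- wl) * ((- wl) * ((- wl) * 1)))%Z in D2 at 1.
    rewrite !mult_IZR, opp_IZR in D2. fold s in D1, D2. rewrite <- sv in D1, D2.
    replace (s * v * (s * v) / (2 * s)) with (s * (v ^ 2 / 2)) in D1 by (field; lra).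
    replace (- (s * v) * (- (s * v) * (- (s * v) * 1)) / (6 * (s * s))) with (s * ((- v) ^ 3 / 6)) in D2 by (field; lra).
    assert (s * (1 + v + v ^ 2 / 2 - (- v) ^ 3 / 6) <= s * exp (wexp n)) by (apply Rmult_le_compat_l; lra).
    lra. }
  assert (k0 : (0 <= k)%Z) by apply Z.le_max_l.
  set (K := IZR (2 ^ k)). assert (K0 : 0 < K) by (apply IZR_lt, Z.pow_pos_nonneg; lia).
  pose proof (shiftr_bounds (Z.of_nat (pbar (n + 1))) k k0) as Pp. fold qp K in Pp.
  pose proof (shiftr_bounds (Z.of_nat (pbar n)) k k0) as P0. fold q K in P0.
  pose proof (shiftr_bounds (Z.of_nat (pbar (n - 1))) k k0) as Pm. fold qm K in Pm.
  rewrite <- INR_IZR_INZ in Pp, P0, Pm.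
  assert (sh0 : forall p, 0 <= IZR (Z.shiftr (Z.of_nat p) k)).
  { intros p. apply IZR_le, Z.shiftr_nonneg. lia. }
  pose proof (sh0 (pbar (n + 1))) as qp0. fold qp in qp0.
  pose proof (sh0 (pbar n)) as q0. fold q in q0.
  pose proof (sh0 (pbar (n - 1))) as qm0. fold qm in qm0.
  assert (p0 : 0 < INR (pbar n)) by (apply lt_0_INR; assumption).
  set (pp := INR (pbar (n + 1))) in *. set (p := INR (pbar n)) in *. set (pm := INR (pbar (n - 1))) in *.
  assert (LX : 0 < Lfac x) by (apply Lfac_pos; lra). assert (LY : 0 < Lfac y) by (apply Lfac_pos; lra).
  assert (LZ : 0 < Lfac z) by (apply Lfac_pos; lra).
  assert (UY : 0 < Ufac y) by (apply Ufac_pos; lra). assert (UX : 0 < Ufac x) by (apply Ufac_pos; lra).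
  assert (UZ : 0 < Ufac z) by (apply Ufac_pos; lra).
  set (e := exp (wexp n)) in *. assert (e0 : 0 < e) by apply exp_pos.
  assert (nn : 0 < INR n * INR n) by nra. assert (nn1 : 0 < INR n * INR n - 1) by nra.
  unfold u_seq. rewrite f_low_eq, g_up_eq by assumption. unfold nfac. fold x y z e pp p pm.
  assert (mle : forall a b c d, 0 <= a -> 0 <= c -> a <= b -> c <= d -> a * c <= b * d)
    by (intros; apply Rmult_le_compat; assumption).
  assert (M0 : forall a b, 0 <= a -> 0 <= b -> 0 <= a * b) by (intros; apply Rmult_le_pos; assumption).
  assert (sLx : 0 <= s * Lfac x) by (apply M0; lra). assert (sLy : 0 <= s * Lfac y) by (apply M0; lra).
  assert (sLz : 0 <= s * Lfac z) by (apply M0; lra). assert (se : 0 <= s * e) by (apply M0; lra).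
  (* The scale between the integer tests and the real inequalities: three fixed-point factors [s]
     and two counts cut by [K] on each side. *)
  assert (cpos : 0 < s * s * s * / (K * K)).
  { apply Rmult_lt_0_compat; [apply Rmult_lt_0_compat; [apply Rmult_lt_0_compat|]
      |apply Rinv_0_lt_compat, Rmult_lt_0_compat]; assumption. }
  split.
  - assert (K1 : e * (INR n * INR n) * Lfac x * Lfac z * (p * p) < pm * pp * (INR n * INR n - 1) * (Ufac y * Ufac y)).
    { apply Rmult_lt_reg_l with (s * s * s * / (K * K)).
      { exact cpos. }
      apply Rle_lt_trans with (IZR eh * (INR n * INR n) * IZR lx * IZR lz * (IZR (q + 1) * IZR (q + 1))).
      - replace (s * s * s * / (K * K) * (e * (INR n * INR n) * Lfac x * Lfac z * (p * p)))
          with ((s * e) * (INR n * INR n) * (s * Lfac x) * (s * Lfac z) * ((p / K) * (p / K))) by (field; lra).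
        assert (pK : 0 <= p / K <= IZR (q + 1)) by (split; [apply Rdiv_le_0_compat; lra|apply Rle_div_l; lra]).
        assert (0 <= s * e * (INR n * INR n)) by (apply M0; lra).
        assert (0 <= s * e * (INR n * INR n) * (s * Lfac x)) by (apply M0; lra).
        apply mle; [apply M0; assumption|apply M0; lra| |apply mle; lra].
        apply mle; try assumption. apply mle; try assumption. apply Rmult_le_compat_r; lra.
      - eapply Rlt_le_trans; [exact C6|].
        replace (s * s * s * / (K * K) * (pm * pp * (INR n * INR n - 1) * (Ufac y * Ufac y)))
          with (s * (INR n * INR n - 1) * (s * Ufac y) * (s * Ufac y) * ((pm / K) * (pp / K))) by (field; lra).
        assert (pmK : IZR qm <= pm / K) by (apply Rle_div_r; lra).
        assert (ppK : IZR qp <= pp / K) by (apply Rle_div_r; lra).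
        assert (0 <= s * (INR n * INR n - 1)) by (apply M0; lra).
        assert (0 <= s * (INR n * INR n - 1) * IZR uy) by (apply M0; lra).
        apply mle; [apply M0; lra|apply M0; lra| |apply mle; lra].
        apply mle; try lra. apply Rmult_le_compat_l; lra. }
    apply lt_div_intro; [apply pow_lt; assumption|].
    replace (e * (INR n ^ 2 / (INR n ^ 2 - 1) * Lfac x * Lfac z / Ufac y ^ 2) * p ^ 2)
      with ((e * (INR n * INR n) * Lfac x * Lfac z * (p * p)) / ((INR n * INR n - 1) * (Ufac y * Ufac y)))
      by (field; repeat split; lra).
    apply div_lt_intro; [apply Rmult_lt_0_compat; [assumption|apply Rmult_lt_0_compat; assumption]|]. lra.
  - assert (K1 : pm * pp * (INR n * INR n - 1) * (Lfac y * Lfac y) < e * (INR n * INR n) * Ufac x * Ufac z * (p * p)).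
    { apply Rmult_lt_reg_l with (s * s * s * / (K * K)).
      { exact cpos. }
      apply Rle_lt_trans with (s * (INR n * INR n - 1) * IZR ly * IZR ly * (IZR (qm + 1) * IZR (qp + 1))).
      - replace (s * s * s * / (K * K) * (pm * pp * (INR n * INR n - 1) * (Lfac y * Lfac y)))
          with (s * (INR n * INR n - 1) * (s * Lfac y) * (s * Lfac y) * ((pm / K) * (pp / K))) by (field; lra).
        assert (pmK : 0 <= pm / K <= IZR (qm + 1)).
        { split; [apply Rdiv_le_0_compat; [apply pos_INR|lra]|apply Rle_div_l; lra]. }
        assert (ppK : 0 <= pp / K <= IZR (qp + 1)).
        { split; [apply Rdiv_le_0_compat; [apply pos_INR|lra]|apply Rle_div_l; lra]. }
        assert (0 <= s * (INR n * INR n - 1)) by (apply M0; lra).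
        assert (0 <= s * (INR n * INR n - 1) * (s * Lfac y)) by (apply M0; lra).
        apply mle; [apply M0; lra|apply M0; lra| |apply mle; lra].
        apply mle; try lra. apply Rmult_le_compat_l; lra.
      - eapply Rlt_le_trans; [exact C7|].
        replace (s * s * s * / (K * K) * (e * (INR n * INR n) * Ufac x * Ufac z * (p * p)))
          with ((s * e) * (INR n * INR n) * (s * Ufac x) * (s * Ufac z) * ((p / K) * (p / K))) by (field; lra).
        assert (pK : IZR q <= p / K) by (apply Rle_div_r; lra).
        assert (0 <= IZR el * (INR n * INR n)) by (apply M0; lra).
        assert (0 <= IZR el * (INR n * INR n) * IZR ux) by (apply M0; lra).
        apply mle; [apply M0; lra|apply M0; lra| |apply mle; lra].
        apply mle; try lra. apply mle; try lra. apply Rmult_le_compat_r; lra. }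
    apply div_lt_intro; [apply pow_lt; assumption|].
    replace (e * (INR n ^ 2 / (INR n ^ 2 - 1) * Ufac x * Ufac z / Lfac y ^ 2) * p ^ 2)
      with ((e * (INR n * INR n) * Ufac x * Ufac z * (p * p)) / ((INR n * INR n - 1) * (Lfac y * Lfac y)))
      by (field; repeat split; lra).
    apply lt_div_intro; [apply Rmult_lt_0_compat; [assumption|apply Rmult_lt_0_compat; assumption]|]. lra.
Qed.

Lemma rev_seq_S a m : rev (seq a (S m)) = (a + m)%nat :: rev (seq a m).
Proof. rewrite seq_S, rev_app_distr. reflexivity. Qed.

(** Windows of three are consumed from the top, hence the induction on [n]. The lowest index listed
    for [D] is 54, so k = 55 has the last complete window. *)
Lemma check_table_sound (F : nat -> Z) (D : nat -> mdata) n :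
  check_table (map F (rev (seq 0 (n + 2)))) (map D (rev (seq 54 (n + 2 - 54)))) n = true ->
  forall k, (55 <= k <= n)%nat ->
  check (Z.of_nat k) (F (k + 1)%nat) (F k) (F (k - 1)%nat) (D (k + 1)%nat) (D k) (D (k - 1)%nat) = true.
Proof.
  induction n as [|n IH]; intros H k Hk; [lia|].
  replace (S n + 2)%nat with (S (S (S n))) in H by lia.
  replace (S (S (S n)) - 54)%nat with (S (S (S (n - 54)))) in H by lia.
  rewrite !rev_seq_S in H. cbn [map check_table] in H.
  apply andb_prop in H. destruct H as [H1 H2].
  destruct (Nat.eq_dec k (S n)) as [->|Hne].
  - replace (S n + 1)%nat with (0 + S (S n))%nat by lia. replace (S n - 1)%nat with (0 + n)%nat by lia.
    replace (54 + S (S (n - 54)))%nat with (0 + S (S n))%nat in H1 by lia.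
    replace (54 + S (n - 54))%nat with (S n) in H1 by lia.
    replace (54 + (n - 54))%nat with (0 + n)%nat in H1 by lia. exact H1.
  - apply IH; [|lia]. replace (n + 2)%nat with (S (S n)) by lia.
    replace (S (S n) - 54)%nat with (S (S (n - 54))) by lia. rewrite !rev_seq_S. exact H2.
Qed.

Lemma pbar_pos n : (0 < pbar n)%nat.
Proof.
  assert (R1 : forall m, (0 < rep 1 (ov 0) m m)%nat).
  { induction m; [simpl; lia|]. rewrite rep_eq by lia. simpl Nat.leb. cbv iota.
    replace (S m - 1)%nat with m by lia. lia. }
  destruct n; [rewrite (pbar_ov 0 0) by lia; simpl; lia|].
  rewrite (pbar_ov (S n) (S n)) by lia.
  assert (M : forall K, (0 < ov (S K) (S n))%nat).
  { induction K; [|rewrite ov_S; lia].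
    rewrite ov_S. simpl Nat.leb. cbv iota. specialize (R1 (S n - 1)%nat). lia. }
  apply M.
Qed.

Lemma bounds_small n : (55 <= n <= 1000)%nat -> f_low n < u_seq n < g_up n.
Proof.
  intros Hn. apply check_sound; [lia|apply pbar_pos|].
  apply (check_table_sound (fun k => Z.of_nat (pbar k)) mdata_of 1000); [|exact Hn].
  pose proof table_checked as T. rewrite pbar_table_spec in T by lia. exact T.
Qed.

(** * Indices above 1000 *)

Lemma exp_1_ge : 2.718 <= exp 1.
Proof.
  apply Rle_trans with (2 := exp_ge_taylor 1 7 ltac:(lra)). simpl. lra.
Qed.

Lemma exp_INR k : exp (INR k) = exp 1 ^ k.
Proof.
  induction k; [simpl; apply exp_0|]. rewrite S_INR, exp_plus, IHk. simpl. ring.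
Qed.

(* The seventh root of the right side is bounded below by the tangent of exp at 5. *)
Lemma pow7_lt_exp x : 99 <= x -> 397 * x ^ 7 < exp (0.4052 * x).
Proof.
  intros Hx.
  replace (0.4052 * x) with (7 * (0.4052 * x / 7)) by field.
  assert (E7 : exp (7 * (0.4052 * x / 7)) = exp (0.4052 * x / 7) ^ 7).
  { set (y := 0.4052 * x / 7). replace (7 * y) with (y + y + y + y + y + y + y) by ring.
    rewrite !exp_plus. ring. }
  rewrite E7.
  assert (E5 : 148 <= exp 5).
  { replace 5 with (INR 5) by (simpl; ring). rewrite exp_INR. pose proof exp_1_ge.
    apply Rle_trans with (2.718 ^ 5); [simpl; lra|]. apply pow_incr. lra. }
  assert (T : 2.352 * x <= exp (0.4052 * x / 7)).
  { replace (0.4052 * x / 7) with (5 + (0.4052 * x / 7 - 5)) by ring. rewrite exp_plus.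
    pose proof (exp_ineq1_le (0.4052 * x / 7 - 5)) as Q.
    apply Rle_trans with (148 * (1 + (0.4052 * x / 7 - 5))); [lra|].
    apply Rmult_le_compat; lra. }
  apply Rlt_le_trans with ((2.352 * x) ^ 7).
  - rewrite Rpow_mult_distr. assert (0 < x ^ 7) by (apply pow_lt; lra).
    apply Rmult_lt_compat_r; [assumption|]. simpl. lra.
  - apply pow_incr. lra.
Qed.

(* [pbar_main_term] is used at the saddle point t = pi^2 / (2 mu n) = pi / (2 sqrt n); there the
   relative error is about exp (- 4 mu / pi^2), and 4 / pi^2 > 0.4052. *)
Lemma pbar_large n : (1000 <= n)%nat ->
  exp (mu n) * Lfac (mu n) / (8 * INR n) < INR (pbar n) < exp (mu n) * Ufac (mu n) / (8 * INR n).
Proof.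
  intros Hn. pose proof PI_coarse as P.
  assert (n0 : 1000 <= INR n) by (apply (le_INR 1000) in Hn; simpl in Hn; lra).
  pose proof (mu_sqr n) as Em. pose proof (mu_pos n ltac:(lia)) as m0. set (m := mu n) in *.
  assert (PP : 9.8695 <= PI ^ 2 <= 9.8697) by nra.
  assert (m99 : 99 <= m).
  { apply Rsqr_incr_0_var; [|lra]. unfold Rsqr. nra. }
  set (t := PI ^ 2 / (2 * m)).
  (* The bound 1/20 amounts to mu >= 98.7, little below the value 99 available for n >= 1000. *)
  assert (Ht : 0 < t <= / 20).
  { unfold t. split; [apply Rdiv_lt_0_compat; lra|apply Rle_div_l; lra]. }
  pose proof (pbar_main_term t n ltac:(lia) Ht) as B.
  assert (pi0 : PI <> 0) by lra.
  replace (PI ^ 2 / (4 * t)) with (m / 2) in B by (unfold t; field; split; lra).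
  replace (2 / t) with (4 * m / PI ^ 2) in B by (unfold t; field; split; lra).
  replace (INR n * t) with (m / 2) in B.
  2:{ unfold t. replace (INR n) with (m ^ 2 / PI ^ 2) by (rewrite Em; field; lra). field. split; lra. }
  set (h := 0.4052 * m).
  pose proof (pow7_lt_exp m m99) as H7. fold h in H7.
  pose proof (exp_pos m) as em0. pose proof (exp_pos (- h)) as eh0.
  assert (ehh : exp h * exp (- h) = 1) by (rewrite <- exp_plus, Rplus_opp_r; apply exp_0).
  (* As mu / 2 - h = 0.0948 mu exceeds 7, the constant 611 < 2.718^7 is absorbed. *)
  assert (A1 : 611 * exp (m / 2) <= exp m * exp (- h)).
  { replace (exp m * exp (- h)) with (exp (m / 2) * exp (m / 2 - h)) by (rewrite <- !exp_plus; f_equal; field).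
    rewrite (Rmult_comm 611). apply Rmult_le_compat_l; [left; apply exp_pos|].
    apply Rle_trans with (exp (INR 7)).
    - rewrite exp_INR. apply Rle_trans with (2.718 ^ 7); [simpl; lra|].
      apply pow_incr. pose proof exp_1_ge. lra.
    - apply exp_le. unfold h. replace (INR 7) with 7 by (simpl; ring). lra. }
  assert (A2 : exp (m / 2 - 4 * m / PI ^ 2 + 4.6) * exp (m / 2) <= 243 * (exp m * exp (- h))).
  { rewrite <- !exp_plus.
    apply Rle_trans with (exp (5 + (m + - h))).
    - apply exp_le. assert (0.4052 * m <= 4 * m / PI ^ 2); [|unfold h; lra].
      apply (Rle_div_r (0.4052 * m)); [lra|]. assert (0 <= m * (9.8697 - PI ^ 2)) by (apply Rmult_le_pos; lra). lra.
    - rewrite (exp_plus 5). apply Rmult_le_compat_r; [left; apply exp_pos|apply exp_5_le]. }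
  (* 487 is 1 from the bounded errors plus 2 times 243 from the region away from q = 1, with e^4.6
     <= e^5 <= 243. *)
  assert (A3 : Rabs (INR (pbar n) - main_term n) <= 487 * (exp m * exp (- h))).
  { apply Rle_trans with (1 := B). rewrite Rmult_plus_distr_r, Rmult_assoc. lra. }
  assert (im : 0 < / m <= 1).
  { split; [apply Rinv_0_lt_compat; lra|]. rewrite <- Rinv_1. apply Rinv_le_contravar; lra. }
  assert (A4 : Rabs (INR (pbar n) * (8 * INR n) - exp m * (1 - / m)) <= 487 * (exp m * exp (- h)) * (8 * INR n) + 2 * (exp m * exp (- h))).
  { replace (INR (pbar n) * (8 * INR n) - exp m * (1 - / m))
      with ((INR (pbar n) - main_term n) * (8 * INR n) + exp (- m) * (1 + / m))
      by (unfold main_term; fold m; field; split; lra).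
    eapply Rle_trans; [apply Rabs_triang|]. rewrite Rabs_mult, (Rabs_pos_eq (8 * INR n)) by lra.
    apply Rplus_le_compat; [apply Rmult_le_compat_r; lra|].
    pose proof (exp_pos (- m)).
    rewrite Rabs_pos_eq by (apply Rmult_le_pos; lra).
    apply Rle_trans with (exp (- m) * 2); [apply Rmult_le_compat_l; lra|].
    rewrite Rmult_comm. apply Rmult_le_compat_l; [lra|]. rewrite <- exp_plus. apply exp_le. unfold h. lra. }
  assert (A5 : 487 * (exp m * exp (- h)) * (8 * INR n) + 2 * (exp m * exp (- h)) < exp m * / m ^ 5).
  (* Here 8 n = 8 mu^2 / pi^2, and 487 times 0.8107 is below 395, which leaves room for the added 2
     within 397 mu^2. *)
  { assert (n8 : 8 * INR n <= 0.8107 * m ^ 2) by (rewrite Em; nra).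
    assert (m5 : 0 < m ^ 5) by (apply pow_lt; lra).
    apply Rle_lt_trans with (exp m * (397 * m ^ 2 * exp (- h))).
    - replace (487 * (exp m * exp (- h)) * (8 * INR n) + 2 * (exp m * exp (- h)))
        with (exp m * ((487 * (8 * INR n) + 2) * exp (- h))) by ring.
      apply Rmult_le_compat_l; [lra|]. apply Rmult_le_compat_r; [lra|]. nra.
    - apply Rmult_lt_compat_l; [assumption|]. apply Rmult_lt_reg_r with (m ^ 5); [assumption|].
      rewrite Rinv_l by lra. rewrite <- ehh.
      replace (397 * m ^ 2 * exp (- h) * m ^ 5) with ((397 * m ^ 7) * exp (- h)) by ring.
      apply Rmult_lt_compat_r; assumption. }
  assert (A6 : Rabs (INR (pbar n) * (8 * INR n) - exp m * (1 - / m)) < exp m * / m ^ 5) by lra.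
  apply Rabs_lt_between in A6. unfold Lfac, Ufac.
  split; [apply div_lt_intro|apply lt_div_intro]; lra.
Qed.

(** [f_low n] is the product of the lower bounds of [pbar_large] at n - 1 and n + 1 over the square
    of the upper bound at n, and [g_up n] is the same with upper and lower exchanged. The index n -
    1 makes 1001 the first [n] covered. *)
Lemma bounds_large n : (1001 <= n)%nat -> f_low n < u_seq n < g_up n.
Proof.
  intros Hn. rewrite f_low_eq, g_up_eq by lia. unfold u_seq, nfac, wexp.
  pose proof (pbar_large (n - 1) ltac:(lia)) as Bx. pose proof (pbar_large n ltac:(lia)) as By.
  pose proof (pbar_large (n + 1) ltac:(lia)) as Bz.
  pose proof (mu_gt_3 (n - 1) ltac:(lia)) as x3. pose proof (mu_gt_3 n ltac:(lia)) as y3.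
  pose proof (mu_gt_3 (n + 1) ltac:(lia)) as z3.
  set (x := mu (n - 1)) in *. set (y := mu n) in *. set (z := mu (n + 1)) in *.
  assert (N2 : 2 <= INR n) by (apply (le_INR 2); lia).
  replace (INR (n - 1)) with (INR n - 1) in Bx by (rewrite minus_INR by lia; simpl; ring).
  replace (INR (n + 1)) with (INR n + 1) in Bz by (rewrite plus_INR; simpl; ring).
  set (N := INR n) in *.
  pose proof (Lfac_pos x ltac:(lra)) as LX. pose proof (Lfac_pos y ltac:(lra)) as LY. pose proof (Lfac_pos z ltac:(lra)) as LZ.
  pose proof (Ufac_pos x ltac:(lra)) as UX. pose proof (Ufac_pos y ltac:(lra)) as UY. pose proof (Ufac_pos z ltac:(lra)) as UZ.
  set (pm := INR (pbar (n - 1))) in *. set (p := INR (pbar n)) in *. set (pp := INR (pbar (n + 1))) in *.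
  pose proof (exp_pos x) as ex. pose proof (exp_pos y) as ey. pose proof (exp_pos z) as ez.
  assert (EW : exp (x - 2 * y + z) = exp x * exp z / (exp y * exp y)).
  { unfold Rdiv. rewrite Rinv_mult, <- !exp_Ropp, <- !exp_plus. f_equal. ring. }
  rewrite EW.
  assert (pos : forall e l c, 0 < e -> 0 < l -> 0 < c -> 0 < e * l / c)
    by (intros; apply Rdiv_lt_0_compat; [apply Rmult_lt_0_compat|]; assumption).
  pose proof (pos _ _ (8 * (N - 1)) ex LX ltac:(lra)) as lx0.
  pose proof (pos _ _ (8 * N) ey LY ltac:(lra)) as ly0.
  pose proof (pos _ _ (8 * (N + 1)) ez LZ ltac:(lra)) as lz0.
  assert (NN : 0 < N ^ 2 - 1) by nra.
  split.
  - replace (exp x * exp z / (exp y * exp y) * (N ^ 2 / (N ^ 2 - 1) * Lfac x * Lfac z / Ufac y ^ 2))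
      with (exp x * Lfac x / (8 * (N - 1)) * (exp z * Lfac z / (8 * (N + 1))) / (exp y * Ufac y / (8 * N)) ^ 2)
      by (field; repeat split; nra).
    apply lt_div_intro; [apply pow_lt; lra|].
    apply Rle_lt_trans with (exp x * Lfac x / (8 * (N - 1)) * (exp z * Lfac z / (8 * (N + 1)))).
    + set (A := exp x * Lfac x / (8 * (N - 1)) * (exp z * Lfac z / (8 * (N + 1)))).
      assert (A0 : 0 < A) by (apply Rmult_lt_0_compat; assumption).
      set (U := exp y * Ufac y / (8 * N)) in *.
      apply Rle_trans with (A / U ^ 2 * U ^ 2).
      * apply Rmult_le_compat_l; [left; apply Rdiv_lt_0_compat; [assumption|apply pow_lt; lra]|].
        apply pow_incr; lra.
      * right. field. lra.
    + apply Rmult_gt_0_lt_compat; lra.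
  - replace (exp x * exp z / (exp y * exp y) * (N ^ 2 / (N ^ 2 - 1) * Ufac x * Ufac z / Lfac y ^ 2))
      with (exp x * Ufac x / (8 * (N - 1)) * (exp z * Ufac z / (8 * (N + 1))) / (exp y * Lfac y / (8 * N)) ^ 2)
      by (field; repeat split; nra).
    apply div_lt_intro; [apply pow_lt; lra|].
    apply Rlt_le_trans with (exp x * Ufac x / (8 * (N - 1)) * (exp z * Ufac z / (8 * (N + 1)))).
    + apply Rmult_gt_0_lt_compat; lra.
    + set (A := exp x * Ufac x / (8 * (N - 1)) * (exp z * Ufac z / (8 * (N + 1)))).
      assert (A0 : 0 < A) by (apply Rmult_lt_0_compat; lra).
      set (L := exp y * Lfac y / (8 * N)) in *.
      apply Rle_trans with (A / L ^ 2 * L ^ 2).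
      * right. field. lra.
      * apply Rmult_le_compat_l; [left; apply Rdiv_lt_0_compat; [assumption|apply pow_lt; lra]|].
        apply pow_incr; lra.
Qed.

Theorem theorem3p1 : forall n : nat, (55 <= n)%nat -> f_low n < u_seq n < g_up n.
Proof.
  intros n Hn. destruct (Nat.le_gt_cases n 1000).
  - apply bounds_small. lia.
  - apply bounds_large. lia.
Qed.
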